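(* Let $p$ be a prime with $p\equiv 1\pmod 4$, let $t=\frac{p-1}{4}$, let $T$ be a generator of the character group $\widehat{\mathbb F_p^{\times}}$, and let $\lambda\in\mathbb F_p^{\times}$. Then \begin{align*} \#X_{\lambda}^4(\mathbb F_p)&=\frac{p^3-1}{p-1}+12p\,T^t(-1)\,T^{2t}(1-\lambda^4)\\ &\quad+{}_3G_3\left[\left.\begin{array}{ccc} 1/4&2/4&3/4\\ 0&0&0\end{array}\right|\lambda^4\right]_p+3p\,{}_2G_2\left[\left.\begin{array}{cc} 3/4&1/4\\ 0&2/4\end{array}\right|\lambda^4\right]_p. \end{align*}
   Context: For $\lambda\in\mathbb F_p$, $X_\lambda^4$ is the Dwork K3 surface in $\mathbb P^3$ defined by $x_1^4+x_2^4+x_3^4+x_4^4=4\lambda x_1x_2x_3x_4$, and $\#X_\lambda^4(\mathbb F_p)$ is its number of $\mathbb F_p$-rational points. Characters are extended to $\mathbb F_p$ by $\chi(0)=0$. Let $\omega$ be the Teichmüller character of $\mathbb F_p$ (values in $\mathbb Z_p$, $\omega(x)\equiv x\pmod p$), $\overline\omega=\omega^{-1}$, with $\overline\omega^j(0)=0$. $\Gamma_p$ is Morita's $p$-adic Gamma function. For $x\in\mathbb Q$, $\lfloor x\rfloor$ is the floor and $\langle x\rangle=x-\lfloor x\rfloor$. McCarthy's $p$-adic hypergeometric function is defined, for $a_i,b_i\in\mathbb Q\cap\mathbb Z_p$ and $u\in\mathbb F_p$, by $${}_nG_n\left[\left.\begin{array}{ccc}a_1&\ldots&a_n\\ b_1&\ldots&b_n\end{array}\right|u\right]_p:=\frac{-1}{p-1}\sum_{j=0}^{p-2}(-1)^{jn}\,\overline\omega^j(u)\prod_{i=1}^n\frac{\Gamma_p(\langle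 a_i-\frac{j}{p-1}\rangle)}{\Gamma_p(\langle a_i\rangle)}\frac{\Gamma_p(\langle -b_i+\frac{j}{p-1}\rangle)}{\Gamma_p(\langle -b_i\rangle)}(-p)^{-\lfloor\langle a_i\rangle-\frac{j}{p-1}\rfloor-\lfloor\langle -b_i\rangle+\frac{j}{p-1}\rfloor}.$$ *)

(* Defs.v *)
From HB Require Import structures.
From mathcomp Require Import all_boot all_order all_algebra all_field.
Unset Printing Implicit Defensive.
Import Order.TTheory GRing.Theory Num.Theory.
Local Open Scope ring_scope.

Definition fracq (x : rat) : rat := x - (Num.floor x)%:~R.

Definition morita_nat (p n : nat) : int :=
  (-1) ^+ n * \prod_(1 <= j < n | ~~ (p %| j)%N) (j%:Z).

(* p-adic numbers are handled through their residues modulo p^k (k >= 1):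
   an identity in Z_p holds iff it holds in 'Z_(p^k) for every k >= 1. *)

(* Residue mod p^k of a rational x in Z_p (denominator prime to p). *)
Definition ratZ (p k : nat) (x : rat) : 'Z_(p ^ k) :=
  (numq x)%:~R / (denq x)%:~R.

(* Residue mod p^k of Gamma_p(x), x in Q /\ Z_p: Gamma_p is the continuous
   extension of morita_nat, so Gamma_p(x) = Gamma_p(n) mod p^k for the
   integer representative n in [0,p^k) of x mod p^k. *)
Definition gammap (p k : nat) (x : rat) : 'Z_(p ^ k) :=
  (morita_nat p (nat_of_ord (ratZ p k x)))%:~R.

(* Residue mod p^k of the Teichmuller character: omega(u) = lim u^(p^m),
   and omega(u) = u^(p^(k-1)) mod p^k. *)
Definition teich (p k : nat) (u : 'F_p) : 'Z_(p ^ k) :=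
  ((nat_of_ord u)%:R) ^+ (p ^ k.-1).

Definition omegabar_pow (p k j : nat) (u : 'F_p) : 'Z_(p ^ k) :=
  if u == 0 then 0 else ((teich p k u)^-1) ^+ j.

Definition Gexp (p : nat) (a b : seq rat) (j : nat) : int :=
  \sum_(i < size a)
    (- Num.floor (fracq a`_i - j%:R / (p.-1)%:R)
     - Num.floor (fracq (- b`_i) + j%:R / (p.-1)%:R)).

Definition Gfactor (p k : nat) (a b : seq rat) (j : nat) : 'Z_(p ^ k) :=
  \prod_(i < size a)
    (gammap p k (fracq (a`_i - j%:R / (p.-1)%:R)) / gammap p k (fracq a`_i)
     * (gammap p k (fracq (- b`_i + j%:R / (p.-1)%:R))
        / gammap p k (fracq (- b`_i)))).

(* Residue mod p^k of  p^s * nGn[a_1..a_n ; b_1..b_n | u]_p  (n = size a).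
   Each exponent of (-p) is >= -1 per index, so for s >= n the quantity
   lies in Z_p and p^s*(-p)^E = (-1)^E p^(s+E) with s+E >= 0. *)
Definition Gscaled (p k s : nat) (a b : seq rat) (u : 'F_p) : 'Z_(p ^ k) :=
  - ((p.-1)%:R)^-1 *
  \sum_(j < p.-1)
    ((-1) ^+ (j * size a) * omegabar_pow p k j u * Gfactor p k a b j
     * (-1) ^+ absz (Gexp p a b j) * (p%:R) ^+ absz (s%:Z + Gexp p a b j)).

(* Number of F_p-points of the Dwork surface X_lam^4 in P^3: points of P^3
   are represented by the vectors whose first nonzero coordinate is 1. *)
Definition dwork_count (p : nat) (lam : 'F_p) : nat :=
  #|[set x : {ffun 'I_4 -> 'F_p} |
      (if [pick i | x i != 0] is Some i then x i == 1 else false)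
      && (\sum_i x i ^+ 4 == 4%:R * lam * \prod_i x i)]|.

(* Main.v *)
Require Import Defs.
From HB Require Import structures.
From mathcomp Require Import all_boot all_order all_algebra all_fingroup all_solvable all_field.
From mathcomp Require Import ring lra zify.
Set Implicit Arguments.
Unset Strict Implicit.
Unset Printing Implicit Defensive.
Import Order.TTheory GRing.Theory Num.Theory.
Local Open Scope ring_scope.

(* Everything is computed in S = (Z/p^k)[pi] / (pi^(p-1) + p). Dwork's exponential
   exp (pi (x - x^p)) at Teichmueller representatives gives an additive character
   psi of F_p, and its Gauss sums g(a), formed with the powers of the inverse
   Teichmueller character, are g(a) = - pi^a Gamma_p(a / (p-1)) (Gross-Koblitz).
   For the latter, p-adic Gamma values satisfy
     Gamma_p(a / (p-1)) = sum_j p^j d_(a+pj) (a/(p-1))_j,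
   where d_n are the Taylor coefficients of exp (y + y^p / p), by interpolation from
   negative integers; this series is the action on a one-dimensional cokernel of an
   operator with matrix ((-p)^j d_(a+pj-i)), whose trace is the sum coming from g(a).

   Fourier expansion of the number of affine zeros of the Dwork quartic gives, for
   each j modulo t = (p-1)/4, the coefficient of w^0 in
   (g(j) + g(j+t) w + g(j+2t) w^2 + g(j+3t) w^3)^4 modulo w^4 = 1. By the reflection
   and multiplication formulas for Gauss sums the fourth powers yield 3G3, the
   terms g(j)^2 g(j+2t)^2 yield 2G2, and the terms g(j)^2 g(j+t) g(j+3t) reduce to
   Jacobi-type sums that add up to the quadratic character of 1 - lam^4. The block
   j = 0, where reflection fails, is computed directly. *)

(** * p-integral rationals modulo p^k *)

(** Every ring in play is killed by a power of p, so p, pi and the Gauss sums of nontrivial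
    characters are nilpotent and can never be cancelled. This shapes the proof. A step that needs a
    division is carried out between p-adic Gamma values, which are units, or over the rationals
    before reduction; a relation in S descends to Z/p^k by removing a power pi^c with c < p-1, S
    being free on these powers. Reflection consumes factors p, and the comparison of the point count
    with the hypergeometric sums is proved after multiplication by p^3, the factor that the
    statement carries. The numbers d_n have denominators. Convergence rests on one estimate: d_n
    p^floor(3n/(4p)) is p-integral. Since 3/(4p) < 1/(p-1), the product d_n pi^n makes sense in S,
    vanishes for large n and is divisible by pi^2 for n >= 2. The estimate comes from the recurrence
    n d_n = d_(n-1) + d_(n-p) and Wilson's theorem. The constants use p >= 5, which p = 1 modulo 4
    ensures. *)

Definition plocal_pred (p : nat) : pred rat := fun q => coprime p `|denq q|%N.
Arguments plocal_pred p q /.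
Definition plocal (p : nat) := [qualify a q : rat | plocal_pred p q].

Lemma plocal_frac (p : nat) (u v : int) :
  coprime p `|v|%N -> (u%:~R / v%:~R : rat) \is a plocal p.
Proof.
move=> cv; rewrite qualifE /=; set q := _ / _.
have [v0|v0] := eqVneq v 0.
  by rewrite /q v0 invr0 mulr0 coprimen1.
have e : (numq q * v = u * denq q)%R.
  apply/eqP; rewrite -(eqr_int rat) !intrM numqE /q mulrAC divfK ?intr_eq0 //; exact: v0.
apply: (coprime_dvdr _ cv).
have c : coprime `|denq q| `|numq q| by rewrite coprime_sym coprime_num_den.
rewrite -(Gauss_dvdr _ c) -abszM e abszM; exact: dvdn_mull.
Qed.

Lemma plocal_subring_closed (p : nat) : subring_closed (plocal_pred p).
Proof.
have E q : plocal_pred p q = (q \is a plocal p) by rewrite qualifE.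
have D q : q = (numq q)%:~R / (denq q)%:~R by rewrite divq_num_den.
have N q : (denq q)%:~R != 0 :> rat by rewrite intr_eq0 denq_neq0.
split=> [|x y|x y]; rewrite !unfold_in /=.
- by rewrite coprimen1.
- move=> cx cy.
  have -> : x - y = (numq x * denq y - numq y * denq x)%:~R
                     / (denq x * denq y)%:~R.
    rewrite {1}(D x) {1}(D y) intrB !intrM.
    by field; rewrite !N.
  by have := @plocal_frac p (numq x * denq y - numq y * denq x)
    (denq x * denq y); rewrite qualifE /=; apply; rewrite abszM coprimeMr cx.
- move=> cx cy.
  have -> : x * y = (numq x * numq y)%:~R / (denq x * denq y)%:~R.
    rewrite {1}(D x) {1}(D y) !intrM.
    by field; rewrite !N.
  by have := @plocal_frac p (numq x * numq y)
    (denq x * denq y); rewrite qualifE /=; apply; rewrite abszM coprimeMr cx.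
Qed.

HB.instance Definition _ (p : nat) :=
  GRing.isSubringClosed.Build rat (plocal_pred p) (plocal_subring_closed p).

Lemma plocalVn (p n : nat) : coprime p n -> (n%:R^-1 : rat) \is a plocal p.
Proof. by move=> c; have := @plocal_frac p 1 n c; rewrite div1r. Qed.

Section Residue.
Variables (p k : nat).
Hypotheses (p_gt1 : (1 < p)%N) (k_gt0 : (0 < k)%N).
Let R := 'Z_(p ^ k).

Lemma pk_gt1 : (1 < p ^ k)%N.
Proof. by rewrite -(exp1n k) ltn_exp2r. Qed.

Lemma natZ_unit n : coprime p n -> (n%:R : R) \is a GRing.unit.
Proof. by move=> c; rewrite unitZpE ?pk_gt1 // coprimeXl. Qed.

Lemma intZ_unit (v : int) : coprime p `|v|%N -> (v%:~R : R) \is a GRing.unit.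
Proof.
move=> c; rewrite [v]intEsign intrM rmorphXn /= rmorphN1 unitrM unitrX ?unitrN1 //=.
exact: natZ_unit.
Qed.

Lemma ratZE (q : rat) (u v : int) : q \is a plocal p ->
  q * v%:~R = u%:~R -> ratZ p k q * v%:~R = u%:~R.
Proof.
rewrite qualifE /= => /intZ_unit c e; apply: (mulIr c).
rewrite /ratZ mulrAC divrK // -!intrM; congr (_%:~R).
apply/eqP; rewrite -(eqr_int rat) !intrM numqE -e; apply/eqP.
by rewrite mulrAC.
Qed.

Lemma ratZ_eq (q : rat) (x : R) (v : int) : q \is a plocal p ->
  coprime p `|v|%N -> forall u : int, q * v%:~R = u%:~R -> x * v%:~R = u%:~R ->
  ratZ p k q = x.
Proof.
move=> ql /intZ_unit c u e ex; apply: (mulIr c).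
by rewrite (ratZE ql e).
Qed.

Lemma ratZ_int (n : int) : ratZ p k n%:~R = n%:~R.
Proof. by rewrite /ratZ numq_int denq_int divr1. Qed.

Lemma ratZ_nat (n : nat) : ratZ p k n%:R = n%:R.
Proof. by rewrite (ratZ_int n). Qed.

Lemma ratZD (x y : rat) : x \is a plocal p -> y \is a plocal p ->
  ratZ p k (x + y) = ratZ p k x + ratZ p k y.
Proof.
move=> lx ly; have := lx; have := ly; rewrite ![_ \is a plocal p]qualifE /=.
move=> cy cx.
apply: (@ratZ_eq _ _ (denq x * denq y) _ _
  (numq x * denq y + numq y * denq x)); first by rewrite rpredD.
- by rewrite abszM coprimeMr cx.
- by rewrite intrD !intrM !numqE; ring.
- have := ratZE lx (esym (numqE x)); have := ratZE ly (esym (numqE y)).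
  by rewrite intrD !intrM => <- <-; ring.
Qed.

Lemma ratZM (x y : rat) : x \is a plocal p -> y \is a plocal p ->
  ratZ p k (x * y) = ratZ p k x * ratZ p k y.
Proof.
move=> lx ly; have := lx; have := ly; rewrite ![_ \is a plocal p]qualifE /=.
move=> cy cx.
apply: (@ratZ_eq _ _ (denq x * denq y) _ _
  (numq x * numq y)); first by rewrite rpredM.
- by rewrite abszM coprimeMr cx.
- by rewrite !intrM !numqE; ring.
- have := ratZE lx (esym (numqE x)); have := ratZE ly (esym (numqE y)).
  by rewrite !intrM => <- <-; ring.
Qed.

Lemma ratZN (x : rat) : x \is a plocal p -> ratZ p k (- x) = - ratZ p k x.
Proof.
move=> lx; rewrite -mulN1r ratZM ?rpredN1 //.
by rewrite (ratZ_int (-1)) rmorphN1 mulN1r.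
Qed.

Lemma ratZ_sum I (r : seq I) (P : pred I) (F : I -> rat) :
  (forall i, P i -> F i \is a plocal p) ->
  ratZ p k (\sum_(i <- r | P i) F i) = \sum_(i <- r | P i) ratZ p k (F i).
Proof.
move=> lF; elim: r => [|i r IH]; first by rewrite !big_nil (ratZ_int 0).
rewrite !big_cons; case: ifP => // Pi.
by rewrite ratZD ?IH ?lF //; apply: rpred_sum.
Qed.

Lemma ratZX (x : rat) n : x \is a plocal p -> ratZ p k (x ^+ n) = ratZ p k x ^+ n.
Proof.
move=> lx; elim: n => [|n IH]; first by rewrite (ratZ_int 1).
by rewrite !exprS ratZM ?IH ?rpredX.
Qed.

Lemma ratZ_sign (x : rat) n : x \is a plocal p ->
  ratZ p k ((-1) ^+ n * x) = (-1) ^+ n * ratZ p k x.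
Proof.
move=> lx; rewrite ratZM ?rpredX ?rpredN1 // ratZX ?rpredN1 //.
by rewrite (ratZ_int (-1)) rmorphN1.
Qed.

Lemma pZ_eq0 n : (k <= n)%N -> (p%:R : R) ^+ n = 0.
Proof.
move=> kn; rewrite -(subnKC kn) exprD -natrX pchar_Zp ?mul0r //.
exact: pk_gt1.
Qed.

Lemma ratZ_pX n (x : rat) : x \is a plocal p -> (k <= n)%N ->
  ratZ p k (p%:R ^+ n * x) = 0.
Proof.
move=> lx kn; rewrite ratZM ?rpredX ?rpred_nat //.
by rewrite ratZX ?rpred_nat // ratZ_nat pZ_eq0 ?mul0r.
Qed.

End Residue.

(** * Taylor coefficients of Dwork's exponential *)

Definition exp_coef (n : nat) : rat := (n`!%:R)^-1.

(** Taylor coefficients of exp (y^p / p), the second factor of exp (y + y^p / p). *)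
Definition exp_frob_coef (p n : nat) : rat :=
  if (p %| n)%N then exp_coef (n %/ p) / p%:R ^+ (n %/ p) else 0.

(* Taylor coefficients of exp (y + y^p / p) *)
Definition dwork_coef (p n : nat) : rat :=
  \sum_(i < n.+1) exp_coef i * exp_frob_coef p (n - i).

Lemma exp_coefS n : n.+1%:R * exp_coef n.+1 = exp_coef n.
Proof.
rewrite /exp_coef factS natrM invfM mulrA divff ?mul1r // pnatr_eq0 //.
Qed.

Lemma exp_coef0 : exp_coef 0 = 1. Proof. by rewrite /exp_coef fact0 invr1. Qed.

Section DworkCoef.
Variable p : nat.
Hypothesis p_prime : prime p.
Let p_gt0 : (0 < p)%N := prime_gt0 p_prime.
Let p_gt1 : (1 < p)%N := prime_gt1 p_prime.
Let pr0 : p%:R != 0 :> rat.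
Proof. by rewrite pnatr_eq0 -lt0n. Qed.

Let d := dwork_coef p.
Let h := exp_frob_coef p.

(** Coefficient form of y F' = y^p F for F = exp (y^p / p). *)
Lemma exp_frob_coefD n : (n + p)%:R * h (n + p) = h n.
Proof.
rewrite /h /exp_frob_coef dvdn_addl ?dvdnn //.
case: ifP => [/dvdnP [m ->]|_]; last by rewrite mulr0.
rewrite -mulSnr !mulnK // -(exp_coefS m) exprS natrM.
by field; rewrite expf_neq0.
Qed.

Lemma exp_frob_coef_lt n : (n < p)%N -> n%:R * h n = 0.
Proof.
move=> np; rewrite /h /exp_frob_coef.
case: ifP => [/dvdnP [[|m] e]|_]; rewrite ?mulr0 // e ?mul0r //.
by move: np; rewrite e mulSn -ltn_subRL subnn.
Qed.

Lemma dwork_coef0 : d 0 = 1.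
Proof.
rewrite /d /dwork_coef big_ord1 /exp_frob_coef dvdn0 div0n expr0 exp_coef0.
by rewrite invr1 !mulr1.
Qed.

Lemma dwork_coef_split n : n.+1%:R * d n.+1 =
  d n + \sum_(i < n.+2) exp_coef i * ((n.+1 - i)%:R * h (n.+1 - i)).
Proof.
rewrite /d /dwork_coef mulr_sumr.
have E (i : 'I_n.+2) : n.+1%:R * (exp_coef i * h (n.+1 - i)) =
   i%:R * exp_coef i * h (n.+1 - i) +
   exp_coef i * ((n.+1 - i)%:R * h (n.+1 - i)).
  rewrite natrB; last by rewrite -ltnS.
  move: (exp_coef i) (h _) => x y.
  by move: (n.+1%:R : rat) (i%:R : rat) => u v; ring.
rewrite (eq_bigr _ (fun i _ => E i)) big_split /=; congr (_ + _).
rewrite big_ord_recl (_ : (ord0 : nat)%:R = 0) // !mul0r add0r; apply: eq_bigr => i _.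
by rewrite lift0 exp_coefS subSS.
Qed.

Lemma dwork_coefS_lt n : (n.+1 < p)%N -> n.+1%:R * d n.+1 = d n.
Proof.
move=> np; rewrite dwork_coef_split big1 ?addr0 // => i _.
by rewrite exp_frob_coef_lt ?mulr0 //; lia.
Qed.

(** Coefficient of y^(n+p) in y E' = (y + y^p) E, where E = exp (y + y^p / p). Both the p-adic
    estimates and the functional equation of the Gamma series rest on this recurrence. *)
Lemma dwork_coefD n : (n + p)%:R * d (n + p) = d (n + p).-1 + d n.
Proof.
have e : (n + p = (n + p).-1.+1)%N by lia.
rewrite {1 2}e dwork_coef_split -e; congr (_ + _).
rewrite [RHS]/d /dwork_coef.
rewrite -(big_mkord predT (fun i => exp_coef i * ((n + p - i)%:R * h (n + p - i)))).
rewrite (big_cat_nat (n := n.+1)) //=; last by lia.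
rewrite big_mkord [X in _ + X]big1_seq ?addr0.
  apply: eq_bigr => i _; congr (_ * _).
  have li := ltn_ord i; rewrite (_ : n + p - i = n - i + p)%N; last by lia.
  exact: exp_frob_coefD.
move=> i; rewrite mem_index_iota => /andP[_ /andP [i1 i2]].
by rewrite exp_frob_coef_lt ?mulr0 //; lia.
Qed.

(** With the sign (-1)^k, these are the Mahler coefficients of m |-> Gamma_p(-a - p m). The factor
    k! turns binomial coefficients into Pochhammer symbols: (-1)^k C(m,k) k! = (-m)_k. *)
Definition dwork_fact (a k : nat) : rat := k`!%:R * p%:R ^+ k * d (a + p * k).
Let B := dwork_fact.

Lemma dwork_fact00 : B 0 0 = 1.
Proof. by rewrite /B /dwork_fact muln0 dwork_coef0 fact0 expr0 !mul1r. Qed.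

Lemma dwork_factS a k : (a.+1 < p)%N ->
  (a.+1 + p * k)%:R * B a.+1 k = B a k + (p * k)%:R * B a.+1 k.-1.
Proof.
move=> ap; rewrite /B /dwork_fact mulrCA; case: k => [|k] /=.
  by rewrite !muln0 mul0r addr0 !addn0 dwork_coefS_lt // expr0.
rewrite mulnSr addnA dwork_coefD (_ : _.-1 = a + p * k + p)%N; last by lia.
rewrite factS exprS !natrM addnA; ring.
Qed.

Lemma dwork_fact0S k : B 0 k.+1 = B p.-1 k + B 0 k.
Proof.
rewrite /B /dwork_fact !add0n mulnSr.
have := dwork_coefD (p * k).
rewrite (_ : (p * k + p).-1 = p.-1 + p * k)%N; last by lia.
move=> e; rewrite -mulrDr -e factS exprS natrM.
rewrite (_ : (p * k + p = p * k.+1)%N); last by lia.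
by rewrite natrM; ring.
Qed.

(** * Divisibility of the Mahler coefficients by powers of p *)

Definition pdivs (e : nat) (q : rat) := q / p%:R ^+ e \is a plocal p.

Lemma pdivsD e x y : pdivs e x -> pdivs e y -> pdivs e (x + y).
Proof. by rewrite /pdivs mulrDl; apply: rpredD. Qed.
Lemma pdivsN e x : pdivs e (- x) = pdivs e x.
Proof. by rewrite /pdivs mulNr rpredN. Qed.
Lemma pdivsB e x y : pdivs e x -> pdivs e y -> pdivs e (x - y).
Proof. by move=> hx hy; apply: pdivsD => //; rewrite pdivsN. Qed.
Lemma pdivsMl e x y : x \is a plocal p -> pdivs e y -> pdivs e (x * y).
Proof. by move=> hx hy; rewrite /pdivs -mulrA rpredM. Qed.
Lemma pdivs_p e (n : nat) x : pdivs e x -> pdivs e.+1 ((p * n)%:R * x).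
Proof.
rewrite /pdivs => hx; rewrite natrM exprS invfM.
rewrite (_ : _ * _ = n%:R * (x / p%:R ^+ e)); first by rewrite rpredM ?rpred_nat.
by field; rewrite expf_neq0.
Qed.
Lemma pdivs_le e f x : (f <= e)%N -> pdivs e x -> pdivs f x.
Proof.
move=> fe; rewrite /pdivs -(subnK fe) exprD => hx.
have -> : x / p%:R ^+ f = p%:R ^+ (e - f) * (x / (p%:R ^+ (e - f) * p%:R ^+ f)).
  by field; rewrite !expf_neq0.
by rewrite rpredM ?rpredX ?rpred_nat.
Qed.
Lemma pdivs_unit e n x : coprime p n -> pdivs e (n%:R * x) -> pdivs e x.
Proof.
move=> c hx; rewrite (_ : x = n%:R^-1 * (n%:R * x)).
  by apply: pdivsMl => //; apply: plocalVn.
rewrite mulKf // pnatr_eq0; apply: contraTneq c => ->.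
by rewrite /coprime gcdn0; apply/eqP; lia.
Qed.

Lemma coprime_lt a : (0 < a < p)%N -> coprime p a.
Proof. by move=> /andP[a0 ap]; rewrite prime_coprime // gtnNdvd. Qed.

Lemma coprime_ltD a k : (0 < a < p)%N -> coprime p (a + p * k).
Proof. by move=> ha; rewrite mulnC addnC /coprime gcdnMDl -/(coprime p a) coprime_lt. Qed.

(** Modulo the target power of p the recurrence reads (a+1) B(a+1,k) = B(a,k), so a! B(a,k) =
    B(0,k). At a = p-1 Wilson's theorem gives B(0,k+1) = B(p-1,k) + B(0,k) = 0, and this spreads to
    all B(a,k+1). The neglected terms p k B(a,k-1) gain only one factor p over two values of k,
    whence the exponent [uphalf]. *)
Lemma pdivs_dwork_fact_step k :
  (forall a, (a < p)%N -> pdivs (uphalf k) (B a k)) ->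
  (forall a, (a < p)%N -> pdivs (uphalf k.+1) ((p * k)%:R * B a k.-1)) ->
  forall a, (a < p)%N -> pdivs (uphalf k.+1) (B a k.+1).
Proof.
move=> H1 H2.
have H1' n a : (a < p)%N -> pdivs (uphalf k.+1) ((p * n)%:R * B a k).
  by move=> ap; apply: (@pdivs_le (uphalf k).+1); [lia | apply: pdivs_p; exact: H1].
have E a : (a < p)%N -> pdivs (uphalf k.+1) (a`!%:R * B a k - B 0 k).
  elim: a => [_|a IH ap]; first by rewrite fact0 mul1r subrr /pdivs mul0r rpred0.
  have -> : a.+1`!%:R * B a.+1 k - B 0 k =
     (a`!%:R * B a k - B 0 k) + a`!%:R * ((p * k)%:R * B a.+1 k.-1)
     - a`!%:R * ((p * k)%:R * B a.+1 k).
    have e := dwork_factS k ap; rewrite natrD mulrDl in e.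
    rewrite factS natrM; move/eqP: e; rewrite -subr_eq => /eqP e.
    have -> : a.+1%:R * a`!%:R * B a.+1 k = a`!%:R * (a.+1%:R * B a.+1 k) by ring.
    rewrite -[a.+1%:R * _](addrK ((p * k)%:R * B a.+1 k)) -[X in _ = X + _]addrA.
    move/eqP: e; rewrite subr_eq => /eqP e.
    rewrite (_ : a.+1%:R * B a.+1 k + (p * k)%:R * B a.+1 k =
      B a k + (p * k)%:R * B a.+1 k.-1); first by ring.
    by rewrite -e; ring.
  apply: pdivsB; last by apply: pdivsMl; rewrite ?rpred_nat //; apply: H1'.
  apply: pdivsD; first by apply: IH; lia.
  by apply: pdivsMl; rewrite ?rpred_nat //; apply: H2.
have B0 : pdivs (uphalf k.+1) (B 0 k.+1).
  rewrite dwork_fact0S.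
  have /dvdnP [m em] : (p %| p.-1`!.+1)%N by rewrite -Wilson.
  have -> : B p.-1 k + B 0 k = (p * m)%:R * B p.-1 k - (p.-1`!%:R * B p.-1 k - B 0 k).
    by rewrite (mulnC p) -em -natr1; ring.
  by apply: pdivsB; [apply: H1' | apply: E]; lia.
elim=> [//|a IH] ap.
apply: (@pdivs_unit _ (a.+1 + p * k.+1)); first by apply: coprime_ltD; lia.
by rewrite dwork_factS //; apply: pdivsD; [apply: IH; lia | apply: H1'].
Qed.

Lemma pdivs_dwork_fact k : forall a, (a < p)%N -> pdivs (uphalf k) (B a k).
Proof.
(* Two consecutive values of k are carried along, because the step uses B at k and at k-1. *)
suff H : (forall a, (a < p)%N -> pdivs (uphalf k) (B a k)) /\
         (forall a, (a < p)%N -> pdivs (uphalf k.+1) (B a k.+1)) by case: H.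
elim: k => [|k [H1 H2]].
  have H0 : forall a, (a < p)%N -> pdivs (uphalf 0) (B a 0).
    elim=> [|a IH] ap; first by rewrite dwork_fact00 /pdivs divr1 rpred1.
    apply: (@pdivs_unit _ (a.+1 + p * 0)); first by apply: coprime_ltD; lia.
    by rewrite dwork_factS // muln0 mul0r addr0; apply: IH; lia.
  split=> //; apply: pdivs_dwork_fact_step => // a ap.
  by rewrite muln0 mul0r /pdivs mul0r rpred0.
split=> //; apply: pdivs_dwork_fact_step => //= a ap.
by apply: (@pdivs_le (uphalf k).+1); [lia | apply: pdivs_p; apply: H1].
Qed.

(** Legendre's bound v_p(k!) <= k/(p-1) with 4 <= p-1, by induction through v_p(k!) = floor(k/p) +
    v_p(floor(k/p)!). *)
Lemma logn_fact_le k : (4 < p)%N -> (4 * logn p k`! <= k)%N.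
Proof.
move=> p4; elim/ltn_ind: k => k IH.
have [->|k0] := posnP k; first by rewrite logn1.
have e : (logn p k`! = k %/ p + logn p (k %/ p)`!)%N.
  rewrite !logn_fact //; case: k k0 {IH} => // k _.
  rewrite big_ltn // expn1; congr (_ + _)%N.
  rewrite big_add1 /=.
  have lt : (k.+1 %/ p < k.+1)%N by rewrite ltn_Pdiv.
  rewrite [RHS](_ : _ = \sum_(1 <= i < k.+1) k.+1 %/ p %/ p ^ i)%N.
    by apply: eq_bigr => i _; rewrite -divnMA expnS.
  rewrite [RHS](big_cat_nat (n := (k.+1 %/ p).+1)) //=.
  rewrite [X in (_ + X)%N]big1_seq ?addn0 // => i.
  rewrite mem_index_iota => /andP[_ /andP[i1 _]]; apply: divn_small.
  by apply: leq_trans i1 _; rewrite ltnW // ltn_expl.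
have lt : (k %/ p < k)%N by rewrite ltn_Pdiv.
have := IH _ lt; have := leq_trunc_div k p.
rewrite e; nia.
Qed.

(** Write n = a + p k. In d_n = B(a,k) / (k! p^k) the denominator costs at most k + k/4 factors p
    and B(a,k) returns k/2 of them; this is the origin of 3/4. *)
Lemma plocal_dwork_coef n : (4 < p)%N ->
  d n * p%:R ^+ ((3 * n) %/ (4 * p)) \is a plocal p.
Proof.
move=> p4; set b := (_ %/ _)%N.
have e : n = (n %% p + p * (n %/ p))%N by rewrite {1}(divn_eq n p); lia.
set a := (n %% p)%N in e; set k := (n %/ p)%N in e.
have ap : (a < p)%N by rewrite ltn_mod.
have := pdivs_dwork_fact k ap; rewrite /pdivs; set r := _ / _ => hr.
have er : B a k = r * p%:R ^+ uphalf k by rewrite divfK // expf_neq0.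
have v4 := logn_fact_le k p4.
have [m cm em] := pfactor_coprime p_prime (fact_gt0 k).
set v := logn p k`! in em v4.
have bk : ((3 * k) %/ 4 <= b)%N.
  rewrite /b leq_divRL ?muln_gt0 // mulnA.
  apply: (@leq_trans (3 * k * p)); first by rewrite leq_mul2r leq_trunc_div orbT.
  by rewrite e; lia.
have le : (k + v <= uphalf k + b)%N by lia.
have m0 : m%:R != 0 :> rat.
  by rewrite pnatr_eq0; apply: contraTneq cm => ->; rewrite /coprime gcdn0; lia.
have -> : d n * p%:R ^+ b = r * m%:R^-1 * p%:R ^+ (uphalf k + b - (k + v)).
  apply: (mulfI (_ : p%:R ^+ (k + v) * m%:R != 0)).
    by rewrite mulf_neq0 ?expf_neq0.
  have -> : p%:R ^+ (k + v) * m%:R * (d n * p%:R ^+ b) = B a k * p%:R ^+ b.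
    by rewrite /B /dwork_fact em natrM natrX -e exprD; ring.
  have ex : p%:R ^+ uphalf k * p%:R ^+ b =
    p%:R ^+ (k + v) * p%:R ^+ (uphalf k + b - (k + v)) :> rat.
    by rewrite -!exprD (subnKC le).
  transitivity (r * (p%:R ^+ uphalf k * p%:R ^+ b)); first by rewrite er mulrA.
  rewrite ex; move: (p%:R ^+ _) (p%:R ^+ _) => x y.
  by field.
apply: rpredM; last by rewrite rpredX // rpred_nat.
by apply: rpredM; [exact: hr | apply: plocalVn].
Qed.

End DworkCoef.

(** * Series for the p-adic Gamma function *)

Definition unit_fact (p n : nat) : nat := \prod_(0 <= j < n | ~~ (p %| j)%N) j.

Lemma morita_natE p n : morita_nat p n = (-1) ^+ n * (unit_fact p n)%:Z.
Proof.
rewrite /morita_nat /unit_fact; congr (_ * _).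
case: n => [|n]; first by rewrite !big_geq.
rewrite [in RHS]big_ltn_cond // dvdn0 /=.
by rewrite (big_morph Posz PoszM (erefl : Posz 1 = 1)).
Qed.

Lemma unit_factS p n : unit_fact p n.+1 = (unit_fact p n * (if (p %| n)%N then 1 else n))%N.
Proof.
rewrite /unit_fact big_mkcond big_nat_recr //= -big_mkcond /=.
by case: (p %| n)%N.
Qed.

Section GammaSeries.
Variable p : nat.
Hypothesis p_prime : prime p.
Let p_gt0 : (0 < p)%N := prime_gt0 p_prime.
Let p_gt1 : (1 < p)%N := prime_gt1 p_prime.
Let d := dwork_coef p.
Let B := dwork_fact p.

(* Mahler expansion of Gamma_p(- a - p m) as a function of m *)
Definition gamma_mahler (a m : nat) : rat :=
  \sum_(k < m.+1) (-1) ^+ k * 'C(m, k)%:R * B a k.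
Let f := gamma_mahler.

(** How multiplication by m acts on a Mahler expansion: split m = k + (m-k) and use (m-k) C(m,k) =
    (k+1) C(m,k+1). *)
Lemma mahler_shift (u : nat -> rat) m :
  \sum_(k < m.+1) (-1) ^+ k * 'C(m, k)%:R * (k%:R * u k - k%:R * u k.-1) =
  m%:R * \sum_(k < m.+1) (-1) ^+ k * 'C(m, k)%:R * u k.
Proof.
under eq_bigr => k _ do rewrite mulrBr.
rewrite sumrB [X in _ - X](_ : _ =
   - \sum_(k < m.+1) (-1) ^+ k * ((m - k) * 'C(m, k))%:R * u k); last first.
  rewrite big_ord_recl /= mul0r mulr0 add0r.
  rewrite [in RHS]big_ord_recr /= subnn mul0n mulr0 mul0r addr0 -sumrN.
  apply: eq_bigr => k _; rewrite /bump /= add1n add0n -mul_bin_left exprS natrM; ring.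
rewrite opprK -big_split mulr_sumr; apply: eq_bigr => k _ /=.
have lk := ltn_ord k; rewrite natrM.
have -> : m%:R = k%:R + (m - k)%:R :> rat by rewrite -natrD; congr (_%:R); lia.
move: (_%:R) (_%:R) (_%:R) (u k) (_ ^+ k) => x y z w v; ring.
Qed.

(** The functional equation Gamma_p(x+1) = -x Gamma_p(x) at the p-adic unit x = -(a+1) - p m. *)
Lemma gamma_mahlerS a m : (a.+1 < p)%N -> (a.+1 + p * m)%:R * f a.+1 m = f a m.
Proof.
move=> ap; rewrite natrD mulrDl natrM -mulrA -mahler_shift mulr_sumr.
rewrite /f /gamma_mahler mulr_sumr -big_split /=; apply: eq_bigr => k _.
have := dwork_factS p_prime k ap; rewrite -/B natrD natrM => e.
rewrite (_ : B a k = (a.+1%:R + p%:R * k%:R) * B a.+1 k - p%:R * k%:R * B a.+1 k.-1).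
  move: (B _ _) (B _ _) (_%:R) (_%:R) (_%:R) (_%:R) (_ ^+ _) => *; ring.
by rewrite e addrK.
Qed.

(** The other case of the functional equation, Gamma_p(x+1) = -Gamma_p(x) when p divides x, here x =
    -p(m+1). Pascal's rule combines with the passage from residue p-1 to residue 0. *)
Lemma gamma_mahler0S m : f 0 m.+1 = - f p.-1 m.
Proof.
rewrite /f /gamma_mahler big_ord_recl bin0.
under eq_bigr => k _.
  rewrite lift0 binS natrD mulrDr mulrDl; over.
rewrite big_split /= addrA [X in X + _](_ : _ = f 0 m); last first.
  rewrite /f /gamma_mahler [in RHS]big_ord_recl bin0; congr (_ + _).
  rewrite big_ord_recr /= bin_small // mulr0 mul0r addr0.
  by apply: eq_bigr => k _; rewrite /bump /= add1n.
rewrite [X in _ + X](_ : _ = - f 0 m - f p.-1 m); first by rewrite addrA subrr add0r.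
rewrite -opprD addrC -big_split /= -sumrN; apply: eq_bigr => k _.
rewrite /B dwork_fact0S // exprS.
move: (dwork_fact _ _ _) (dwork_fact _ _ _) (_%:R) (_ ^+ _) => *; ring.
Qed.

Lemma gamma_mahlerE m a : (a < p)%N -> f a m * (unit_fact p (a + p * m).+1)%:R = (-1) ^+ m.
Proof.
have S n l : (n.+1 < p)%N -> f n l * (unit_fact p (n + p * l).+1)%:R = (-1) ^+ l ->
   f n.+1 l * (unit_fact p (n.+1 + p * l).+1)%:R = (-1) ^+ l.
  move=> np <-; rewrite -(gamma_mahlerS l np) unit_factS.
  have -> : (p %| n.+1 + p * l)%N = false.
    by rewrite dvdn_addl ?dvdn_mulr // gtnNdvd.
  by rewrite addSn natrM; move: (f _ _) (_%:R) (_%:R) => *; ring.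
elim: m a => [|m IH].
  elim=> [_|a IHa ap]; last by apply: S => //; apply: IHa; lia.
  by rewrite muln0 unit_factS dvdn0 /unit_fact big_geq // mulr1 /f /gamma_mahler
    big_ord1 bin0 /B dwork_fact00 // !mulr1.
elim=> [_|a IHa ap]; last by apply: S => //; apply: IHa; lia.
rewrite gamma_mahler0S add0n unit_factS dvdn_mulr // muln1 mulnSr.
rewrite (_ : (p * m + p = (p.-1 + p * m).+1)%N); last by lia.
by rewrite mulNr IH ?exprS ?mulN1r //; lia.
Qed.

Lemma pdivs_dwork_coef n j e : (4 < p)%N -> ((3 * n) %/ (4 * p) + e <= j)%N ->
  pdivs p e (p%:R ^+ j * d n).
Proof.
move=> p4 le; have := plocal_dwork_coef p_prime n p4; rewrite -/d => H.
have pr0 : p%:R != 0 :> rat by rewrite pnatr_eq0 -lt0n.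
rewrite /pdivs -(subnKC le) !exprD.
rewrite (_ : _ / _ = p%:R ^+ (j - ((3 * n) %/ (4 * p) + e)) *
   (d n * p%:R ^+ ((3 * n) %/ (4 * p)))); first by rewrite rpredM // rpredX // rpred_nat.
have : p%:R ^+ e != 0 :> rat by rewrite expf_neq0.
move: (p%:R ^+ _) (p%:R ^+ _) (p%:R ^+ _) => x y z z0; by field.
Qed.

Lemma plocal_pdivs e x : pdivs p e x -> x \is a plocal p.
Proof. by move/(pdivs_le p_prime (leq0n e)); rewrite /pdivs divr1. Qed.

Lemma pdivsE e x : pdivs p e x -> exists2 y, y \is a plocal p & x = p%:R ^+ e * y.
Proof.
move=> h; exists (x / p%:R ^+ e) => //.
by rewrite mulrC divfK // expf_neq0 // pnatr_eq0 -lt0n.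
Qed.

Lemma dwork_exponent a j : (a < p)%N -> ((3 * (a + p * j)) %/ (4 * p) <= (3 * j + 2) %/ 4)%N.
Proof.
move=> ap; rewrite -ltnS ltn_divLR ?muln_gt0 //.
apply: (@leq_ltn_trans (3 * (p * j) + 3 * p.-1)%N); first by lia.
apply: (@leq_trans ((3 * j + 3) * p)); first by lia.
rewrite mulnA leq_mul2r; apply/orP; right; lia.
Qed.

Hypothesis p_gt4 : (4 < p)%N.

Lemma plocal_dwork_row a j : (a < p)%N -> p%:R ^+ j * d (a + p * j) \is a plocal p.
Proof.
move=> ap; apply: (@plocal_pdivs 0); apply: pdivs_dwork_coef => //.
by rewrite addn0; apply: leq_trans (dwork_exponent j ap) _; lia.
Qed.

(** * The Gamma series modulo p^k *)

Section Level.
Variable k : nat.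
Hypothesis k_gt0 : (0 < k)%N.
Let R := 'Z_(p ^ k).
Let rz := ratZ p k.

Lemma pdivs_ratZ0 x : pdivs p k x -> rz x = 0.
Proof. by case/pdivsE => y ly ->; apply: ratZ_pX. Qed.

(** Source of the cutoff 4k + 2: p^j d_(a+pj) is divisible by p to the power j - floor((3j+2)/4),
    which is at least k from j = 4k + 2 on. *)
Lemma dwork_row_eq0 a j : (a < p)%N -> (4 * k + 2 <= j)%N ->
  rz (p%:R ^+ j * d (a + p * j)) = 0.
Proof.
move=> ap kj; apply: pdivs_ratZ0; apply: pdivs_dwork_coef => //.
by apply: leq_trans (leq_add (dwork_exponent j ap) (leqnn k)) _; lia.
Qed.

Definition rising (x : R) (j : nat) : R := \prod_(l < j) (x + l%:R).

Definition gamma_series (a n : nat) (x : R) : R :=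
  \sum_(j < n) rz (p%:R ^+ j * d (a + p * j)) * rising x j.

Lemma gamma_series_trunc a n x : (a < p)%N -> (4 * k + 2 <= n)%N ->
  gamma_series a n x = gamma_series a (4 * k + 2) x.
Proof.
move=> ap kn; rewrite /gamma_series -(subnKC kn) big_split_ord /=.
rewrite [X in _ + X]big1 ?addr0 // => j _.
by rewrite dwork_row_eq0 ?mul0r ?leq_addr.
Qed.

Lemma rising_natN m j : rising (- m%:R) j = (-1) ^+ j * ('C(m, j) * j`!)%:R.
Proof.
rewrite bin_ffact; elim: j => [|j IH].
  by rewrite /rising big_ord0 ffactn0 mulr1.
rewrite /rising big_ord_recr /= -/(rising _ _) IH ffactnSr exprS natrM.
have [jm|mj] := leqP j m; first by rewrite natrB //; ring.
by rewrite ffact_small // !(mul0r, mulr0).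
Qed.

(** At x = -m the series is a finite Mahler sum. The two cutoffs agree: terms from 4k + 2 on vanish
    modulo p^k, and terms beyond m vanish with the binomial coefficient. *)
Lemma gamma_series_mahler a m : (a < p)%N ->
  gamma_series a (4 * k + 2) (- m%:R) = rz (f a m).
Proof.
move=> ap; rewrite -(@gamma_series_trunc a (4 * k + 2 + m.+1)) ?leq_addr //.
rewrite /gamma_series addnC big_split_ord /= [X in _ + X]big1 ?addr0; last first.
  by move=> i _; rewrite rising_natN bin_small ?mul0n ?mulr0 //; lia.
rewrite /f /gamma_mahler /B.
have E (j : 'I_m.+1) : (-1) ^+ j * 'C(m, j)%:R * dwork_fact p a j =
   ((-1) ^+ j * ('C(m, j) * j`!)%:R) * (p%:R ^+ j * d (a + p * j)).
  rewrite /dwork_fact -/d natrM.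
  move: (_%:R) (_%:R) (_ ^+ _) (_ ^+ _) (d _) => *; ring.
under [in RHS]eq_bigr => j _ do rewrite E.
have l (j : nat) : (-1) ^+ j * ('C(m, j) * j`!)%:R \is a plocal p.
  by rewrite rpredM ?rpred_nat // rpredX // rpredN1.
rewrite /rz ratZ_sum //; last by move=> i _; rewrite rpredM // plocal_dwork_row.
apply: eq_bigr => j _; rewrite [RHS]ratZM ?plocal_dwork_row //.
rewrite mulrC rising_natN; congr (_ * _); rewrite ratZM ?rpred_nat ?rpredX ?rpredN1 // ratZX ?rpredN1 //.
by rewrite ratZ_nat // (ratZ_int p k (-1)) rmorphN1.
Qed.

Lemma plocal_mahler a m : (a < p)%N -> f a m \is a plocal p.
Proof.
move=> ap; apply: rpred_sum => j _; apply: rpredM.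
  by rewrite rpredM ?rpred_nat // rpredX // rpredN1.
rewrite /B /dwork_fact -mulrA rpredM ?rpred_nat //; exact: plocal_dwork_row.
Qed.

Lemma gamma_series_natN a m : (a < p)%N ->
  gamma_series a (4 * k + 2) (- m%:R) * (unit_fact p (a + p * m).+1)%:R = (-1) ^+ m.
Proof.
move=> ap; rewrite gamma_series_mahler // /rz -(ratZ_nat p k).
rewrite -ratZM ?plocal_mahler ?rpred_nat // gamma_mahlerE //.
by rewrite ratZX ?rpredN1 // (ratZ_int p k (-1)) rmorphN1.
Qed.

Lemma gamma_series00 : gamma_series 0 (4 * k + 2) 0 = 1.
Proof.
rewrite /gamma_series addn2 big_ord_recl big1 ?addr0.
  by rewrite /rising big_ord0 mulr1 expr0 mul1r muln0 /d dwork_coef0 // /rz (ratZ_int p k 1).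
by move=> i _; rewrite lift0 /rising big_ord_recl addr0 mul0r mulr0.
Qed.

Lemma unit_fact_blocks q : (unit_fact p (p ^ k * q))%:R = (unit_fact p (p ^ k))%:R ^+ q :> R.
Proof.
elim: q => [|q IH]; first by rewrite muln0 /unit_fact big_geq.
rewrite mulnSr {1}/unit_fact (big_cat_nat (n := p ^ k * q)) ?leq_addr //= natrM.
rewrite -/(unit_fact _ _) IH exprSr; congr (_ * _).
rewrite -{1}[(p ^ k * q)%N]add0n big_addn addKn /unit_fact !natr_prod.
apply: eq_big => [i|i _].
  by rewrite dvdn_addl // dvdn_mulr // dvdn_exp.
by rewrite natrD natrM pchar_Zp ?pk_gt1 // mul0r addr0.
Qed.

(** This is the product of all units of Z/p^k, a set stable under inversion. *)
Lemma unit_fact_sqr : (unit_fact p (p ^ k))%:R ^+ 2 = 1 :> R.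
Proof.
have -> : (unit_fact p (p ^ k))%:R = \prod_(x : R | x \is a GRing.unit) x :> R.
  rewrite /unit_fact natr_prod.
  have E n : n = (p ^ k)%N -> \prod_(0 <= j < p ^ k | ~~ (p %| j)%N) j%:R =
     \prod_(0 <= j < n | ~~ (p %| j)%N) j%:R :> R by move=> ->.
  rewrite (E _ (Zp_cast (pk_gt1 p_gt1 k_gt0))) big_mkord.
  apply: eq_big => [i|i _]; last by rewrite natr_Zp.
  rewrite -[i in RHS]natr_Zp unitZpE ?pk_gt1 // coprime_sym.
  by rewrite coprime_pexpr // coprime_sym prime_coprime.
have E : \prod_(x : R | x \is a GRing.unit) x = \prod_(x : R | x \is a GRing.unit) x^-1.
  by rewrite (reindex_inj invr_inj); apply: eq_bigl => x; rewrite unitrV.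
rewrite expr2 {2}E -big_split big1 //= => x; exact: mulrV.
Qed.

Lemma odd_p : odd p.
Proof. by apply: contraTT p_gt4 => /(prime_oddPn p_prime) ->. Qed.

(** Wilson's theorem modulo p^k, read off the series: at m = p^k the argument -m is 0, where the
    series is 1. Hence [unit_fact] at p^k, raised to the p-th power, is (-1)^(p^k) = -1; as its
    square is 1 and p is odd, the p-th power changes nothing. *)
Lemma unit_fact_pk : (unit_fact p (p ^ k))%:R = -1 :> R.
Proof.
have := gamma_series_natN (p ^ k) p_gt0.
rewrite natrX pZ_eq0 // oppr0 gamma_series00 mul1r add0n unit_factS dvdn_mulr // muln1.
rewrite mulnC unit_fact_blocks.
have X (x : R) n : odd n -> x ^+ 2 = 1 -> x ^+ n = x.
  move=> n1 x2; rewrite -(odd_double_half n) n1 exprD expr1 -muln2 mulnC exprM.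
  by rewrite x2 expr1n mulr1.
by rewrite X ?unit_fact_sqr ?odd_p // -signr_odd oddX odd_p orbT.
Qed.

Lemma unit_factN n : (0 < n)%N -> 
  (\prod_(0 <= j < n | ~~ (p %| j)%N) (- (j%:R : R))) =
  (-1) ^+ (n.-1 - n.-1 %/ p) * (unit_fact p n)%:R.
Proof.
case: n => // n _; elim: n => [|n IH].
  by rewrite big_mkcond big_nat1 /unit_fact big_mkcond big_nat1 dvdn0 div0n !mul1r.
rewrite big_mkcond big_nat_recr //= -big_mkcond /= IH (unit_factS p n.+1) natrM /=.
rewrite divnS //; case: (p %| n.+1)%N => /=.
  by rewrite add1n subSS; ring.
by rewrite add0n subSn ?leq_div // exprS; ring.
Qed.

Lemma coprime_p1 : coprime p p.-1.
Proof. by rewrite coprime_sym; apply: coprimePn. Qed.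

Lemma plocal_div_p1 (a : nat) : (a%:R / (p.-1)%:R : rat) \is a plocal p.
Proof. by rewrite rpredM ?rpred_nat // plocalVn // coprime_p1. Qed.

Lemma ratZ_div_p1 (a : nat) : rz (a%:R / (p.-1)%:R) = a%:R / (p.-1)%:R.
Proof.
apply: (@ratZ_eq p k p_gt1 k_gt0 _ _ p.-1 _ _ a); rewrite ?plocal_div_p1 ?coprime_p1 //.
  by rewrite divfK // pnatr_eq0; lia.
by rewrite divrK //; apply: natZ_unit; rewrite ?coprime_p1.
Qed.

(** The series is known at negative integers only. Let N represent x = a/(p-1) modulo p^k and m =
    p^k - N. Then x = -m and x = -a + p x, so N + a + p m = p^k q for some q. Modulo p^k the factors
    of [unit_fact p (p ^ k * q)] beyond a + p m are the negatives of those of [unit_fact p N]; this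
    converts the inverse product at -m into Gamma_p(N). *)
Lemma gamma_series_gammap a : (a < p.-1)%N ->
  gamma_series a (4 * k + 2) (a%:R / (p.-1)%:R) = gammap p k (a%:R / (p.-1)%:R).
Proof.
move=> ap; rewrite /gammap -/rz ratZ_div_p1.
set x : R := _ / _; set N := nat_of_ord x.
have u1 : (p.-1%:R : R) \is a GRing.unit by apply: natZ_unit; rewrite ?coprime_p1.
have xN : x = N%:R by rewrite /N natr_Zp.
have ltN : (N < p ^ k)%N.
  by rewrite -[X in (_ < X)%N](Zp_cast (pk_gt1 p_gt1 k_gt0)) ltn_ord.
have [a0|a0] := posnP a.
  have x0 : x = 0 by rewrite /x a0 mul0r.
  by rewrite x0 a0 gamma_series00 /N x0 /= /morita_nat expr0 mul1r big_geq.
pose m := (p ^ k - N)%N.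
have xm : x = - m%:R.
  by rewrite /m natrB 1?ltnW // natrX pZ_eq0 // sub0r opprK.
clearbody m.
have N0 : (0 < N)%N.
  rewrite lt0n; apply: contraTneq a0 => N0; rewrite -leqNgt.
  have : (a%:R : R) = 0 by rewrite -[a%:R](divrK u1) -/x xN N0 mul0r.
  move=> /(congr1 (fun y : R => nat_of_ord y)); rewrite val_Zp_nat ?pk_gt1 //=.
  have : (p ^ 1 <= p ^ k)%N by rewrite leq_exp2l.
  by rewrite expn1 => pk; rewrite modn_small //; lia.
have [q eq] : exists q, (N + (a + p * m) = p ^ k * q)%N.
  have : ((N + (a + p * m))%:R : R) = 0.
    rewrite !natrD natrM -xN -[m%:R]opprK -xm.
    rewrite -[a%:R](divrK u1) -/x.
    have -> : p%:R = 1 + p.-1%:R :> R by rewrite -[1]/(1%:R) -natrD; congr (_%:R); lia.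
    by ring.
  move=> /(congr1 (fun y : R => nat_of_ord y)); rewrite val_Zp_nat ?pk_gt1 //= => /eqP.
  by rewrite -/(dvdn _ _) => /dvdnP [q ->]; exists q; rewrite mulnC.
have := gamma_series_natN m (leq_trans ap (leq_pred p)); rewrite -xm.
set l := gamma_series _ _ _ => E1.
have E2 : (unit_fact p (p ^ k * q))%:R = (-1) ^+ q :> R.
  by rewrite unit_fact_blocks unit_fact_pk.
have E3 : (unit_fact p (p ^ k * q))%:R =
  (unit_fact p (a + p * m).+1)%:R * ((-1) ^+ (N.-1 - N.-1 %/ p) * (unit_fact p N)%:R) :> R.
  rewrite {1}/unit_fact (big_cat_nat (n := (a + p * m).+1)) //=; last by rewrite -eq; lia.
  rewrite natrM -/(unit_fact _ _); congr (_ * _).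
  rewrite -unit_factN // natr_prod [RHS]big_mkcond [RHS]big_ltn // dvdn0 [X in _ = X * _]/= mul1r.
  rewrite -add1n big_addn -eq addnK big_nat_rev [LHS]big_mkcond.
  apply: eq_big_nat => i /andP[i1 iN].
  rewrite (_ : 1 + N - i.+1 + (a + p * m) = p ^ k * q - i)%N; last by rewrite -eq; lia.
  have iq : (i <= p ^ k * q)%N by rewrite -eq; lia.
  rewrite dvdn_subr ?dvdn_mulr ?dvdn_exp // natrB // natrM natrX pZ_eq0 //.
  by rewrite mul0r sub0r.
(* The sign depends on the number of positive multiples of p below N. It is s - m - 1, because N + a
   + p m = p s. *)
pose s := (p ^ k.-1 * q)%N.
have es : (p ^ k * q = p * s)%N by rewrite /s mulnA -expnS prednK.
have os : odd s = odd q by rewrite /s oddM oddX odd_p orbT.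
have ec : (N.-1 %/ p = s - m.+1)%N.
  have ms : (m < s)%N by rewrite -(ltn_pmul2l p_gt0) -es -eq; lia.
  have -> : N.-1 = ((s - m.+1) * p + (p.-1 - a))%N.
    have h : (p + p * m <= N + (a + p * m))%N by rewrite eq es -mulnS leq_mul2l ms orbT.
    rewrite mulnBl mulSn (mulnC s) (mulnC m) -es -eq; lia.
  by rewrite divnMDl // divn_small ?addn0 //; lia.
have ms : (m < s)%N by rewrite -(ltn_pmul2l p_gt0) -es -eq; lia.
have le : (s - m.+1 <= N.-1)%N by rewrite -ec leq_div.
have E4 : l * (-1) ^+ q = (-1) ^+ m * ((-1) ^+ (N.-1 - N.-1 %/ p) * (unit_fact p N)%:R).
  by rewrite -E2 E3 -E1; ring.
have -> : l = (-1) ^+ (q + m + (N.-1 - N.-1 %/ p)) * (unit_fact p N)%:R.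
  rewrite -[LHS]mulr1 -[X in _ * X = _](sqrr_sign _ q) expr2 mulrA E4 !exprD.
  move: (_ ^+ _) (_ ^+ _) (_ ^+ _) (_%:R) => *; ring.
rewrite morita_natE intrM rmorphXn /= rmorphN1; congr (_ * _).
rewrite -[LHS]signr_odd -[RHS]signr_odd; congr (_ ^+ (nat_of_bool _)).
rewrite ec !oddD (oddB le) (oddB ms) /= os.
have e : (N + (a + p * m) = p * s)%N by rewrite eq.
move/(congr1 odd): e; rewrite !oddD (oddM p m) (oddM p s) odd_p /= os => e.
have eN : odd N.-1 = ~~ odd N by rewrite -[in RHS](prednK N0) /= negbK.
rewrite eN; move: e; do 4! case: odd => //.
Qed.

(** The representatives of x and 1 - x satisfy N + N' = p^k + 1, so the product of the units below
    p^k, which is -1, splits at N; up to sign its upper part is the product belonging to N'. The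
    sign follows from p | N + a, a consequence of x = -a + p x. *)
Lemma gammap_reflection a : (0 < a < p.-1)%N ->
  gammap p k (a%:R / (p.-1)%:R) * gammap p k ((p.-1 - a)%:R / (p.-1)%:R) = (-1) ^+ a.+1.
Proof.
move=> /andP [a0 ap]; rewrite /gammap -/rz !ratZ_div_p1.
set x : R := a%:R / _; set y : R := _ / _.
have u1 : (p.-1%:R : R) \is a GRing.unit by apply: natZ_unit; rewrite ?coprime_p1.
have xy : y = 1 - x by rewrite /y /x natrB 1?ltnW // mulrBl divrr.
have xE : x = - a%:R + p%:R * x.
  have -> : p%:R = p.-1%:R + 1 :> R by rewrite natr1 prednK.
  have e : p.-1%:R * x = a%:R by rewrite /x mulrC divrK.
  by rewrite mulrDl mul1r e addKr.
set N := nat_of_ord x; set N' := nat_of_ord y.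
have xN : x = N%:R by rewrite /N natr_Zp.
have yN : y = N'%:R by rewrite /N' natr_Zp.
have lt (z : R) : (nat_of_ord z < p ^ k)%N.
  by rewrite -[X in (_ < X)%N](Zp_cast (pk_gt1 p_gt1 k_gt0)) ltn_ord.
have modp (m n : nat) : (m%:R : R) = n%:R -> m = n %[mod p].
  move=> /(congr1 (fun z : R => nat_of_ord z)); rewrite !val_Zp_nat ?pk_gt1 // => e.
  by rewrite -(@modn_dvdm (p ^ k) m) ?dvdn_exp // e modn_dvdm // dvdn_exp.
have pN : (p %| N + a)%N.
  have /modp : ((N + a)%:R : R) = (p * N)%:R.
    by rewrite natrD natrM -xN {1}xE addrAC addNr add0r.
  by rewrite modnMr => /eqP.
have N0 : (0 < N)%N.
  rewrite lt0n; apply: contraTneq pN => ->; rewrite add0n gtnNdvd //; lia.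
have NN : (N' = p ^ k + 1 - N)%N.
  have : N' = (p ^ k + 1 - N)%N %[mod p ^ k].
    have : (N'%:R : R) = (p ^ k + 1 - N)%:R.
      rewrite -yN xy xN natrB; last by have := lt x; rewrite -/N; lia.
      by rewrite natrD natrX pZ_eq0 // add0r.
    by move=> /(congr1 (fun z : R => nat_of_ord z)); rewrite !val_Zp_nat ?pk_gt1.
  rewrite (modn_small (lt y)) modn_small //.
  (* For N = 1 the representative of 1 - x would be 0 instead of p^k; but then p would divide a + 1
     < p. *)
  have N1 : (N != 1)%N.
    apply: contraTneq pN => ->; rewrite gtnNdvd //; lia.
  by have := lt x; rewrite -/N; lia.
have E : (unit_fact p (p ^ k))%:R = (unit_fact p N)%:R *
   ((-1) ^+ (N'.-1 - N'.-1 %/ p) * (unit_fact p N')%:R) :> R.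
  have lN := lt x; rewrite -/N in lN.
  rewrite {1}/unit_fact (big_cat_nat (n := N)) //=; last by lia.
  rewrite natrM -/(unit_fact _ _); congr (_ * _).
  rewrite -unit_factN; last by lia.
  rewrite natr_prod [RHS]big_mkcond [RHS]big_ltn; last by lia.
  rewrite dvdn0 [X in _ = X * _]/= mul1r.
  have -> : N = (1 + N.-1)%N by lia.
  rewrite big_addn (_ : (p ^ k - N.-1 = N')%N); last by lia.
  rewrite big_nat_rev [LHS]big_mkcond.
  apply: eq_big_nat => i /andP[i1 iN].
  rewrite (_ : 1 + N' - i.+1 + N.-1 = p ^ k - i)%N; last by lia.
  rewrite dvdn_subr ?dvdn_exp //; last by lia.
  by rewrite natrB ?natrX ?pZ_eq0 ?sub0r //; lia.
rewrite !morita_natE !intrM !rmorphXn /= !rmorphN1 -!pmulrn.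
rewrite unit_fact_pk in E.
move: E; set u := (unit_fact p N)%:R; set v := (unit_fact p N')%:R; set w := (-1) ^+ (_ - _).
move=> E; have ww : w * w = 1 by rewrite -expr2 sqrr_sign.
have -> : (-1) ^+ N * u * ((-1) ^+ N' * v) = (-1) ^+ N * (-1) ^+ N' * w * (-1) :> R.
  rewrite [X in _ = _ * X]E; move: ((-1) ^+ N) ((-1) ^+ N') => x1 y1.
  transitivity (x1 * y1 * (w * w) * u * v); last by ring.
  by rewrite ww; ring.
rewrite /w.
rewrite -!exprD -exprSr -[LHS]signr_odd -[RHS]signr_odd; congr (_ ^+ (nat_of_bool _)).
have [m em] := dvdnP pN.
have e0 : N'.-1 = ((p ^ k.-1 - m) * p + a)%N.
  have pk : (p ^ k = p * p ^ k.-1)%N by rewrite -expnS prednK.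
  have le : (m <= p ^ k.-1)%N.
    rewrite -ltnS -(ltn_pmul2r p_gt0) -em mulSn [X in (_ < _ + X)%N]mulnC -pk.
    by have := lt x; rewrite -/N; lia.
  have le' : (m * p <= p ^ k)%N by rewrite pk (mulnC m) leq_mul2l le orbT.
  by rewrite mulnBl -em [X in (X - _ + _)%N]mulnC -pk NN; move: le'; rewrite -em; lia.
have eN : (N'.-1 - N'.-1 %/ p = (p ^ k.-1 - m) * p.-1 + a)%N.
  rewrite e0 divnMDl // divn_small ?addn0; last by lia.
  move: (p ^ k.-1 - m)%N => l.
  by rewrite -{1}(prednK p_gt0) mulnS -addnA addKn.
have e2 : (N + N' = p ^ k + 1)%N by have := lt x; rewrite -/N; lia.
rewrite eN e2 /= !oddD oddM oddX odd_p orbT /=.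
have -> : odd p.-1 = false by move: odd_p; rewrite -{1}(prednK p_gt0) /= => /negbTE.
by rewrite andbF.
Qed.

End Level.
End GammaSeries.

(** * The trace formula *)

Lemma sum_ord_delta (R : pzRingType) n (F : nat -> R) i :
  \sum_(l < n) (i == l :> nat)%:R * F l = if (i < n)%N then F i else 0.
Proof.
case: ifP => [lt|/negbT ge].
  rewrite (bigD1 (Ordinal lt)) //= eqxx mul1r big1 ?addr0 // => l ne.
  have -> : (i == l) = false by apply: contraNF ne => /eqP e; apply/eqP/val_inj.
  by rewrite mul0r.
rewrite big1 // => l _; have -> : (i == l) = false.
  by apply: contraNF ge => /eqP ->; apply: ltn_ord.
by rewrite mul0r.
Qed.

(* The trace of an operator Psi on a space V that commutes up to a factor c
   with a map N whose cokernel is a line, computed on that line. *)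
Lemma trace_cokernel (R : comUnitRingType) n (Psi : 'M[R]_n.+1) (Psi' : 'M[R]_n)
    (N : 'M[R]_(n.+1, n)) (e : 'cV[R]_n.+1) (phi : 'rV[R]_n.+1) (c : R) :
  Psi *m N = c *: (N *m Psi') ->
  (row_mx e N : 'M_(n.+1, 1 + n)) \in unitmx -> phi *m e = 1%:M -> phi *m N = 0 ->
  \tr Psi = \tr (phi *m Psi *m e) + c * \tr Psi'.
Proof.
move=> comm uM phie phiN; set M := (row_mx e N : 'M_(1 + n)) in uM.
pose L := dsubmx (invmx M : 'M_(1 + n, n.+1)).
have eM : invmx M = col_mx phi L.
  rewrite -[LHS]vsubmxK; congr col_mx.
  have : phi *m M = row_mx 1%:M 0 by rewrite /M mul_mx_row phie phiN.
  move=> /(congr1 (fun X => X *m invmx M)); rewrite -mulmxA mulmxV // mulmx1 => ->.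
  by rewrite -[X in _ = _ *m X]vsubmxK mul_row_col mul1mx mul0mx addr0.
have LN : L *m N = 1%:M.
  have : invmx M *m M = 1%:M by rewrite mulVmx.
  by rewrite eM mul_col_row (@scalar_mx_block _ 1 n 1) => /eq_block_mx [].
have MM : e *m phi + N *m L = 1%:M by rewrite -mul_row_col -eM mulmxV.
rewrite -{1}[Psi]mulmx1 -MM mulmxDr mxtraceD; congr (_ + _).
  by rewrite mulmxA mxtrace_mulC mulmxA.
by rewrite mulmxA comm -scalemxAl mxtraceZ -mulmxA mxtrace_mulC -mulmxA LN mulmx1.
Qed.

Section Trace.
Variable p : nat.
Hypothesis p_prime : prime p.
Hypothesis p_gt4 : (4 < p)%N.
Let p_gt1 : (1 < p)%N := prime_gt1 p_prime.
Let d := dwork_coef p.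
Variable k : nat.
Hypothesis k_gt0 : (0 < k)%N.
Let R := 'Z_(p ^ k).
Let rz := ratZ p k.
Variables (a : nat) (alpha : R).
Hypothesis a_ltp : (a < p)%N.
Hypothesis alphaE : p%:R * alpha = a%:R + alpha.

(* matrix of the operator y^i |-> sum_j psi j i y^j on polynomials in y *)
Let psi (j i : nat) : R :=
  if (i <= a + p * j)%N then rz ((- p%:R) ^+ j * d (a + p * j - i)) else 0.

Lemma pdivs_sgn e j x : pdivs p e (p%:R ^+ j * x) -> pdivs p e ((- p%:R) ^+ j * x).
Proof.
rewrite exprNn -mulrA => h; apply: pdivsMl => //.
by rewrite rpredX // rpredN1.
Qed.

Lemma pdivs_dwork_entry j m e : (m <= a + p * j)%N -> ((3 * j + 2) %/ 4 + e <= j)%N ->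
  pdivs p e ((- p%:R) ^+ j * d m).
Proof.
move=> mj le; apply: pdivs_sgn; apply: pdivs_dwork_coef => //; apply: leq_trans le.
rewrite leq_add2r; apply: leq_trans (dwork_exponent p_prime j a_ltp).
by rewrite leq_div2r // leq_mul2l mj orbT.
Qed.

Lemma plocal_dwork_entry j m : (m <= a + p * j)%N -> (- p%:R) ^+ j * d m \is a plocal p.
Proof.
move=> mj; apply: (@plocal_pdivs p p_prime 0); apply: pdivs_dwork_entry => //; lia.
Qed.

Lemma psi_eq0 j i : (4 * k + 2 <= j)%N -> psi j i = 0.
Proof.
move=> jk; rewrite /psi; case: ifP => // _; apply: pdivs_ratZ0 => //.
by apply: pdivs_dwork_entry; [apply: leq_subr | lia].
Qed.

Lemma psi_lt j i : (a + p * j < i)%N -> psi j i = 0.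
Proof. by move=> lt; rewrite /psi leqNgt lt. Qed.

Let psi_pred (j i : nat) : R := if j is j'.+1 then psi j' i else 0.

Lemma psi_pred_lt j i : (a + p * j < i + p)%N -> psi_pred j i = 0.
Proof. by case: j => [//|j] lt; rewrite /psi_pred psi_lt //; lia. Qed.

Lemma psi_pred_ge j i : (i + p <= a + p * j)%N ->
  p%:R * psi_pred j i = - rz ((- p%:R) ^+ j * d (a + p * j - i - p)).
Proof.
case: j => [|j] le; first by move: le; rewrite muln0; lia.
have le' : (i <= a + p * j)%N by lia.
have -> : (a + p * j.+1 - i - p = a + p * j - i)%N by lia.
rewrite /psi_pred /psi le' -(ratZ_nat p k p) -/rz {1}/rz.
rewrite -ratZM ?rpred_nat ?plocal_dwork_entry ?leq_subr //.
rewrite /rz -ratZN ?plocal_dwork_entry ?leq_subr //; last by lia.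
by congr (ratZ p k _); rewrite exprS mulrA !mulNr opprK.
Qed.

(** Coefficient of y^j in Psi N y^i = p N Psi y^i, where N = y d/dy + alpha + y. With m = a + p j -
    i one has p (j + alpha) = m + (i + alpha), and what remains is the recurrence m d_m = d_(m-1) +
    d_(m-p). *)
Lemma psi_comm j i : (i%:R + alpha) * psi j i + psi j i.+1 =
  p%:R * ((j%:R + alpha) * psi j i + psi_pred j i).
Proof.
have [lt|le] := ltnP (a + p * j) i.
  by rewrite !psi_lt ?psi_pred_lt ?mulr0 ?addr0 ?mulr0 //; lia.
pose m := (a + p * j - i)%N.
have em : (a + p * j = i + m)%N by rewrite /m; lia.
suff K : psi j i.+1 = m%:R * psi j i + p%:R * psi_pred j i.
  have : p%:R * (j%:R + alpha) = m%:R + (i%:R + alpha).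
    by rewrite mulrDr alphaE !addrA -natrM -!natrD; congr (_%:R + _); lia.
  by move=> e; rewrite K [RHS]mulrDr [p%:R * (_ * psi _ _)]mulrA e; ring.
have -> : m%:R * psi j i = rz ((- p%:R) ^+ j * (m%:R * d m)).
  rewrite /psi le -(ratZ_nat p k m) -/rz {1}/rz -ratZM ?rpred_nat //.
    by congr (ratZ p k _); rewrite mulrCA.
  by rewrite plocal_dwork_entry ?leq_subr.
have [m0|m0] := posnP m.
  rewrite m0 mul0r mulr0 /rz (ratZ_int p k 0) add0r psi_lt; last by lia.
  by rewrite psi_pred_lt ?mulr0 //; lia.
have -> : psi j i.+1 = rz ((- p%:R) ^+ j * d m.-1).
  rewrite /psi (_ : (_ < _)%N = true); last by lia.
  by congr (rz (_ * d _)); lia.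
have e : m.-1.+1 = m by rewrite prednK.
have [mp|pm] := ltnP m p.
  have := @dwork_coefS_lt p p_prime m.-1; rewrite e => /(_ mp) ->.
  by rewrite psi_pred_lt ?mulr0 ?addr0 //; lia.
rewrite psi_pred_ge -/m; last by lia.
have := dwork_coefD p_prime (m - p); rewrite (subnK pm) => ->.
rewrite -/d mulrDr /rz ratZD ?addrK //; apply: plocal_dwork_entry; lia.
Qed.

Lemma psi_row0 j : psi j 0 = (-1) ^+ j * rz (p%:R ^+ j * d (a + p * j)).
Proof.
rewrite /psi leq0n subn0 exprNn -mulrA /rz ratZ_sign //; exact: plocal_dwork_row.
Qed.

(** [phi] sends y^j to (-1)^j (alpha)_j and kills the image of [N], so the cokernel contributes
    phi(Psi 1), which is the Gamma series. The traces on the two polynomial spaces are the same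
    diagonal sum, whence the factor 1 - p. [N] raises the degree by one and is therefore
    rectangular; truncation causes no error because rows of index at least 4k + 2 vanish. *)
Lemma gamma_series_trace n : (4 * k + 3 <= n)%N ->
  gamma_series a (4 * k + 2) alpha =
  (1 - p%:R) * \sum_(i < n) rz ((- p%:R) ^+ i * d (a + p.-1 * i)).
Proof.
move=> kn; rewrite -(@gamma_series_trunc p p_prime p_gt4 k k_gt0 a n.+1) //; last by lia.
pose Psi := \matrix_(j < n.+1, i < n.+1) psi j i.
pose Psi' := \matrix_(j < n, i < n) psi j i.
pose N := \matrix_(j < n.+1, i < n)
  ((j == i :> nat)%:R * (i%:R + alpha) + (j == i.+1 :> nat)%:R).
pose e : 'cV[R]_n.+1 := \col_i (i == 0 :> nat)%:R.
pose phi : 'rV[R]_n.+1 := \row_j ((-1) ^+ j * rising alpha j).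
have rowS j : rising alpha j.+1 = rising alpha j * (alpha + j%:R).
  by rewrite /rising big_ord_recr.
have phie : phi *m e = 1%:M.
  apply/matrixP => i j; rewrite !ord1 !mxE big_ord_recl !mxE big1 ?addr0.
    by rewrite mulr1 expr0 mul1r /rising big_ord0.
  by move=> l _; rewrite !mxE mulr0.
pose ph j := (-1) ^+ j * rising alpha j.
have phiN : phi *m N = 0.
  apply/matrixP => i j; rewrite !mxE.
  transitivity (\sum_(l < n.+1) (j == l :> nat)%:R * (ph l * (j%:R + alpha)) +
                \sum_(l < n.+1) (j.+1 == l)%:R * ph l).
    rewrite -big_split; apply: eq_bigr => l _ /=.
    by rewrite !mxE (eq_sym _ (val j)) (eq_sym _ j.+1) /ph; ring.
  rewrite (sum_ord_delta _ (fun l => ph l * (j%:R + alpha))) sum_ord_delta ltnS ltnW ?ltn_ord //.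
  by rewrite ltnS ltn_ord /ph rowS exprS; ring.
have comm : Psi *m N = p%:R *: (N *m Psi').
  apply/matrixP => j i; rewrite !mxE.
  transitivity (\sum_(l < n.+1) (i == l :> nat)%:R * (psi j l * (i%:R + alpha)) +
                \sum_(l < n.+1) (i.+1 == l)%:R * psi j l).
    rewrite -big_split; apply: eq_bigr => l _ /=.
    by rewrite !mxE (eq_sym _ (val i)) (eq_sym _ i.+1); ring.
  rewrite (sum_ord_delta _ (fun l => psi j l * (i%:R + alpha))) sum_ord_delta ltnS ltnW ?ltn_ord //.
  rewrite ltnS ltn_ord mulrC psi_comm; congr (_ * _).
  transitivity (\sum_(l < n) (j == l :> nat)%:R * ((l%:R + alpha) * psi l i) +
                \sum_(l < n) (j == l.+1 :> nat)%:R * psi l i); last first.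
    by rewrite -big_split; apply: eq_bigr => l _ /=; rewrite !mxE; ring.
  rewrite (sum_ord_delta _ (fun l => (l%:R + alpha) * psi l i)); congr (_ + _).
    by case: ifP => // /negbT; rewrite -leqNgt => nj; rewrite psi_eq0 ?mulr0 //; lia.
  case: j => -[|j] /= lj.
    by rewrite big1 // => l _; rewrite mul0r.
  under eq_bigr => l _ do rewrite eqSS.
  by rewrite (sum_ord_delta n (fun l => psi l i)) -ltnS lj.
have uM : (row_mx e N : 'M_(n.+1, 1 + n)) \in unitmx.
  rewrite -unitmx_tr unitmxE det_trig.
    rewrite big1 ?unitr1 // => i _; rewrite !mxE.
    case: splitP => l /=; first by rewrite ord1 !mxE => ->.
    by rewrite !mxE => ->; rewrite add1n eqxx gtn_eqF // mul0r add0r.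
  apply/is_trig_mxP => i j ij; rewrite !mxE.
  case: splitP => l /= il; first by rewrite !mxE gtn_eqF //; lia.
  rewrite !mxE; move: ij; rewrite il add1n => ij.
  by rewrite (gtn_eqF ij) (gtn_eqF (ltnW ij)) mul0r addr0.
have := trace_cokernel comm uM phie phiN.
have -> : \tr (phi *m Psi *m e) = gamma_series a n.+1 alpha.
  rewrite /mxtrace big_ord1 !mxE big_ord_recl big1 ?addr0; last first.
    by move=> l _; rewrite !mxE mulr0.
  rewrite !mxE mulr1; apply: eq_bigr => j _; rewrite !mxE psi_row0.
  have e1 : (-1) ^+ j * (-1) ^+ j = 1 :> R by rewrite -expr2 sqrr_sign.
  transitivity (((-1) ^+ j * (-1) ^+ j) * (rz (p%:R ^+ j * d (a + p * j)) * rising alpha j)).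
    by move: (_ ^+ _) (rz _) (rising _ _) => *; ring.
  by rewrite e1 mul1r.
have psid (i : nat) : psi i i = rz ((- p%:R) ^+ i * d (a + p.-1 * i)).
  have -> : (a + p.-1 * i = a + p * i - i)%N by rewrite -subn1 mulnBl mul1n; nia.
  by rewrite /psi; case: ifP => //; nia.
have -> : \tr Psi = \sum_(i < n) psi i i.
  rewrite /mxtrace big_ord_recr /= mxE psi_eq0 ?addr0; last by move=> /=; lia.
  by apply: eq_bigr => i _; rewrite mxE.
have -> : \tr Psi' = \sum_(i < n) psi i i by apply: eq_bigr => i _; rewrite mxE.
move=> E; rewrite (eq_bigr (fun i : 'I_n => psi i i)) //.
by rewrite mulrBl mul1r {1}E addrK.
Qed.

End Trace.

(** * Teichmueller representatives *)

Lemma exprD_congr (R : comPzRingType) (x y z : R) n :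
  exists t, (x + y * z) ^+ n = x ^+ n + n%:R * y * z * x ^+ n.-1 + y ^+ 2 * t.
Proof.
elim: n => [|n [t e]].
  by exists 0; rewrite !expr0 !mul0r mulr0 !addr0.
case: n e => [|n] e; first by exists 0; ring.
exists (x * t + n.+1%:R * z ^+ 2 * x ^+ n + y * z * t).
by rewrite exprS e /= -[n.+2%:R]natr1 !exprS; ring.
Qed.

Lemma exp_congr_step (R : comPzRingType) (p e : nat) (x y r : R) :
  (0 < e)%N -> x = y + p%:R ^+ e * r -> exists s, x ^+ p = y ^+ p + p%:R ^+ e.+1 * s.
Proof.
case: e => // e _ ->; have [t ->] := exprD_congr y (p%:R ^+ e.+1) r p.
exists (r * y ^+ p.-1 + p%:R ^+ e * t).
by rewrite [p%:R ^+ e.+2]exprS !exprS; ring.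
Qed.

Section Teich.
Variables (p k : nat).
Hypotheses (p_prime : prime p) (k_gt0 : (0 < k)%N).
Let p_gt0 : (0 < p)%N := prime_gt0 p_prime.
Let p_gt1 : (1 < p)%N := prime_gt1 p_prime.
Let R := 'Z_(p ^ k).
Let om : 'F_p -> R := teich p k.

Lemma exp_congr (x y r : R) e : x = y + p%:R * r ->
  exists s, x ^+ (p ^ e) = y ^+ (p ^ e) + p%:R ^+ e.+1 * s.
Proof.
move=> exy; elim: e => [|e [s IH]]; first by exists r; rewrite !expr1.
rewrite expnSr !exprM; exact: exp_congr_step IH.
Qed.

Lemma teich_nat (n : nat) : om n%:R = n%:R ^+ (p ^ k.-1).
Proof.
rewrite /om /teich val_Fp_nat //.
have [r er] : exists r : R, n%:R = (n %% p)%:R + p%:R * r.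
  by exists (n %/ p)%:R; rewrite {1}(divn_eq n p) natrD natrM mulrC addrC.
have [s ->] := exp_congr k.-1 er.
by rewrite prednK // pZ_eq0 // mul0r addr0.
Qed.

Lemma natr_Fp (u : 'F_p) : u = (nat_of_ord u)%:R :> 'F_p.
Proof. by rewrite natr_Zp. Qed.

Lemma teichM u v : om (u * v) = om u * om v.
Proof. by rewrite (natr_Fp u) (natr_Fp v) -natrM !teich_nat natrM exprMn. Qed.

Lemma teich1 : om 1 = 1.
Proof. by rewrite (teich_nat 1) expr1n. Qed.

Lemma teich0 : om 0 = 0.
Proof. by rewrite (teich_nat 0) expr0n expn_eq0 (gtn_eqF p_gt0). Qed.

Lemma teichX u n : om (u ^+ n) = om u ^+ n.
Proof. by elim: n => [|n IH]; rewrite ?expr0 ?teich1 // !exprS teichM IH. Qed.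

Lemma Fp_exp_pred (u : 'F_p) : u != 0 -> u ^+ p.-1 = 1.
Proof.
move=> u0; apply: (mulfI u0); rewrite -exprS prednK // mulr1.
by rewrite -[X in _ ^+ X](card_Fp p_prime) expf_card.
Qed.

Lemma Fp_prim_root : exists g : 'F_p, p.-1.-primitive_root g.
Proof.
pose rs := enum (predC1 (0 : 'F_p)).
have p10 : (0 < p.-1)%N by rewrite -ltnS prednK.
have : has p.-1.-primitive_root rs.
  apply: has_prim_root => //; last 1 first.
  - by rewrite -cardE cardC1 card_Fp.
  - apply/allP => x; rewrite mem_enum inE => x0.
    by apply/unity_rootP; apply: Fp_exp_pred.
  - exact: enum_uniq.
by case/hasP => g _ gp; exists g.
Qed.

Lemma Fp_prim_root_neq0 (g : 'F_p) : p.-1.-primitive_root g -> g != 0.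
Proof.
move=> gp; apply: contraTneq gp => ->; apply/negP => /prim_expr_order/eqP.
rewrite expr0n gtn_eqF; last by rewrite -ltnS prednK.
by rewrite eq_sym oner_eq0.
Qed.

Lemma teich_exp_pred u : u != 0 -> om u ^+ p.-1 = 1.
Proof. by move=> u0; rewrite -teichX Fp_exp_pred // teich1. Qed.

Lemma teich_exp_p u : om u ^+ p = om u.
Proof.
have [->|u0] := eqVneq u 0; first by rewrite teich0 expr0n (gtn_eqF p_gt0).
have : om u ^+ p.-1.+1 = om u by rewrite exprS teich_exp_pred ?mulr1.
by rewrite prednK.
Qed.

Lemma teich_unit u : u != 0 -> om u \is a GRing.unit.
Proof.
move=> u0; have := @unitr1 R; rewrite -(teich_exp_pred u0).
by rewrite unitrX_pos // -ltnS prednK.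
Qed.

Lemma teich_congr (n : nat) : exists r, om n%:R = n%:R + p%:R * r.
Proof.
rewrite teich_nat; set q := (p ^ k.-1)%N.
have : (n ^ q)%:R = n%:R :> 'F_p.
  rewrite natrX /q; elim: (k.-1) => [|e IH]; first by rewrite expr1.
  by rewrite expnS exprM -[X in _ ^+ X ^+ _](card_Fp p_prime) expf_card.
move=> /(congr1 (fun y : 'F_p => nat_of_ord y)); rewrite !val_Fp_nat // => e.
exists ((n ^ q %/ p)%:R - (n %/ p)%:R).
have E1 : (n ^ q)%:R = (n ^ q %/ p)%:R * p%:R + (n %% p)%:R :> R.
  by rewrite -natrM -natrD -e -divn_eq.
have E2 : n%:R = (n %/ p)%:R * p%:R + (n %% p)%:R :> R.
  by rewrite -natrM -natrD -divn_eq.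
by rewrite -natrX E1 [X in _ = X + _]E2; ring.
Qed.

Lemma teichD_congr u v : exists r, om (u + v) = om u + om v + p%:R * r.
Proof.
rewrite (natr_Fp u) (natr_Fp v) -natrD.
have [r ->] := teich_congr u; have [s ->] := teich_congr v.
have [t ->] := teich_congr (u + v).
by exists (t - r - s); rewrite natrD; ring.
Qed.

(** To annihilate a character sum over Z/p^k, omega(u) - 1 must be invertible and not merely
    nonzero. It is the unit u - 1 plus a multiple of p, and a finite geometric series inverts it. *)
Lemma teich_sub1_unit u : u != 0 -> u != 1 -> om u - 1 \is a GRing.unit.
Proof.
move=> u0 u1; rewrite (natr_Fp u); have [r ->] := teich_congr u.
have ug : (0 < u)%N.
  by rewrite lt0n; apply: contraNneq u0 => e; rewrite (natr_Fp u) e.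
set x := (_%:R : R).
have -> : x + p%:R * r - 1 = (u.-1)%:R + p%:R * r.
  by rewrite /x -{1}(prednK ug) -natr1; ring.
have cu : ((u.-1)%:R : R) \is a GRing.unit.
  apply: natZ_unit => //; rewrite prime_coprime // gtnNdvd //.
    rewrite -ltnS prednK // ltn_neqAle ug andbT eq_sym.
    by apply: contraNneq u1 => e; rewrite (natr_Fp u) e.
  have := ltn_ord u; rewrite [X in (_ < X)%N](Fp_cast p_prime) => lt.
  by apply: leq_ltn_trans lt; apply: leq_pred.
set y := (_%:R : R) in cu *.
have -> : y + p%:R * r = y * (1 + p%:R * (r / y)).
  by rewrite mulrDr mulr1 mulrCA [y * _]mulrC divrK.
rewrite unitrM cu /=; set z := r / y.
apply/unitrP; exists (\sum_(i < k) (- (p%:R * z)) ^+ i).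
have e : (1 + p%:R * z) * (\sum_(i < k) (- (p%:R * z)) ^+ i) = 1.
  have := subrX1 (- (p%:R * z)) k.
  rewrite exprNn exprMn pZ_eq0 // mul0r mulr0 sub0r => e.
  apply: (can_inj opprK); rewrite -mulNr [RHS]e; congr (_ * _); ring.
by rewrite mulrC e.
Qed.

Lemma sum_teich_exp m : (p.-1 %| m)%N = false -> \sum_(u | u != 0) om u ^+ m = 0.
Proof.
move=> ndiv; have [g gp] := Fp_prim_root.
have g0 := Fp_prim_root_neq0 gp.
have un : om (g ^+ m) - 1 \is a GRing.unit.
  by apply: teich_sub1_unit; rewrite ?expf_neq0 // -(prim_order_dvd gp) ndiv.
apply: (mulrI un); rewrite mulr0 mulrBl mul1r mulr_sumr.
rewrite [X in _ - X](reindex_inj (mulfI g0)) /=.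
rewrite [X in _ - X](eq_bigl (fun u => u != 0)) => [|u]; last by rewrite mulf_eq0 negb_or g0.
apply/eqP; rewrite subr_eq0; apply/eqP; apply: eq_bigr => u _.
by rewrite teichM teichX exprMn.
Qed.

Lemma sum_teich_dual a c i : (a < p.-1)%N -> (c < p.-1)%N ->
  \sum_(u | u != 0) (om u)^-1 ^+ a * om u ^+ (i * p.-1 + c) = (a == c)%:R * (p.-1)%:R.
Proof.
move=> ap cp.
have E u : u != 0 -> (om u)^-1 ^+ a * om u ^+ (i * p.-1 + c) = om u ^+ (p.-1 - a + c).
  move=> u0; have un := teich_unit u0.
  have -> : (om u)^-1 ^+ a = om u ^+ (p.-1 - a).
    apply: (mulrI (unitrX a un)); rewrite -exprMn divrr // expr1n -exprD subnKC ?teich_exp_pred //.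
    exact: ltnW.
  by rewrite -exprD addnCA exprD mulnC exprM teich_exp_pred // expr1n mul1r.
rewrite (eq_bigr _ E); have [->|ne] := eqVneq a c; last first.
  rewrite mul0r; apply: sum_teich_exp; apply/negP => /dvdnP [m em].
  case: m em => [|[|m]] em; first by lia.
    by move/eqP: ne; apply; lia.
  by have := leq_addr (m * p.-1) p.-1; move: em; rewrite !mulSn; move: (m * p.-1)%N => x; lia.
rewrite subnK; last exact: ltnW.
rewrite (eq_bigr (fun=> 1)) => [|u u0]; last exact: teich_exp_pred.
by rewrite sumr_const cardC1 card_Fp // mul1r.
Qed.

Lemma sum_teich_pow u : u != 0 -> \sum_(a < p.-1) om u ^+ a = (u == 1)%:R * (p.-1)%:R.
Proof.
move=> u0; have [->|u1] := eqVneq u 1.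
  by under eq_bigr do rewrite teich1 expr1n; rewrite sumr_const card_ord mul1r.
rewrite mul0r; apply: (mulrI (teich_sub1_unit u0 u1)).
by rewrite mulr0 -subrX1 teich_exp_pred // subrr.
Qed.

End Teich.

(** * Reduction from level k + 1 to level k *)

Section Reduction.
Variables (p k : nat).
Hypotheses (p_prime : prime p) (k_gt0 : (0 < k)%N).
Let p_gt1 : (1 < p)%N := prime_gt1 p_prime.
Let R1 := 'Z_(p ^ k.+1).
Let R := 'Z_(p ^ k).

Definition level_red (x : 'Z_(p ^ k.+1)) : 'Z_(p ^ k) := (nat_of_ord x)%:R.

Lemma level_red_nat n : level_red n%:R = n%:R.
Proof.
rewrite /level_red val_Zp_nat ?pk_gt1 //.
rewrite [in RHS](divn_eq n (p ^ k.+1)) natrD natrM expnS [in (p * _)%:R]natrM.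
by rewrite [(p ^ k)%:R]natrX pZ_eq0 // !mulr0 add0r.
Qed.

Fact level_red_zmod_morphism : zmod_morphism level_red.
Proof.
move=> x y; rewrite -[x]natr_Zp -[y]natr_Zp.
set m := nat_of_ord x; set n := nat_of_ord y.
have ln : (n <= p ^ k.+1)%N.
  by rewrite -[X in (_ <= X)%N](Zp_cast (pk_gt1 p_gt1 (ltn0Sn k))) ltnW // ltn_ord.
have -> : m%:R - n%:R = (m + (p ^ k.+1 - n))%:R :> R1.
  by rewrite natrD natrB // natrX pZ_eq0 // sub0r.
by rewrite !level_red_nat natrD natrB // natrX pZ_eq0 // sub0r.
Qed.

Fact level_red_monoid_morphism : monoid_morphism level_red.
Proof.
split; first exact: (level_red_nat 1).
by move=> x y; rewrite -[x]natr_Zp -[y]natr_Zp -natrM !level_red_nat natrM.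
Qed.

HB.instance Definition _ :=
  GRing.isZmodMorphism.Build _ _ level_red level_red_zmod_morphism.
HB.instance Definition _ :=
  GRing.isMonoidMorphism.Build _ _ level_red level_red_monoid_morphism.

Lemma level_red_ratZ q : q \is a plocal p -> level_red (ratZ p k.+1 q) = ratZ p k q.
Proof.
move=> lq; apply/esym; have := lq; rewrite qualifE /= => c.
apply: (@ratZ_eq p k p_gt1 k_gt0 q _ (denq q) lq c (numq q)).
  by rewrite [RHS]numqE.
have := ratZE p_gt1 (ltn0Sn k) lq (esym (numqE q)).
by move=> /(congr1 level_red); rewrite rmorphM !rmorph_int.
Qed.

Lemma level_red_teich u : level_red (teich p k.+1 u) = teich p k u.
Proof.
rewrite (natr_Fp u) !teich_nat // rmorphXn rmorph_nat /=.
transitivity ((nat_of_ord u)%:R ^+ (p ^ k.-1 * p) : R).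
  by congr (_ ^+ _); rewrite -expnSr prednK.
by rewrite exprM -teich_nat // teich_exp_p.
Qed.

Lemma level_red_eq0 x : p%:R * x = 0 -> level_red x = 0.
Proof.
rewrite -[x]natr_Zp level_red_nat; set n := nat_of_ord x => e.
have : (p ^ k.+1 %| p * n)%N.
  apply/eqP; move: e; rewrite -natrM => /(congr1 (fun y : R1 => nat_of_ord y)).
  by rewrite val_Zp_nat ?pk_gt1.
rewrite expnS dvdn_pmul2l ?prime_gt0 // => /dvdnP [m ->].
by rewrite natrM natrX pZ_eq0 // mulr0.
Qed.

Definition level_hom : {rmorphism R1 -> R} := level_red.

End Reduction.

(** * Dwork's exponential *)

Definition eqXn (R : nzRingType) (M : nat) (f g : {poly R}) :=
  forall n, (n < M)%N -> f`_n = g`_n.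

Lemma eqXnM (R : nzRingType) M (f g f' g' : {poly R}) :
  eqXn M f g -> eqXn M f' g' -> eqXn M (f * f') (g * g').
Proof.
move=> e e' n nM; rewrite !coefM; apply: eq_bigr => i _.
by rewrite e ?e' //; have := ltn_ord i; lia.
Qed.

Lemma eqXnX (R : nzRingType) M (f g : {poly R}) l :
  eqXn M f g -> eqXn M (f ^+ l) (g ^+ l).
Proof. by move=> e; elim: l => [|l IH] //; rewrite !exprS; apply: eqXnM. Qed.

Lemma eqXn_trans (R : nzRingType) M (f g h : {poly R}) :
  eqXn M f g -> eqXn M g h -> eqXn M f h.
Proof. by move=> e e' n nM; rewrite e ?e'. Qed.

Definition exp_poly (M : nat) (c : rat) : {poly rat} := \poly_(n < M) (c ^+ n * exp_coef n).

Lemma exp_polyD M c c' : eqXn M (exp_poly M c * exp_poly M c') (exp_poly M (c + c')).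
Proof.
move=> n nM; rewrite coefM coef_poly nM addrC exprDn mulr_suml; apply: eq_bigr => i _.
have li := ltn_ord i; rewrite !coef_poly ifT; last by lia.
rewrite ifT; last by lia.
have f0 m : m`!%:R != 0 :> rat by rewrite pnatr_eq0 -lt0n fact_gt0.
have e : n`!%:R = 'C(n, i)%:R * i`!%:R * (n - i)`!%:R :> rat.
  by rewrite -!natrM -mulnA bin_fact.
have b0 : 'C(n, i)%:R != 0 :> rat by rewrite pnatr_eq0 -lt0n bin_gt0.
rewrite /exp_coef e -[X in _ = X * _]mulr_natr; move: (c ^+ i) (c' ^+ (n - i)) => u v.
have := f0 i; have := f0 (n - i)%N; move: b0.
move: ('C(n, i)%:R : rat) (i`!%:R : rat) ((n - i)`!%:R : rat) => x y z x0 z0 y0.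
by field; rewrite x0 y0 z0.
Qed.

Lemma exp_polyX M c l : eqXn M (exp_poly M c ^+ l) (exp_poly M (l%:R * c)).
Proof.
elim: l => [|l IH].
  move=> n nM; rewrite mul0r expr0 coef1 coef_poly nM.
  by case: n nM => [|n] nM; rewrite ?expr0 ?exp_coef0 ?mul1r // exprS !mul0r.
rewrite exprS -natr1 mulrDl mul1r addrC; apply: eqXn_trans (exp_polyD _ _).
exact: eqXnM.
Qed.

Lemma exp_poly0 M : (0 < M)%N -> exp_poly M 0 = 1.
Proof.
move=> M0; apply/polyP => -[|n]; rewrite coef_poly coef1.
  by rewrite M0 expr0 exp_coef0 mulr1.
by rewrite exprS !mul0r; case: ifP.
Qed.

Lemma eqXn_comp (R : nzRingType) M p (f g : {poly R}) : (0 < p)%N -> 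
  eqXn M f g -> eqXn M (f \Po 'X^p) (g \Po 'X^p).
Proof.
move=> p0 e n nM; rewrite !coef_comp_poly_Xn //; case: ifP => // _.
by rewrite e //; apply: leq_ltn_trans (leq_div _ _) nM.
Qed.

Section DworkExp.
Variable p : nat.
Hypothesis p_prime : prime p.
Hypothesis p_gt4 : (4 < p)%N.
Let p_gt0 : (0 < p)%N := prime_gt0 p_prime.
Let d := dwork_coef p.
Let pr0 : p%:R != 0 :> rat.
Proof. by rewrite pnatr_eq0 -lt0n. Qed.

Definition dwork_poly (M : nat) : {poly rat} := \poly_(n < M) d n.

Lemma dwork_polyE M :
  eqXn M (dwork_poly M) (exp_poly M 1 * (exp_poly M p%:R^-1 \Po 'X^p)).
Proof.
move=> n nM; rewrite coefM coef_poly nM /d /dwork_coef; apply: eq_bigr => i _.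
have li := ltn_ord i.
rewrite coef_poly ifT; last by lia.
rewrite expr1n mul1r coef_comp_poly_Xn // /exp_frob_coef; case: ifP => // _.
rewrite coef_poly ifT; first by rewrite exprVn [X in _ * X]mulrC.
by have := leq_div (n - i) p; lia.
Qed.

(** The p-th power of exp (y + y^p / p) is exp (p y) exp (y^p). At y = pi x one has y^p = - p pi
    x^p, so the two factors are inverse to each other as soon as x^p = x. *)
Lemma dwork_polyX M : eqXn M (dwork_poly M ^+ p) (exp_poly M p%:R * (exp_poly M 1 \Po 'X^p)).
Proof.
apply: eqXn_trans (eqXnX p (@dwork_polyE M)) _; rewrite exprMn.
apply: eqXnM; first by have := @exp_polyX M 1 p; rewrite mulr1.
rewrite -rmorphXn /=; apply: eqXn_comp => //.
by have := @exp_polyX M p%:R^-1 p; rewrite divff.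
Qed.

(** The estimate of [plocal_dwork_coef] as a condition on a coefficient of degree n. It is stable
    under products, and since 3/(4p) < 1/(p-1) the missing powers of p are supplied by pi^n. *)
Definition pi_integral (n : nat) (q : rat) := q * p%:R ^+ ((3 * n) %/ (4 * p)) \is a plocal p.

Lemma pi_integralM n m q r : pi_integral n q -> pi_integral m r -> pi_integral (n + m) (q * r).
Proof.
rewrite /pi_integral mulnDr => hq hr; have := rpredM hq hr.
set a := (_ %/ _)%N; set b := (_ %/ _)%N; set c := (_ %/ _)%N => h.
have le : (a + b <= c)%N by rewrite /a /b /c leq_divRL ?muln_gt0 // mulnDl leq_add // leq_trunc_div.
rewrite -(subnKC le) !exprD.
have -> : q * r * (p%:R ^+ a * p%:R ^+ b * p%:R ^+ (c - (a + b))) =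
  q * p%:R ^+ a * (r * p%:R ^+ b) * p%:R ^+ (c - (a + b)) by ring.
by apply: rpredM => //; rewrite rpredX // rpred_nat.
Qed.

Lemma pi_integralD n q r : pi_integral n q -> pi_integral n r -> pi_integral n (q + r).
Proof. by rewrite /pi_integral mulrDl; apply: rpredD. Qed.

Lemma pi_integral0 n : pi_integral n 0.
Proof. by rewrite /pi_integral mul0r rpred0. Qed.

Lemma pi_integral_sum n I (r : seq I) (P : pred I) (F : I -> rat) :
  (forall i, P i -> pi_integral n (F i)) -> pi_integral n (\sum_(i <- r | P i) F i).
Proof.
move=> h; elim/big_ind: _ => //; [exact: pi_integral0 | exact: pi_integralD].
Qed.

Definition pi_integral_poly (f : {poly rat}) := forall n, pi_integral n f`_n.

Lemma pi_integral_polyM f g :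
  pi_integral_poly f -> pi_integral_poly g -> pi_integral_poly (f * g).
Proof.
move=> hf hg n; rewrite coefM; apply: pi_integral_sum => i _.
have e : n = (i + (n - i))%N by have := ltn_ord i; lia.
by rewrite {1}e; apply: pi_integralM.
Qed.

Lemma pi_integral_polyX f l : pi_integral_poly f -> pi_integral_poly (f ^+ l).
Proof.
move=> hf; elim: l => [|l IH]; last by rewrite exprS; apply: pi_integral_polyM.
move=> n; rewrite expr0 coef1 /pi_integral.
by apply: rpredM; [exact: rpred_nat | rewrite rpredX // rpred_nat].
Qed.

Lemma pi_integral_dwork M : pi_integral_poly (dwork_poly M).
Proof.
move=> n; rewrite coef_poly; case: ifP => _; last exact: pi_integral0.
exact: plocal_dwork_coef.
Qed.

Lemma plocal_exp_coef n e : (n %/ 4 <= e)%N -> exp_coef n * p%:R ^+ e \is a plocal p.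
Proof.
move=> ne; have [m cm em] := pfactor_coprime p_prime (fact_gt0 n).
have v4 := logn_fact_le p_prime n p_gt4; set v := logn _ _ in em v4.
have le : (v <= e)%N by apply: leq_trans ne; rewrite leq_divRL // mulnC.
rewrite /exp_coef em natrM natrX -(subnKC le) exprD invfM mulrA mulfVK ?expf_neq0 //.
by rewrite rpredM ?plocalVn // rpredX // rpred_nat.
Qed.

Lemma pi_integral_exp M (c : int) : pi_integral_poly (exp_poly M (p%:R * c%:~R)).
Proof.
move=> n; rewrite coef_poly; case: ifP => _; last exact: pi_integral0.
rewrite /pi_integral exprMn.
have -> : p%:R ^+ n * c%:~R ^+ n * exp_coef n * p%:R ^+ (3 * n %/ (4 * p)) =
  c%:~R ^+ n * (exp_coef n * p%:R ^+ n) * p%:R ^+ (3 * n %/ (4 * p)) by ring.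
apply: rpredM; last by rewrite rpredX // rpred_nat.
apply: rpredM; first by rewrite rpredX // rpred_int.
by apply: plocal_exp_coef; apply: leq_div.
Qed.

Lemma pi_integral_exp_frob M : pi_integral_poly (exp_poly M 1 \Po 'X^p).
Proof.
move=> n; rewrite coef_comp_poly_Xn //; case: ifP => [/dvdnP [m ->]|_]; last exact: pi_integral0.
rewrite mulnK // coef_poly; case: ifP => _; last exact: pi_integral0.
rewrite /pi_integral expr1n mul1r; apply: plocal_exp_coef.
by rewrite mulnA divnMr // leq_div2r //; lia.
Qed.

End DworkExp.

Lemma nilp_mul_eq0 (S : comPzRingType) (y z : S) n : z ^+ n = 0 -> y * (1 + z) = 0 -> y = 0.
Proof.
move=> zn e; have e1 : y = y * - z by apply/eqP; rewrite -subr_eq0 mulrN opprK -{1}[y]mulr1 -mulrDr e.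
suff H m : y = y * (- z) ^+ m by rewrite (H n) exprNn zn !mulr0.
elim: m => [|m IH]; first by rewrite expr0 mulr1.
by rewrite exprS mulrA -e1.
Qed.

Lemma big_ord_recl2r (V : nmodType) (F : nat -> V) m n : m = n.+3 ->
  \sum_(i < m) F i = F 0 + F 1 + \sum_(i < n) F i.+2 + F n.+2.
Proof.
move=> ->; rewrite big_ord_recr /= big_ord_recl big_ord_recl /= !addrA.
by congr (_ + _ + _); apply: eq_bigr.
Qed.

(* With v = pi^2 s, (1 + v)^p - 1 = p v (1 + pi t) for some t, and pi is
   nilpotent. *)
Lemma exp_p_eq1 (S : comPzRingType) (p K : nat) (pi s : S) : prime p -> (2 < p)%N ->
  pi ^+ p.-1 = - p%:R -> (p%:R : S) ^+ K = 0 -> (1 + pi ^+ 2 * s) ^+ p = 1 ->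
  p%:R * (pi ^+ 2 * s) = 0.
Proof.
move=> p_prime p_gt2 piE pK; set v := pi ^+ 2 * s.
have pin : exists z, p%:R = pi * z.
  exists (- pi ^+ p.-2); rewrite mulrN -exprS (_ : p.-2.+1 = p.-1); last by lia.
  by rewrite piE opprK.
have vp : exists t, v ^+ p = p%:R * v * (pi * t).
  case: pin => z ez; exists (z * s ^+ p.-1).
  have -> : v ^+ p = v * v ^+ p.-1 by rewrite -exprS; congr (_ ^+ _); lia.
  rewrite {2}/v exprMn -exprM mulnC exprM piE sqrrN expr2 {2}ez; ring.
have mid (n : nat) : (n <= p.-2)%N ->
   exists t, \sum_(i < n) v ^+ i.+2 *+ 'C(p, i.+2) = p%:R * v * (pi * t).
  elim: n => [|n IH] np; first by exists 0; rewrite big_ord0 !mulr0.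
  have [t et] := IH (ltnW np).
  have /dvdnP [c ec] : (p %| 'C(p, n.+2))%N by apply: prime_dvd_bin => //; lia.
  have ev : v ^+ n.+2 = v * (v ^+ n * (pi * (pi * s))).
    by rewrite exprS exprSr {3}/v expr2 -!mulrA.
  exists (t + c%:R * v ^+ n * (pi * s)); rewrite big_ord_recr /= et ec ev.
  rewrite -[_ *+ (c * p)]mulr_natr natrM; move: (v ^+ n) => x; ring.
move=> E; have [t1 e1] := vp; have [t2 e2] := mid _ (leqnn _).
have : p%:R * v * (1 + pi * (t1 + t2)) = 0.
  have ep : p.+1 = p.-2.+3 by lia.
  have B : (1 + v) ^+ p = \sum_(i < p.+1) v ^+ i *+ 'C(p, i).
    by rewrite exprDn; apply: eq_bigr => i _; rewrite expr1n mul1r.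
  move: E; rewrite B (big_ord_recl2r (fun i => v ^+ i *+ 'C(p, i)) ep).
  rewrite (_ : p.-2.+2 = p); last by lia.
  rewrite bin0 bin1 binn expr0 expr1 !mulr1n e1 e2 => h.
  have {}h : v *+ p + p%:R * v * (pi * t2) + p%:R * v * (pi * t1) = 0.
    by apply: (@addrI _ 1); rewrite addr0 !addrA.
  by rewrite -[RHS]h -[v *+ p]mulr_natr; ring.
move=> H; apply: (@nilp_mul_eq0 _ _ (pi * (t1 + t2)) (p.-1 * K)%N) H.
by rewrite exprMn exprM piE exprNn pK mulr0 mul0r.
Qed.

(** * Dwork's exponential in a ring containing pi *)

Section Eisenstein.
Variables (p k : nat).
Hypotheses (p_prime : prime p) (p_gt4 : (4 < p)%N) (k_gt0 : (0 < k)%N).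
Let p_gt0 : (0 < p)%N := prime_gt0 p_prime.
Let p_gt1 : (1 < p)%N := prime_gt1 p_prime.
Let R := 'Z_(p ^ k).
Let rz := ratZ p k.
Variables (S : comNzRingType) (iota : {rmorphism R -> S}) (pi : S).
Hypothesis piE : pi ^+ p.-1 = - p%:R.

(* [pi_term n q] stands for [q * pi^n] : the powers of [pi ^+ p.-1 = - p] are
   moved into the rational [q], which need not be p-integral by itself. *)
Definition pi_term (n : nat) (q : rat) : S :=
  iota (rz (q * (- p%:R) ^+ (n %/ p.-1))) * pi ^+ (n %% p.-1).

Let b n := ((3 * n) %/ (4 * p))%N.

Lemma pdivs_pi_term n q e : pi_integral p n q -> (b n + e <= n %/ p.-1)%N ->
  pdivs p e (q * (- p%:R) ^+ (n %/ p.-1)).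
Proof.
move=> hq le; rewrite mulrC; apply: pdivs_sgn => //.
have pr0 : p%:R != 0 :> rat by rewrite pnatr_eq0 -lt0n.
rewrite /pdivs -(subnKC le) !exprD.
rewrite (_ : _ / _ = p%:R ^+ (n %/ p.-1 - (b n + e)) * (q * p%:R ^+ b n)).
  by rewrite rpredM // rpredX // rpred_nat.
have : p%:R ^+ e != 0 :> rat by rewrite expf_neq0.
move: (p%:R ^+ _) (p%:R ^+ _) (p%:R ^+ _) => x y z z0; by field.
Qed.

Lemma pi_exponent_le n : (b n <= n %/ p.-1)%N.
Proof.
clear k_gt0; have p10 : (0 < p.-1)%N by lia.
rewrite leq_divRL //; have := leq_trunc_div (3 * n) (4 * p); rewrite -/(b n).
by nia.
Qed.

(** As 1/(p-1) - 3/(4p) > 1/(4p), a degree of at least 4p(e+2) leaves e factors p to spare after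
    rounding. *)
Lemma pi_exponent_large n e : (4 * p * e.+2 <= n)%N -> (b n + e <= n %/ p.-1)%N.
Proof.
clear k_gt0; move=> ne; have p10 : (0 < p.-1)%N by lia.
rewrite leq_divRL //; have := leq_trunc_div (3 * n) (4 * p); rewrite -/(b n).
by nia.
Qed.

Lemma pi_exponent_gt1 n : (1 < n)%N -> (n %% p.-1 < 2)%N -> (b n + 1 <= n %/ p.-1)%N.
Proof.
clear k_gt0; move=> n1 n2; rewrite addn1 /b ltn_divLR ?muln_gt0 //.
have e := divn_eq n p.-1; set q := (n %/ p.-1)%N in e *.
by have q0 : (0 < q)%N by [nia|]; nia.
Qed.

Lemma plocal_pi_term n q : pi_integral p n q -> q * (- p%:R) ^+ (n %/ p.-1) \is a plocal p.
Proof.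
move=> hq; apply: (@plocal_pdivs p p_prime 0); apply: pdivs_pi_term => //.
by rewrite addn0 pi_exponent_le.
Qed.

Lemma rz_pow x i : x \is a plocal p -> rz (x * (- p%:R) ^+ i) = rz x * (- p%:R) ^+ i.
Proof.
move=> lx; rewrite /rz ratZM ?rpredX ?rpredN ?rpred_nat // ratZX ?rpredN ?rpred_nat //.
by rewrite ratZN ?rpred_nat // ratZ_nat.
Qed.

Lemma iota_pow x i r : iota (x * (- p%:R) ^+ i) * pi ^+ r = iota x * pi ^+ (r + p.-1 * i).
Proof.
by rewrite rmorphM rmorphXn rmorphN rmorph_nat /= exprD exprM piE; ring.
Qed.

Lemma pi_termM n m q r : pi_integral p n q -> pi_integral p m r ->
  pi_term n q * pi_term m r = pi_term (n + m) (q * r).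
Proof.
move=> hq hr; rewrite /pi_term.
have lq := plocal_pi_term hq; have lr := plocal_pi_term hr.
set x := q * _ in lq *; set y := r * _ in lr *.
pose c := ((n %% p.-1 + m %% p.-1) %/ p.-1)%N.
have p10 : (0 < p.-1)%N by lia.
have e1 : ((n + m) %/ p.-1 = n %/ p.-1 + m %/ p.-1 + c)%N.
  by rewrite {1}(divn_eq n p.-1) {1}(divn_eq m p.-1) addnACA -mulnDl divnMDl.
have e2 : (n %% p.-1 + m %% p.-1 = (n + m) %% p.-1 + p.-1 * c)%N.
  by have := divn_eq (n %% p.-1 + m %% p.-1) p.-1; rewrite modnDm -/c => ->;
    rewrite addnC (mulnC c).
have -> : q * r * (- p%:R) ^+ ((n + m) %/ p.-1) = x * y * (- p%:R) ^+ c.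
  rewrite e1 !exprD /x /y; move: (_ ^+ _) (_ ^+ _) (_ ^+ _) => *; ring.
rewrite rz_pow; last exact: rpredM lq lr.
rewrite (iota_pow (rz (x * y)) c) -e2 exprD /rz ratZM // [iota (_ * ratZ p k y)]rmorphM.
by rewrite mulrACA.
Qed.

Lemma pi_termD n q r : pi_integral p n q -> pi_integral p n r ->
  pi_term n (q + r) = pi_term n q + pi_term n r.
Proof.
move=> hq hr; rewrite /pi_term mulrDl /rz ratZD ?plocal_pi_term //.
by rewrite rmorphD mulrDl.
Qed.

Lemma pi_term0 n : pi_term n 0 = 0.
Proof. by rewrite /pi_term mul0r /rz (ratZ_int p k 0) rmorph0 mul0r. Qed.

Lemma pi_term_sum n I (r : seq I) (P : pred I) (F : I -> rat) :
  (forall i, P i -> pi_integral p n (F i)) ->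
  pi_term n (\sum_(i <- r | P i) F i) = \sum_(i <- r | P i) pi_term n (F i).
Proof.
move=> h; elim: r => [|i r IH]; first by rewrite !big_nil pi_term0.
rewrite !big_cons; case: ifP => // Pi.
by rewrite pi_termD ?IH ?h //; apply: pi_integral_sum.
Qed.

Lemma pi_term_large n q : pi_integral p n q -> (4 * p * k.+2 <= n)%N -> pi_term n q = 0.
Proof.
move=> hq le; rewrite /pi_term /rz pdivs_ratZ0 ?rmorph0 ?mul0r //.
by apply: pdivs_pi_term => //; apply: pi_exponent_large.
Qed.

Lemma pi_term_pi2 n q : pi_integral p n q -> (1 < n)%N -> exists s, pi_term n q = pi ^+ 2 * s.
Proof.
move=> hq n1; rewrite /pi_term; have [lt|ge] := ltnP (n %% p.-1) 2; last first.
  by exists (iota (rz (q * (- p%:R) ^+ (n %/ p.-1))) * pi ^+ (n %% p.-1 - 2));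
     rewrite mulrCA -exprD subnKC.
have /pdivsE [] := pdivs_pi_term hq (pi_exponent_gt1 n1 lt) => // y ly ->.
have -> : p%:R ^+ 1 * y = - y * (- p%:R) ^+ 1 by rewrite !expr1 mulrNN mulrC.
rewrite rz_pow ?rpredN //.
rewrite iota_pow muln1 (_ : p.-1 = 2 + (p - 3))%N; last by lia.
exists (iota (rz (- y)) * (pi ^+ (n %% (2 + (p - 3))) * pi ^+ (p - 3))).
by rewrite !exprD; ring.
Qed.

Definition pi_poly (M : nat) (f : {poly rat}) : {poly S} := \poly_(n < M) pi_term n f`_n.

Lemma pi_poly_eqXn M f g : eqXn M f g -> pi_poly M f = pi_poly M g.
Proof.
move=> e; apply/polyP => n; rewrite !coef_poly; case: ifP => // nM.
by rewrite e.
Qed.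

(** A product of truncations reaches degrees beyond M, but those coefficients vanish in S by
    [pi_term_large]; truncation is thus multiplicative. *)
Lemma pi_polyM M f g : (4 * p * k.+2 <= M)%N ->
  pi_integral_poly p f -> pi_integral_poly p g ->
  pi_poly M (f * g) = pi_poly M f * pi_poly M g.
Proof.
move=> kM hf hg; apply/polyP => n; rewrite coef_poly !coefM.
have V i : (i <= n)%N -> pi_integral p n (f`_i * g`_(n - i)).
  by move=> le; rewrite -{1}(subnKC le); apply: pi_integralM.
have T i : (i <= n)%N -> pi_term i f`_i * pi_term (n - i) g`_(n - i) = pi_term n (f`_i * g`_(n - i)).
  by move=> le; rewrite pi_termM // subnKC.
have [nM|Mn] := ltnP n M.
  rewrite pi_term_sum => [|i _]; last by apply: V; rewrite -ltnS.
  apply: eq_bigr => i _; have li := ltn_ord i.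
  by rewrite !coef_poly ifT ?ifT ?T //; lia.
rewrite big1 // => i _; have li := ltn_ord i; rewrite !coef_poly.
case: ifP => _; last by rewrite mul0r.
case: ifP => _; last by rewrite mulr0.
by rewrite T // pi_term_large ?V //; apply: leq_trans Mn.
Qed.

Lemma pi_polyX M f l : (4 * p * k.+2 <= M)%N -> pi_integral_poly p f ->
  pi_poly M (f ^+ l) = pi_poly M f ^+ l.
Proof.
move=> kM hf; elim: l => [|l IH]; last first.
  by rewrite !exprS pi_polyM // ?IH //; apply: pi_integral_polyX.
apply/polyP => n; rewrite !expr0 coef_poly !coef1; case: n => [|n] /=; last first.
  by rewrite pi_term0; case: ifP.
rewrite (leq_trans _ kM) ?muln_gt0 ?p_gt0 //.
by rewrite /pi_term div0n mod0n !expr0 !mulr1 /rz (ratZ_int p k 1) rmorph1.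
Qed.

Variable M : nat.
Hypothesis M_large : (4 * p * k.+2 <= M)%N.

(* Truncation of exp (pi (x - x^p)) : put y = pi x in exp (y + y^p / p). *)
Definition dwork_exp (x : S) : S := (pi_poly M (dwork_poly p M)).[x].

Lemma sum_dvdn_ord (V : nmodType) (F : nat -> V) m :
  \sum_(n < m * p) (if (p %| n)%N then F (n %/ p)%N else 0) = \sum_(j < m) F j.
Proof.
elim: m => [|m IH]; first by rewrite mul0n !big_ord0.
rewrite mulSnr big_split_ord /= IH big_ord_recr /=; congr (_ + _).
rewrite (bigD1 (Ordinal p_gt0)) //= addn0 dvdn_mull // mulnK //.
rewrite big1 ?addr0 // => i i0.
rewrite dvdn_addr ?dvdn_mull // gtnNdvd // lt0n.
by apply: contraNneq i0 => e; apply/eqP/val_inj.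
Qed.

(** For y = pi x with x^p = x, y^p = pi^p x^p = - p pi x. *)
Lemma pi_poly_frob x : x ^+ p = x ->
  (pi_poly M (exp_poly M 1 \Po 'X^p)).[x] = (pi_poly M (exp_poly M (- p%:R))).[x].
Proof.
move=> xp; rewrite !horner_poly.
pose F j := pi_term (j * p) (exp_coef j) * x ^+ j.
transitivity (\sum_(j < M) F j); last first.
  apply: eq_bigr => j _; rewrite /F coef_poly ltn_ord; congr (_ * _).
  have ejp : (j * p = j * p.-1 + j)%N by nia.
  have e1 : (j * p %/ p.-1 = j + j %/ p.-1)%N by rewrite ejp divnMDl //; lia.
  have e2 : (j * p %% p.-1 = j %% p.-1)%N by rewrite ejp modnMDl.
  rewrite /pi_term e1 e2.
  by congr (iota (rz _) * _); rewrite exprD mulrA (mulrC (exp_coef j)).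
pose H n := (if (p %| n)%N then F (n %/ p)%N else 0).
rewrite -(sum_dvdn_ord F).
have pM : (M <= M * p)%N by rewrite leq_pmulr.
rewrite -(subnKC pM) big_split_ord /= [X in _ = _ + X]big1 ?addr0; last first.
  move=> i _; case: ifP => // /dvdnP [j ej]; rewrite ej mulnK // /F.
  have lj : (4 * p * k.+2 <= j * p)%N by rewrite -ej; apply: leq_trans M_large _; apply: leq_addr.
  rewrite pi_term_large ?mul0r //.
  have := @pi_integral_exp_frob p p_prime p_gt4 j.+1 (j * p)%N.
  by rewrite coef_comp_poly_Xn // dvdn_mull // mulnK // coef_poly ltnSn expr1n mul1r.
apply: eq_bigr => i _; rewrite coef_comp_poly_Xn //.
case: ifP => [/dvdnP [j ej]|_]; last by rewrite pi_term0 mul0r.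
have li := ltn_ord i; rewrite ej mulnK // coef_poly ifT; last by rewrite ej in li; nia.
by rewrite expr1n mul1r /F mulnC exprM xp.
Qed.

Lemma M_gt1 : (1 < M)%N.
Proof. by apply: leq_trans M_large; nia. Qed.

Lemma dwork_exp_p x : x ^+ p = x -> dwork_exp x ^+ p = 1.
Proof.
move=> xp; have M0 := ltnW M_gt1.
have hp : pi_integral_poly p (exp_poly M p%:R).
  by have := @pi_integral_exp p p_prime p_gt4 M 1; rewrite mulr1.
have hn : pi_integral_poly p (exp_poly M (- p%:R)).
  by have := @pi_integral_exp p p_prime p_gt4 M (-1); rewrite mulrN1.
rewrite /dwork_exp -horner_exp -pi_polyX //; last exact: pi_integral_dwork.
rewrite (pi_poly_eqXn (@dwork_polyX p p_prime p_gt4 M)) pi_polyM //; last exact: pi_integral_exp_frob.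
rewrite hornerM pi_poly_frob // -hornerM -pi_polyM //.
rewrite (pi_poly_eqXn (@exp_polyD M _ _)) subrr exp_poly0 // -(expr0 (exp_poly M p%:R)).
by rewrite pi_polyX // expr0 hornerC.
Qed.

Lemma dwork_exp_pi2 x : exists s, dwork_exp x = 1 + pi * x + pi ^+ 2 * s.
Proof.
rewrite /dwork_exp horner_poly.
have H m : (1 < m)%N -> exists s, \sum_(i < m) pi_term i (dwork_poly p M)`_i * x ^+ i =
   1 + pi * x + pi ^+ 2 * s.
  case: m => [|[|m]] // _; elim: m => [|m [s IH]].
    exists 0; rewrite !big_ord_recr big_ord0 /= !coef_poly M_gt1 (ltnW M_gt1).
    have -> : dwork_coef p 1 = 1.
      by have := @dwork_coefS_lt p p_prime 0 p_gt1; rewrite mul1r dwork_coef0.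
    rewrite dwork_coef0 // /pi_term div0n mod0n divn_small; last by lia.
    rewrite modn_small; last by lia.
    by rewrite expr0 !mulr1 /rz (ratZ_int p k 1) rmorph1; ring.
  have [t et] := pi_term_pi2 (@pi_integral_dwork p p_prime p_gt4 M m.+2) (ltn0Sn m.+1 : 1 < m.+2)%N.
  by exists (s + t * x ^+ m.+2); rewrite big_ord_recr /= IH et; ring.
exact: H M_gt1.
Qed.

(** The quotient of [dwork_exp x * dwork_exp y] by [dwork_exp z] is a p-th root of 1, and it is 1
    modulo pi^2 because the linear terms cancel when z = x + y modulo p. Then [exp_p_eq1] applies;
    it controls p times the deviation from 1, which explains the factor p. The inverse of
    [dwork_exp z] is its power p-1. *)
Lemma dwork_exp_additive x y z w : x ^+ p = x -> y ^+ p = y -> z ^+ p = z ->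
  z = x + y + p%:R * w -> p%:R * (dwork_exp x * dwork_exp y - dwork_exp z) = 0.
Proof.
move=> xp yp zp ez; set D := _ - _.
have [s es] : exists s, D = pi ^+ 2 * s.
  have [sx ex] := dwork_exp_pi2 x; have [sy ey] := dwork_exp_pi2 y.
  have [sz esz] := dwork_exp_pi2 z.
  exists (sx * (1 + pi * y) + sy * (1 + pi * x) + pi ^+ 2 * sx * sy + x * y - sz
    + pi * (pi ^+ (p - 3) * w)).
  have ep : p%:R = - (pi ^+ 2 * pi ^+ (p - 3)).
    by rewrite -exprD -[p%:R]opprK -piE; congr (- _ ^+ _); lia.
  by rewrite /D ex ey esz ez ep; ring.
have Ez := dwork_exp_p zp.
have Ez1 : dwork_exp z * dwork_exp z ^+ p.-1 = 1 by rewrite -exprS prednK.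
set E := dwork_exp z ^+ p.-1 in Ez1.
have eDE : pi ^+ 2 * (s * E) = D * E by rewrite mulrA -es.
have -> : p%:R * D = p%:R * (pi ^+ 2 * (s * E)) * dwork_exp z.
  by rewrite eDE -[in LHS](mulr1 D) -Ez1; ring.
rewrite (@exp_p_eq1 S p k) ?mul0r //; first by lia.
  by rewrite -(rmorph_nat iota) -rmorphXn pZ_eq0 ?rmorph0.
rewrite eDE.
have -> : 1 + D * E = dwork_exp x * dwork_exp y * E by rewrite /D -Ez1; ring.
by rewrite !exprMn !dwork_exp_p // mul1r mul1r /E -exprM mulnC exprM Ez expr1n.
Qed.

End Eisenstein.

(** * The Gross-Koblitz formula *)

Definition eis_poly (R : comNzRingType) (p : nat) : {poly R} := 'X^(p.-1) + (p%:R)%:P.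

Section EisPoly.
Variables (R : comNzRingType) (p : nat).
Hypothesis p_gt4 : (4 < p)%N.
Let h := eis_poly R p.

Lemma size_eis_poly : size h = p.
Proof.
rewrite /h /eis_poly size_polyDl size_polyXn; first by lia.
by apply: leq_ltn_trans (size_polyC_leq1 _) _; lia.
Qed.

Lemma monic_eis_poly : h \is monic.
Proof.
rewrite monicE lead_coefE size_eis_poly /h /eis_poly coefD coefXn eqxx coefC.
by rewrite gtn_eqF ?addr0 //; lia.
Qed.

Lemma mk_monic_eis : mk_monic h = h.
Proof. by rewrite /mk_monic monic_eis_poly size_eis_poly andbT ifT //; lia. Qed.

Lemma in_qpoly_eis : in_qpoly h h = 0.
Proof. by apply/val_inj; rewrite /= mk_monic_eis Pdiv.RingMonic.rmodpp ?monic_eis_poly. Qed.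

Lemma in_qpolyC c : in_qpoly h c%:P = qpolyC h c.
Proof.
apply/val_inj; rewrite /= Pdiv.Ring.rmodp_small // mk_monic_eis size_eis_poly.
by apply: leq_ltn_trans (size_polyC_leq1 _) _; lia.
Qed.

Lemma qpolyX_exp : ('qX : {poly %/ h}) ^+ p.-1 = - p%:R.
Proof.
have e : in_qpoly h ('X^(p.-1) + (p%:R)%:P) = 0 by exact: in_qpoly_eis.
move: e; rewrite in_qpolyD (rmorphXn (in_qpoly h)) in_qpolyC (rmorph_nat (qpolyC h)).
by move/eqP; rewrite addr_eq0 => /eqP.
Qed.

(** The form in which freeness of S on 1, pi, ..., pi^(p-2) is used: a common power of pi can be
    removed from an identity between elements of R. *)
Lemma qpolyX_free c x : (c < p.-1)%N -> ('qX : {poly %/ h}) ^+ c * qpolyC h x = 0 -> x = 0.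
Proof.
move=> cp; rewrite -in_qpolyC -(rmorphXn (in_qpoly h)) -(rmorphM (in_qpoly h)).
rewrite mulrC mul_polyC => /(congr1 (fun z : {poly %/ h} => (z : {poly R})`_c)).
rewrite in_qpoly_small; first by rewrite coefZ coefXn eqxx mulr1 coef0.
rewrite mk_monic_eis size_eis_poly; apply: leq_ltn_trans (size_scale_leq _ _) _.
by rewrite size_polyXn; lia.
Qed.

End EisPoly.

Lemma sum_block_ord (V : nmodType) (F : nat -> V) m q :
  \sum_(n < m * q) F n = \sum_(i < m) \sum_(a < q) F (i * q + a)%N.
Proof.
elim: m => [|m IH]; first by rewrite mul0n !big_ord0.
by rewrite mulSnr big_split_ord /= IH big_ord_recr.
Qed.

Section Levels.
Variable p : nat.
Hypotheses (p_prime : prime p) (p_gt4 : (4 < p)%N).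
Let p_gt0 : (0 < p)%N := prime_gt0 p_prime.
Let p_gt1 : (1 < p)%N := prime_gt1 p_prime.
Let p1_gt0 : (0 < p.-1)%N. Proof. by lia. Qed.

(** A lift of Dwork's exponential to a polynomial in pi, before division by X^(p-1) + p, so that its
    coefficients can be reduced from level k + 1 to level k. *)
Definition dwork_exp_poly (k M : nat) (x : 'Z_(p ^ k)) : {poly 'Z_(p ^ k)} :=
  \sum_(n < M) (ratZ p k (dwork_coef p n * (- p%:R) ^+ (n %/ p.-1)) * x ^+ n)%:P
               * 'X^(n %% p.-1).

Lemma dwork_exp_polyE k M x :
  dwork_exp (qpolyC (eis_poly 'Z_(p ^ k) p)) 'qX M (qpolyC _ x) =
  in_qpoly _ (dwork_exp_poly M x).
Proof.
rewrite /dwork_exp horner_poly /dwork_exp_poly rmorph_sum; apply: eq_bigr => i _.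
rewrite rmorphM /= in_qpolyC // rmorphM rmorphXn rmorphXn /= /pi_term coef_poly ltn_ord.
by rewrite mulrAC.
Qed.

(* dwork_exp_additive is only an identity up to p-torsion, so additivity modulo
   p^k is deduced from the computation modulo p^(k+1). *)
Section Step.
Variable k : nat.
Hypothesis k_gt0 : (0 < k)%N.
Let R1 := 'Z_(p ^ k.+1).
Let R := 'Z_(p ^ k).
Variable red : {rmorphism R1 -> R}.
Hypothesis redE : red =1 @level_red p k.

Lemma map_dwork_exp_poly M u :
  map_poly red (dwork_exp_poly M (teich p k.+1 u)) = dwork_exp_poly M (teich p k u).
Proof.
rewrite /dwork_exp_poly (rmorph_sum (map_poly red)); apply: eq_bigr => n _.
rewrite rmorphM /= map_polyC map_polyXn /= rmorphM rmorphXn !redE.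
rewrite level_red_teich // level_red_ratZ //; apply: plocal_pi_term => //.
exact: plocal_dwork_coef.
Qed.

Lemma in_qpoly_red (V : {poly R1}) :
  p%:R * in_qpoly (eis_poly R1 p) V = 0 -> in_qpoly (eis_poly R p) (map_poly red V) = 0.
Proof.
move=> e; set h1 := eis_poly R1 p.
have mh1 : h1 \is monic by apply: monic_eis_poly.
have eV := Pdiv.RingMonic.rdivp_eq mh1 V.
have r0 : p%:R * (Pdiv.Ring.rmodp V h1) = 0.
  have : in_qpoly h1 (p%:R * Pdiv.Ring.rmodp V h1) = 0.
    rewrite rmorphM rmorph_nat /= -[RHS]e; congr (_ * _).
    by rewrite [in RHS]eV rmorphD rmorphM /= in_qpoly_eis // mulr0 add0r.
  rewrite -polyC_natr mul_polyC => /(congr1 (fun z : {poly %/ h1} => z : {poly R1})).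
  rewrite in_qpoly_small ?mk_monic_eis //.
  apply: leq_ltn_trans (size_scale_leq _ _) _.
  by rewrite Pdiv.Ring.ltn_rmodp monic_neq0.
have redr : map_poly red (Pdiv.Ring.rmodp V h1) = 0.
  apply/polyP => i; rewrite coef_map coef0 /= redE; apply: level_red_eq0 => //.
  have := congr1 (fun q : {poly R1} => q`_i) r0.
  by rewrite -polyC_natr coefCM coef0.
have -> : map_poly red V = map_poly red (Pdiv.Ring.rdivp V h1) * map_poly red h1.
  by rewrite [in LHS]eV rmorphD rmorphM /= redr addr0.
rewrite rmorphM /=.
have -> : map_poly red h1 = eis_poly R p.
  by rewrite rmorphD /= map_polyXn map_polyC /= rmorph_nat.
by rewrite in_qpoly_eis // mulr0.
Qed.

End Step.

(** The existential isolates the facts about S used later. In the Gauss sum, orthogonality retains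
    the terms d_n pi^n with n = a + (p-1) i; pi^((p-1) i) = (-p)^i turns them into (p-1) pi^a times
    the diagonal sum of the trace formula. *)
Theorem gross_koblitz k : (0 < k)%N ->
  exists (S : comNzRingType) (iota : {rmorphism 'Z_(p ^ k) -> S}) (pi : S) (psi : 'F_p -> S),
  [/\ forall c x, (c < p.-1)%N -> pi ^+ c * iota x = 0 -> x = 0, pi ^+ p.-1 = - p%:R, psi 0 = 1,
      forall u v, psi (u + v) = psi u * psi v
    & forall a, (a < p.-1)%N ->
      \sum_u iota (omegabar_pow p k a u) * psi u =
      - (pi ^+ a * iota (gammap p k (a%:R / (p.-1)%:R)))].
Proof.
move=> k_gt0; set R := 'Z_(p ^ k); pose h := eis_poly R p.
(* 4p(k+3) is the cutoff required at level k + 1, where additivity is checked; a multiple of p-1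
   lets the degrees split into full systems of residues. *)
pose q := (4 * p * k.+3)%N; pose M := (q * p.-1)%N.
pose psi u := in_qpoly h (dwork_exp_poly M (teich p k u)).
have M_large : (4 * p * k.+3 <= M)%N by rewrite /M leq_pmulr.
have psiE (u : 'F_p) : psi u = \sum_(i < q) \sum_(a < p.-1)
   qpolyC h (ratZ p k (dwork_coef p (i * p.-1 + a) * (- p%:R) ^+ i) *
      teich p k u ^+ (i * p.-1 + a)) * 'qX ^+ a.
  rewrite /psi /dwork_exp_poly rmorph_sum /=.
  rewrite (sum_block_ord (fun n => in_qpoly h ((ratZ p k (dwork_coef p n *
    (- p%:R) ^+ (n %/ p.-1)) * teich p k u ^+ n)%:P * 'X^(n %% p.-1)))).
  apply: eq_bigr => i _; apply: eq_bigr => a _.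
  rewrite divnMDl // modnMDl divn_small ?modn_small ?addn0 //.
  by rewrite rmorphM rmorphXn /= in_qpolyC.
exists {poly %/ h}, (qpolyC h), 'qX, psi; split.
- by move=> c x; apply: qpolyX_free.
- exact: qpolyX_exp.
- rewrite psiE teich0 //; have q_gt0 : (0 < q)%N by rewrite /q !muln_gt0 p_gt0.
  rewrite (bigD1 (Ordinal q_gt0)) //= (bigD1 (Ordinal p1_gt0)) //= mul0n dwork_coef0 //.
  rewrite !expr0 !mulr1 (ratZ_int p k 1) rmorph1.
  rewrite big1 => [|a a0]; last first.
    by rewrite add0n expr0n (negbTE (a0 : (a : nat) != 0%N)) mulr0 rmorph0 mul0r.
  rewrite addr0 big1 ?addr0 // => i i0; rewrite big1 // => a _.
  rewrite expr0n addn_eq0 muln_eq0 (negbTE (i0 : (i : nat) != 0%N)) (gtn_eqF p1_gt0).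
  by rewrite mulr0 rmorph0 mul0r.
- move=> u v.
  have [red redE] : exists red : {rmorphism 'Z_(p ^ k.+1) -> R}, red =1 @level_red p k.
    by exists (level_hom p_prime k_gt0).
  pose e w := dwork_exp_poly M (teich p k.+1 w).
  have psiM w : psi w = in_qpoly h (map_poly red (e w)).
    by rewrite /psi /e map_dwork_exp_poly.
  have : in_qpoly h (map_poly red (e u * e v - e (u + v))) = 0.
    apply: (in_qpoly_red k_gt0 redE).
    set h1 := eis_poly _ p.
    have -> : in_qpoly h1 (e u * e v - e (u + v)) =
      in_qpoly h1 (e u) * in_qpoly h1 (e v) - in_qpoly h1 (e (u + v)).
      by rewrite (rmorphB (in_qpoly h1)) (rmorphM (in_qpoly h1)).
    rewrite /e -!(@dwork_exp_polyE k.+1 M).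
    have [w ew] := teichD_congr p_prime (ltn0Sn k) u v.
    apply: (@dwork_exp_additive p k.+1 p_prime p_gt4 _ _ _ _ _ M _ _ _ _
       (qpolyC (eis_poly 'Z_(p ^ k.+1) p) w)) => //.
    + exact: qpolyX_exp.
    + by rewrite -rmorphXn teich_exp_p.
    + by rewrite -rmorphXn teich_exp_p.
    + by rewrite -rmorphXn teich_exp_p.
    + by rewrite -(rmorph_nat (qpolyC _)) -rmorphM -!rmorphD -ew.
  have -> : in_qpoly h (map_poly red (e u * e v - e (u + v))) = psi u * psi v - psi (u + v).
    rewrite !psiM (rmorphB (map_poly red)) (rmorphM (map_poly red)).
    by rewrite (rmorphB (in_qpoly h)) (rmorphM (in_qpoly h)).
  move=> /eqP.
  by rewrite subr_eq0 => /eqP ->.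
- move=> a ap; rewrite (bigD1 0) //= /omegabar_pow eqxx rmorph0 mul0r add0r.
  under eq_bigr => u u0.
    rewrite (negbTE u0) psiE mulr_sumr; under eq_bigr => i _ do rewrite mulr_sumr.
    over.
  rewrite exchange_big /=; under eq_bigr => i _ do rewrite exchange_big /=.
  pose c (i b : nat) := ratZ p k (dwork_coef p (i * p.-1 + b) * (- p%:R) ^+ i).
  transitivity (\sum_(i < q) qpolyC h (c i a * p.-1%:R) * 'qX ^+ a).
    apply: eq_bigr => i _.
    rewrite -(big_mkord predT (fun b => \sum_(u | u != 0) qpolyC h ((teich p k u)^-1 ^+ a) *
      (qpolyC h (c i b * teich p k u ^+ (i * p.-1 + b)) * 'qX ^+ b))).
    have E b : (b < p.-1)%N -> \sum_(u | u != 0) qpolyC h ((teich p k u)^-1 ^+ a) *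
      (qpolyC h (c i b * teich p k u ^+ (i * p.-1 + b)) * 'qX ^+ b) =
      (a == b)%:R * (qpolyC h (c i b * p.-1%:R) * 'qX ^+ b).
      move=> bp; transitivity (qpolyC h (c i b * \sum_(u | u != 0)
         (teich p k u)^-1 ^+ a * teich p k u ^+ (i * p.-1 + b)) * 'qX ^+ b).
        rewrite mulr_sumr rmorph_sum mulr_suml; apply: eq_bigr => u _.
        by rewrite mulrA -rmorphM mulrCA.
      rewrite sum_teich_dual // mulrCA rmorphM rmorph_nat -mulrA //.
    rewrite big_mkord (eq_bigr (fun b : 'I_p.-1 => (a == b)%:R *
        (qpolyC h (c i b * p.-1%:R) * 'qX ^+ b))) => [|b _]; last exact: E.
    by rewrite (sum_ord_delta _ (fun b => qpolyC h (c i b * p.-1%:R) * 'qX ^+ b)) ap.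
  have aE : p%:R * (a%:R / p.-1%:R) = a%:R + a%:R / p.-1%:R :> 'Z_(p ^ k).
    have -> : p%:R = p.-1%:R + 1 :> 'Z_(p ^ k) by rewrite natr1 prednK.
    rewrite mulrDl mul1r mulrC divrK //; apply: natZ_unit => //.
    by rewrite coprime_p1.
  rewrite -mulr_suml -rmorph_sum -mulr_suml mulrC -mulrN -rmorphN; congr (_ * qpolyC h _).
  rewrite -(gamma_series_gammap p_prime p_gt4 k_gt0 ap).
  rewrite (@gamma_series_trace p p_prime p_gt4 k k_gt0 a _ _ aE q); first last.
  + by rewrite /q; nia.
  + by lia.
  rewrite mulrC -mulNr; congr (_ * _).
    by rewrite -subn1 natrB // opprB.
  by apply: eq_bigr => i _; rewrite /c mulrC addnC mulnC.
Qed.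

End Levels.

(** * Powers of the Teichmueller character *)

Section Characters.
Variables (p k : nat).
Hypotheses (p_prime : prime p) (p_gt4 : (4 < p)%N) (k_gt0 : (0 < k)%N).
Let p1_gt0 : (0 < p.-1)%N. Proof. by clear k_gt0; lia. Qed.
Let R := 'Z_(p ^ k).
Local Notation W := (omegabar_pow p k).

Lemma omegabar0 a : W a 0 = 0.
Proof. by rewrite /omegabar_pow eqxx. Qed.

Lemma omegabarE a u : u != 0 -> W a u = (teich p k u)^-1 ^+ a.
Proof. by move=> u0; rewrite /omegabar_pow (negbTE u0). Qed.

Lemma omegabar_zero u : W 0 u = (u != 0)%:R.
Proof. by rewrite /omegabar_pow; case: eqP. Qed.

Lemma omegabar1 a : W a 1 = 1.
Proof. by rewrite omegabarE ?oner_eq0 // teich1 // invr1 expr1n. Qed.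

Lemma omegabarM a u v : W a (u * v) = W a u * W a v.
Proof.
rewrite /omegabar_pow mulf_eq0; have [u0|u0] := eqVneq u 0; first by rewrite mul0r.
have [v0|v0] := eqVneq v 0; first by rewrite mulr0.
by rewrite /= teichM // invrM ?teich_unit // mulrC exprMn.
Qed.

Lemma omegabarX a u n : (0 < n)%N || (u != 0) -> W a (u ^+ n) = W (a * n) u.
Proof.
rewrite orbC; have [->|u0] := eqVneq u 0 => /= H.
  by rewrite expr0n gtn_eqF // !omegabar0.
by rewrite !omegabarE ?expf_neq0 // teichX // -exprVn -exprM mulnC.
Qed.

Lemma omegabarD a b u : W (a + b) u = W a u * W b u.
Proof. by rewrite /omegabar_pow; case: eqP; rewrite ?mul0r // exprD. Qed.

Lemma omegabar_period a i : W (a + i * p.-1) =1 W a.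
Proof.
move=> u; have [->|u0] := eqVneq u 0; first by rewrite !omegabar0.
by rewrite !omegabarE // exprD mulnC exprM [_ ^-1 ^+ p.-1]exprVn teich_exp_pred // invr1 expr1n mulr1.
Qed.

Lemma omegabar_pred u : u != 0 -> W p.-1 u = 1.
Proof. by move=> u0; rewrite omegabarE // exprVn teich_exp_pred // invr1. Qed.

Lemma omegabar_unit a u : u != 0 -> W a u \is a GRing.unit.
Proof. by move=> u0; rewrite omegabarE // unitrX // unitrV teich_unit. Qed.

Lemma omegabarV a u : u != 0 -> W a u * W a u^-1 = 1.
Proof. by move=> u0; rewrite -omegabarM divff // omegabar1. Qed.

Lemma omegabar_sub1_unit a u : u != 0 -> u ^+ a != 1 -> W a u - 1 \is a GRing.unit.
Proof.
move=> u0 ua; have h := teich_sub1_unit p_prime k_gt0 (expf_neq0 a u0) ua.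
have -> : W a u - 1 = - (W a u * (teich p k (u ^+ a) - 1)).
  rewrite mulrBr mulr1 opprB teichX // omegabarE // -exprMn mulVr ?teich_unit //.
  by rewrite expr1n.
by rewrite unitrN unitrM omegabar_unit.
Qed.

Lemma sum_omegabar a : ~~ (p.-1 %| a)%N -> \sum_u W a u = 0.
Proof.
move=> ndiv; have [g gp] := Fp_prim_root p_prime.
have g0 := Fp_prim_root_neq0 p_prime gp.
have un : W a g - 1 \is a GRing.unit.
  by apply: omegabar_sub1_unit; rewrite // -(prim_order_dvd gp).
apply: (mulrI un); rewrite mulr0 mulrBl mul1r mulr_sumr.
rewrite [X in _ - X](reindex_inj (mulfI g0)) /=.
by apply/eqP; rewrite subr_eq0; apply/eqP; apply: eq_bigr => u _; rewrite omegabarM.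
Qed.

Lemma sum_omegabar_dual u : u != 0 -> \sum_(a < p.-1) W a u = (u == 1)%:R * p.-1%:R.
Proof.
move=> u0; have := @sum_teich_pow p k p_prime k_gt0 u^-1; rewrite invr_eq0 u0 => /(_ isT).
rewrite -(inj_eq invr_inj) invrK invr1 => <-; apply: eq_bigr => a _.
rewrite omegabarE //; congr (_ ^+ _).
apply: (mulrI (teich_unit p_prime k_gt0 u0)).
by rewrite divrr ?teich_unit // -teichM // divff // teich1.
Qed.

Lemma prim_root_sum (V : nmodType) (F : 'F_p -> V) g : p.-1.-primitive_root g ->
  \sum_(u | u != 0) F u = \sum_(e < p.-1) F (g ^+ e).
Proof.
move=> gp.
have inj : injective (fun e : 'I_p.-1 => g ^+ e).
  move=> e e' /eqP; rewrite (eq_prim_root_expr gp) => /eqP.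
  by rewrite !modn_small // => /val_inj.
have g0 := Fp_prim_root_neq0 p_prime gp.
transitivity (\sum_(u in [set g ^+ (nat_of_ord e) | e : 'I_p.-1]) F u); last first.
  by rewrite big_imset //= => e e' _ _; apply: inj.
apply: eq_bigl => u.
have -> : [set g ^+ (nat_of_ord e) | e : 'I_p.-1] = [set~ 0].
  apply/eqP; rewrite eqEcard cardsC1 card_Fp // card_imset // card_ord leqnn andbT.
  by apply/subsetP => _ /imsetP [e _ ->]; rewrite !inE expf_neq0.
by rewrite !inE.
Qed.

(** The number of n-th roots of w != 0 is the sum at w of the n characters of order dividing n. *)
Lemma sum_exp_fibre (V : comNzRingType) (f : {rmorphism R -> V}) (F : 'F_p -> V) n m :
  (n * m = p.-1)%N ->
  \sum_(u | u != 0) F (u ^+ n) = \sum_(w | w != 0) F w * \sum_(i < n) f (W (i * m) w).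
Proof.
move=> nm; have [g gp] := Fp_prim_root p_prime.
have g0 := Fp_prim_root_neq0 p_prime gp.
have [n0 m0] : (0 < n)%N /\ (0 < m)%N by move: p1_gt0; rewrite -nm muln_gt0 => /andP.
rewrite !(prim_root_sum _ gp) -nm.
have inner e : \sum_(i < n) W (i * m) (g ^+ e) = (n %| e)%:R * n%:R.
  have ge : g ^+ e != 0 by rewrite expf_neq0.
  have E i : W (i * m) (g ^+ e) = W m (g ^+ e) ^+ i.
    by rewrite !omegabarE // mulnC exprM.
  under eq_bigr => i _ do rewrite E.
  have [ne|ne] := boolP (n %| e)%N.
    have -> : W m (g ^+ e) = 1.
      have /dvdnP [l ->] := ne.
      by rewrite exprM omegabarX ?n0 // mulnC nm omegabar_pred // expf_neq0.
    by under eq_bigr => i _ do rewrite expr1n; rewrite sumr_const card_ord mul1r.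
  have un : W m (g ^+ e) - 1 \is a GRing.unit.
    apply: omegabar_sub1_unit => //; rewrite -exprM -(prim_order_dvd gp) -nm.
    by rewrite dvdn_pmul2r.
  rewrite mul0r; apply: (mulrI un); rewrite mulr0 -subrX1.
  rewrite omegabarE // -exprM [(m * n)%N]mulnC nm exprVn teich_exp_pred //.
  by rewrite invr1 subrr.
under [in RHS]eq_bigr => e _ do rewrite -(rmorph_sum f) inner rmorphM !rmorph_nat.
transitivity (\sum_(i < n) \sum_(a < m) F (g ^+ (a * n))).
  rewrite (sum_block_ord (fun e => F (g ^+ e ^+ n))); apply: eq_bigr => i _.
  apply: eq_bigr => a _; congr (F _).
  by rewrite -exprM mulnDl -mulnA [(m * n)%N]mulnC nm exprD mulnC exprM Fp_exp_pred //
    ?expr1n ?mul1r // .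
rewrite sumr_const card_ord mulnC.
rewrite (sum_block_ord (fun e => F (g ^+ e) * ((n %| e)%:R * n%:R))) -sumrMnl.
apply: eq_bigr => i _; rewrite (bigD1 (Ordinal n0)) //= addn0 dvdn_mull // mul1r mulr_natr.
rewrite big1 ?addr0 // => a a0; rewrite dvdn_addr ?dvdn_mull // gtnNdvd ?mul0r ?mulr0 //.
by rewrite lt0n; apply: contraNneq a0 => e; apply/eqP/val_inj.
Qed.

End Characters.

(** * Gauss sums *)

Section Gauss.
Variables (p k t : nat).
Hypotheses (p_prime : prime p) (p_gt4 : (4 < p)%N) (k_gt0 : (0 < k)%N).
Hypothesis p1E : p.-1 = (4 * t)%N.
Let R := 'Z_(p ^ k).
Local Notation W := (omegabar_pow p k).
Let t_gt0 : (0 < t)%N. Proof. by clear k_gt0; lia. Qed.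

Variables (S : comNzRingType) (iota : {rmorphism R -> S}) (pi : S) (psi : 'F_p -> S).
Hypothesis free : forall c x, (c < p.-1)%N -> pi ^+ c * iota x = 0 -> x = 0.
Hypothesis piE : pi ^+ p.-1 = - p%:R.
Hypothesis psi0 : psi 0 = 1.
Hypothesis psiD : forall u v, psi (u + v) = psi u * psi v.
Hypothesis gk : forall a, (a < p.-1)%N ->
  \sum_u iota (W a u) * psi u = - (pi ^+ a * iota (gammap p k (a%:R / (p.-1)%:R))).

Definition gauss (a : nat) : S := \sum_u iota (W a u) * psi u.
Let g := gauss.
Definition gamma_frac (a : nat) : R := gammap p k (a%:R / (p.-1)%:R).
Let gam := gamma_frac.
Definition jacobi (a b : nat) : R := \sum_x W a x * W b (1 - x).
Let J := jacobi.

Lemma gaussE a : (a < 4 * t)%N -> g a = - (pi ^+ a * iota (gam a)).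
Proof. by rewrite -p1E; apply: gk. Qed.

Lemma gauss_period a : g (a + 4 * t) = g a.
Proof.
apply: eq_bigr => u _; congr (iota _ * _).
by have := omegabar_period p_prime k_gt0 a 1 u; rewrite mul1n p1E.
Qed.

Lemma gamma_frac0 : gam 0 = 1.
Proof.
rewrite /gam /gamma_frac -(gamma_series_gammap p_prime p_gt4 k_gt0); last by lia.
by rewrite mul0r gamma_series00.
Qed.

Lemma gauss0 : g 0 = -1.
Proof. by rewrite gaussE ?muln_gt0 // gamma_frac0 expr0 rmorph1 mulr1. Qed.

Lemma gamma_frac_reflection a : (0 < a < 4 * t)%N -> gam a * gam (4 * t - a) = (-1) ^+ a.+1.
Proof.
by rewrite /gam /gamma_frac -p1E => ha; apply: gammap_reflection.
Qed.

Lemma gamma_frac_unit a : (a < 4 * t)%N -> gam a \is a GRing.unit.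
Proof.
move=> a4; have [->|a0] := posnP a; first by rewrite gamma_frac0 unitr1.
have : gam a * gam (4 * t - a) \is a GRing.unit.
  by rewrite gamma_frac_reflection ?a0 // unitrX // unitrN1.
by rewrite unitrM => /andP [].
Qed.

Lemma pi4t : pi ^+ (4 * t) = - p%:R. Proof. by rewrite -p1E. Qed.

Lemma gauss_reflection a : (0 < a < 4 * t)%N -> g a * g (4 * t - a) = (-1) ^+ a * p%:R.
Proof.
move=> /andP [a0 a4]; rewrite !gaussE //; last by lia.
rewrite mulrNN mulrACA -exprD subnKC 1?ltnW // pi4t -rmorphM.
rewrite gamma_frac_reflection ?a0 // rmorphXn rmorphN1 exprS; ring.
Qed.

Lemma sum_psi : \sum_u psi u = 0.
Proof.
have := gauss0; rewrite /g /gauss (bigD1 0) //= omegabar0 rmorph0 mul0r add0r => e.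
rewrite (bigD1 0) //= psi0 [X in _ + X](_ : _ = -1) ?subrr // -e.
by apply: eq_bigr => u u0; rewrite omegabar_zero u0 rmorph1 mul1r.
Qed.

Lemma sum_psiM c : \sum_z psi (z * c) = (c == 0)%:R * p%:R.
Proof.
have [->|c0] := eqVneq c 0.
  under eq_bigr => z _ do rewrite mulr0 psi0.
  by rewrite sumr_const card_Fp // mul1r.
by rewrite mul0r -[RHS]sum_psi [RHS](reindex_inj (mulIf c0)).
Qed.

Lemma gauss_jacobi a b : ~~ (4 * t %| a + b)%N -> g a * g b = iota (J a b) * g (a + b).
Proof.
move=> nab; rewrite /g /gauss mulr_suml.
transitivity (\sum_s psi s * \sum_u iota (W a u) * iota (W b (s - u))).
  under eq_bigr => u _ do rewrite mulr_sumr.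
  under [in RHS]eq_bigr => s _ do rewrite mulr_sumr.
  rewrite [RHS]exchange_big /=; apply: eq_bigr => u _.
  rewrite [RHS](reindex_inj (addrI u)) /=; apply: eq_bigr => v _.
  by rewrite psiD addrAC subrr add0r; ring.
rewrite mulr_sumr; apply: eq_bigr => s _; have [->|s0] := eqVneq s 0.
  rewrite omegabar0 rmorph0 mul0r mulr0 [X in _ * X](_ : _ = 0) ?mulr0 //.
  under eq_bigr => u _ do rewrite sub0r -mulN1r omegabarM // -rmorphM mulrCA -omegabarD rmorphM.
  by rewrite -mulr_sumr -rmorph_sum sum_omegabar ?p1E // rmorph0 mulr0.
rewrite mulrA [RHS]mulrC; congr (_ * _); rewrite [LHS](reindex_inj (mulfI s0)) /=.
rewrite /J /jacobi -rmorphM mulr_suml rmorph_sum; apply: eq_bigr => x _.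
rewrite -{2}(mulr1 s) -mulrBr !omegabarM // omegabarD -rmorphM; congr (iota _); ring.
Qed.

Lemma sqr_fibre (F : 'F_p -> R) : \sum_y F (y ^+ 2) = \sum_w F w * (1 + W (2 * t) w).
Proof.
rewrite (bigD1 0) //= [RHS](bigD1 0) //= expr0n omegabar0 addr0 mulr1; congr (_ + _).
have := @sum_exp_fibre p k p_prime p_gt4 k_gt0 _ idfun F 2 (2 * t).
rewrite mulnA p1E => ->//; apply: eq_bigr => w w0.
by rewrite !big_ord_recl big_ord0 /= addr0 mul0n omegabar_zero w0 mul1n.
Qed.

Lemma two_neq0 : (2%:R : 'F_p) != 0.
Proof.
apply/negP => /eqP /(congr1 (fun x : 'F_p => nat_of_ord x)).
by rewrite val_Fp_nat // modn_small //; apply: leq_trans p_gt4.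
Qed.

(** Substituting x = (1+y)/2 gives x (1-x) = (1 - y^2)/4; the sum over squares then brings in the
    quadratic character. *)
Lemma jacobi_duplication a : ~~ (4 * t %| a)%N -> J a a = W a 4%:R^-1 * J a (2 * t).
Proof.
move=> na; have n2 := two_neq0.
have e4 : 4%:R = 2%:R * 2%:R :> 'F_p by rewrite -natrM.
have aff : injective (fun y : 'F_p => (1 + y) / 2%:R).
  by move=> x y /(mulIf (invr_neq0 n2)) /addrI.
rewrite /J /jacobi (reindex_inj aff) /=.
transitivity (W a 4%:R^-1 * \sum_y W a (1 - y ^+ 2)).
  rewrite mulr_sumr; apply: eq_bigr => y _; rewrite -!omegabarM //; congr (W _ _).
  by rewrite e4; field; rewrite (_ : 4 = 2 * 2 :> 'F_p) ?mulf_neq0 ?n2.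
congr (_ * _); rewrite (sqr_fibre (fun w => W a (1 - w))).
have -> : \sum_x W a x * W (2 * t) (1 - x) = \sum_w W a (1 - w) * W (2 * t) w.
  have inj : injective (fun x : 'F_p => 1 - x) by move=> x y /addrI /oppr_inj.
  rewrite (reindex_inj inj) /=; apply: eq_bigr => w _.
  by rewrite subKr.
under eq_bigr => w _ do rewrite mulrDr mulr1.
rewrite big_split /= [X in X + _](_ : _ = 0) ?add0r //.
have inj : injective (fun x : 'F_p => 1 - x) by move=> x y /addrI /oppr_inj.
rewrite (reindex_inj inj) /=; under eq_bigr => w _ do rewrite subKr.
by rewrite sum_omegabar // p1E.
Qed.

(** Gauss sums cannot be cancelled but Gamma values can. For a + b < 4t both sides of [gauss_jacobi]
    carry the same power pi^(a+b), whose removal leaves a relation in R. *)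
Lemma gamma_jacobi a b : (0 < a + b < 4 * t)%N -> gam a * gam b = - J a b * gam (a + b).
Proof.
move=> /andP [ab0 ab]; have := @gauss_jacobi a b; rewrite gtnNdvd // => /(_ isT).
rewrite !gaussE //; try lia.
move=> e.
have {}e : pi ^+ (a + b) * iota (gam a * gam b) = pi ^+ (a + b) * iota (- J a b * gam (a + b)).
  rewrite !rmorphM rmorphN.
  transitivity (- (pi ^+ a * iota (gam a)) * - (pi ^+ b * iota (gam b))).
    by rewrite exprD; ring.
  by rewrite e; ring.
apply/eqP; rewrite -subr_eq0; apply/eqP; apply: (@free (a + b)); first by rewrite p1E.
by rewrite rmorphB mulrBr e subrr.
Qed.

Lemma gamma_duplication a : (0 < a < 2 * t)%N ->
  gam a * gam (a + 2 * t) = W a 4%:R^-1 * (gam (2 * t) * gam (2 * a)).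
Proof.
move=> /andP [a0 a2].
have u : gam a \is a GRing.unit by apply: gamma_frac_unit; lia.
apply: (mulrI u).
have E1 := @gamma_jacobi a a; have E2 := @gamma_jacobi a (2 * t).
transitivity ((gam a * gam a) * gam (a + 2 * t)); first by ring.
rewrite E1; last by lia.
have -> : gam a * (W a 4%:R^-1 * (gam (2 * t) * gam (2 * a))) =
   (gam a * gam (2 * t)) * (W a 4%:R^-1 * gam (2 * a)) by ring.
rewrite E2; last by lia.
rewrite jacobi_duplication ?gtnNdvd //; last by lia.
by rewrite addnn -mul2n; ring.
Qed.

Lemma omegabar_mod a i u : W (a + i * (4 * t)) u = W a u.
Proof. by rewrite -p1E; apply: omegabar_period. Qed.

Lemma inv4E : 4%:R^-1 = (2%:R^-1) ^+ 2 :> 'F_p.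
Proof. by rewrite exprVn -natrX. Qed.

(** Hasse-Davenport formula for the quadratic character. For a < 2t it follows from the Gamma
    values. Under a |-> a + 2t the two factors on the left are exchanged, and the right side is
    unchanged since 1/4 is a square. *)
Lemma gauss_duplication a : g a * g (a + 2 * t) = iota (W a 4%:R^-1) * (g (2 * t) * g (2 * a)).
Proof.
have n2 := two_neq0.
have lt b : (b < 2 * t)%N -> g b * g (b + 2 * t) = iota (W b 4%:R^-1) * (g (2 * t) * g (2 * b)).
  move=> b2; have [->|b0] := posnP b.
    rewrite muln0 add0n omegabar_zero invr_neq0 ?rmorph1 ?mul1r 1?mulrC //.
    by have := mulf_neq0 n2 n2; rewrite -natrM.
  rewrite !gaussE; try lia.
  transitivity (pi ^+ (b + (b + 2 * t)) * iota (gam b * gam (b + 2 * t))).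
    by rewrite (exprD pi b (b + 2 * t)) rmorphM; ring.
  rewrite gamma_duplication ?b0 // !rmorphM (_ : b + (b + 2 * t) = 2 * t + 2 * b)%N; last by lia.
  by rewrite exprD; ring.
have step b : g b * g (b + 2 * t) = iota (W b 4%:R^-1) * (g (2 * t) * g (2 * b)) ->
  g (b + 2 * t) * g (b + 2 * t + 2 * t) = iota (W (b + 2 * t) 4%:R^-1) * (g (2 * t) * g (2 * (b + 2 * t))).
  move=> e; rewrite -addnA -mulnDl addnn (_ : (2.*2 * t = 4 * t)%N) // gauss_period mulrC e.
  rewrite mulnDr mulnA gauss_period omegabarD [W (2 * t) _](_ : _ = 1) ?mulr1 //.
  rewrite inv4E omegabarX // (_ : (2 * t * 2 = p.-1)%N); last by rewrite p1E; lia.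
  by apply: omegabar_pred; rewrite ?invr_neq0.
have H q b : (b < 2 * t)%N -> g (b + q * (2 * t)) * g (b + q * (2 * t) + 2 * t) =
   iota (W (b + q * (2 * t)) 4%:R^-1) * (g (2 * t) * g (2 * (b + q * (2 * t)))).
  move=> b2; elim: q => [|q IH]; first by rewrite mul0n addn0; apply: lt.
  by rewrite mulSnr addnA; apply: step.
have := H (a %/ (2 * t))%N (a %% (2 * t))%N; rewrite addnC -divn_eq; apply.
by rewrite ltn_mod muln_gt0.
Qed.

Lemma FpN1_neq1 : (-1 : 'F_p) != 1.
Proof. by rewrite eq_sym -addr_eq0 -(natrD _ 1 1) two_neq0. Qed.

Lemma teichN1 : teich p k (-1) = -1.
Proof.
have N10 : (-1 : 'F_p) != 0 by rewrite oppr_eq0 oner_eq0.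
apply: (mulrI (teich_sub1_unit p_prime k_gt0 N10 FpN1_neq1)).
have : teich p k (-1) ^+ 2 = 1 by rewrite -teichX // sqrrN expr1n teich1.
rewrite expr2 => e; rewrite mulrBl e; ring.
Qed.

Lemma omegabarN1 a : W a (-1) = (-1) ^+ a.
Proof. by rewrite omegabarE ?oppr_eq0 ?oner_eq0 // teichN1 invrN1. Qed.

Lemma sqrt_N1 : exists i : 'F_p, i ^+ 2 = -1.
Proof.
have [w wp] := Fp_prim_root p_prime; exists (w ^+ t).
have : (w ^+ t ^+ 2 - 1) * (w ^+ t ^+ 2 + 1) = 0.
  have := prim_expr_order wp; rewrite p1E mulnC !exprM => e.
  by transitivity (w ^+ t ^+ 4 - 1); [ring | rewrite e subrr].
move/eqP; rewrite mulf_eq0 subr_eq0 addr_eq0 => /orP [|/eqP //].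
rewrite -exprM -(prim_order_dvd wp) p1E gtnNdvd //; lia.
Qed.

(** Supplementary law for 2 when p = 4t + 1: from 2 = -i (1+i)^2 with i^2 = -1, the power 2t of 2 is
    (-i)^(2t) = (-1)^t. *)
Lemma omegabar_two : W (2 * t) 2%:R = (-1) ^+ t.
Proof.
have n2 := two_neq0; have [i i2] := sqrt_N1.
have e2 : 2%:R = - i * (1 + i) ^+ 2.
  transitivity (- i - 2%:R * i ^+ 2 - i * i ^+ 2); first by rewrite i2; ring.
  by ring.
have i1 : 1 + i != 0.
  by apply: contraNneq n2 => e; rewrite e2 e expr0n mulr0.
have : (2%:R : 'F_p) ^+ (2 * t) = (-1) ^+ t.
  rewrite e2 exprMn -[(1 + i) ^+ 2 ^+ _]exprM mulnA -p1E Fp_exp_pred // mulr1.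
  by rewrite exprM sqrrN i2.
move=> /(congr1 (W 1)); rewrite !omegabarX ?oppr_eq0 ?oner_eq0 ?orbT //.
  by rewrite !mul1n omegabarN1.
by rewrite n2 orbT.
Qed.

Lemma omegabar_inv4 : W t 4%:R^-1 = (-1) ^+ t.
Proof.
have n2 := two_neq0; rewrite inv4E omegabarX // mulnC.
have := omegabarV p_prime k_gt0 (2 * t) n2; rewrite omegabar_two => e.
by rewrite -[RHS]mulr1 -[X in _ = _ * X]e mulrA -expr2 sqrr_sign mul1r.
Qed.

Lemma gauss_2t_sqr : g (2 * t) * g (2 * t) = p%:R.
Proof.
have := @gauss_reflection (2 * t); rewrite (_ : 4 * t - 2 * t = 2 * t)%N; last by lia.
by move=> -> //; [rewrite exprM sqrrN !expr1n mul1r | lia].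
Qed.

(** Hasse-Davenport formula for the characters of order dividing 4, by duplication at a, at a + t
    and then at 2a. *)
Lemma gauss_quadruplication a : g a * g (a + t) * g (a + 2 * t) * g (a + 3 * t) =
  iota (W (4 * a) 4%:R^-1) * ((-1) ^+ t * p%:R * (g (2 * t) * g (4 * a))).
Proof.
have E1 := gauss_duplication a; have E2 := gauss_duplication (a + t).
have E3 := gauss_duplication (2 * a).
have -> : (a + 3 * t = a + t + 2 * t)%N by lia.
transitivity ((g a * g (a + 2 * t)) * (g (a + t) * g (a + t + 2 * t))); first by ring.
rewrite E1 E2 (_ : 2 * (a + t) = 2 * a + 2 * t)%N; last by lia.
transitivity (iota (W a 4%:R^-1) * iota (W (a + t) 4%:R^-1) * (g (2 * t) * g (2 * t)) *
  (g (2 * a) * g (2 * a + 2 * t))); first by ring.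
rewrite E3 gauss_2t_sqr (_ : 4 * a = a + a + 2 * a)%N; last by lia.
rewrite mulnA (_ : 2 * 2 * a = a + a + 2 * a)%N; last by lia.
rewrite !omegabarD !rmorphM omegabar_inv4 rmorphXn rmorphN1; ring.
Qed.

End Gauss.

(** * Counting points on the Dwork surface *)

Definition dwork_affine (p : nat) (lam : 'F_p) : {set {ffun 'I_4 -> 'F_p}} :=
  [set x : {ffun 'I_4 -> 'F_p} | \sum_i x i ^+ 4 == 4%:R * lam * \prod_i x i].

Section Projective.
Variables (p : nat) (lam : 'F_p).
Hypothesis p_prime : prime p.

Let lead (x : {ffun 'I_4 -> 'F_p}) : 'F_p := if [pick i | x i != 0] is Some i then x i else 0.
Let scale (c : 'F_p) (x : {ffun 'I_4 -> 'F_p}) : {ffun 'I_4 -> 'F_p} := [ffun i => c * x i].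

Let leadZ c x : c != 0 -> lead (scale c x) = c * lead x.
Proof.
move=> c0; rewrite /lead (@eq_pick _ _ (fun i => x i != 0)) => [|i]; last first.
  by rewrite ffunE mulf_eq0 negb_or c0.
by case: pickP => [i _|_]; rewrite ?ffunE ?mulr0.
Qed.

Let affineZ c x : c != 0 -> (scale c x \in dwork_affine lam) = (x \in dwork_affine lam).
Proof.
move=> c0; rewrite !inE.
have -> : \sum_i scale c x i ^+ 4 = c ^+ 4 * \sum_i x i ^+ 4.
  by rewrite mulr_sumr; apply: eq_bigr => i _; rewrite ffunE exprMn.
have -> : \prod_i scale c x i = c ^+ 4 * \prod_i x i.
  under eq_bigr => i _ do rewrite ffunE.
  by rewrite big_split prodr_const card_ord.
rewrite [4%:R * lam * _]mulrCA; apply/eqP/eqP => [|->] //.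
by apply: mulfI; rewrite expf_neq0.
Qed.

(** Sort the affine zeros by their first nonzero coordinate, with value 0 for the origin. The
    equation is homogeneous, so scaling puts the p-1 nonzero classes in bijection. *)
Lemma card_dwork_affine : #|dwork_affine lam| = (1 + p.-1 * dwork_count p lam)%N.
Proof.
pose D c := [set x in dwork_affine lam | lead x == c].
have lead_eq0 x : (lead x == 0) = (x == [ffun=> 0]).
  rewrite /lead; case: pickP => [i xi|x0].
    rewrite (negbTE xi); apply/esym/eqP => e; move: xi; by rewrite e ffunE eqxx.
  rewrite eqxx; apply/esym/eqP/ffunP => i; rewrite ffunE.
  by have /negbFE/eqP := x0 i.
have D1 : dwork_count p lam = #|D 1|.
  apply: eq_card => x; rewrite !inE /lead andbC.
  by case: pickP => // _; rewrite eq_sym oner_eq0.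
have D0 : D 0 = [set [ffun=> 0]].
  apply/setP => x; rewrite !inE lead_eq0; case: (x =P [ffun=> 0]) => [->|]; rewrite ?andbF // andbT.
  rewrite big1 => [|i _]; last by rewrite ffunE expr0n.
  by rewrite (bigD1 ord0) //= ffunE mul0r mulr0 eqxx.
have Dc c : c != 0 -> #|D c| = #|D 1|.
  move=> c0; have inj d : d != 0 -> injective (scale d).
    move=> d0 x y /ffunP e; apply/ffunP => i; have := e i; rewrite !ffunE.
    exact: mulfI.
  suff -> : D c = scale c @: D 1 by apply: card_imset; apply: inj.
  apply/setP => x; apply/idP/imsetP.
    rewrite inE => /andP [xa /eqP lx]; exists (scale c^-1 x).
      by rewrite inE affineZ ?invr_eq0 // xa leadZ ?invr_eq0 // lx mulVf ?eqxx.
    by apply/ffunP => i; rewrite !ffunE mulrA mulfV // mul1r.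
  case=> y; rewrite inE => /andP [ya /eqP ly] ->.
  by rewrite inE affineZ // ya leadZ // ly mulr1 eqxx.
have -> : #|dwork_affine lam| = (\sum_(c : 'F_p) #|D c|)%N.
  rewrite -sum1_card (partition_big lead predT) //=; apply: eq_bigr => c _.
  by rewrite -sum1_card; apply: eq_bigl => x; rewrite !inE.
rewrite (bigD1 0) //= D0 cards1 D1 (eq_bigr (fun=> #|D 1|)) => [|c c0]; last exact: Dc.
by rewrite sum_nat_const cardC1 card_Fp.
Qed.

End Projective.

(* Coefficient of w^0 in (A0 + A1 w + A2 w^2 + A3 w^3)^4 modulo w^4 = 1 *)
Definition quartic_form (S : comNzRingType) (A0 A1 A2 A3 : S) : S :=
  A0 ^+ 4 + A1 ^+ 4 + A2 ^+ 4 + A3 ^+ 4 + 6%:R * (A0 ^+ 2 * A2 ^+ 2 + A1 ^+ 2 * A3 ^+ 2)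
  + 12%:R * (A0 ^+ 2 * A1 * A3 + A1 ^+ 2 * A0 * A2 + A2 ^+ 2 * A1 * A3 + A3 ^+ 2 * A0 * A2).

Lemma quartic_expansion (S : comNzRingType) (A0 A1 A2 A3 : S) : exists C1 C2 C3 : S,
  forall w, w ^+ 4 = 1 -> (A0 + A1 * w + A2 * w ^+ 2 + A3 * w ^+ 3) ^+ 4 =
    quartic_form A0 A1 A2 A3 + C1 * w + C2 * w ^+ 2 + C3 * w ^+ 3.
Proof.
exists (4%:R * A0 ^+ 3 * A1 + 12%:R * A0 ^+ 2 * A2 * A3 + 12%:R * A0 * A1 ^+ 2 * A3
  + 12%:R * A0 * A1 * A2 ^+ 2 + 4%:R * A0 * A3 ^+ 3 + 4%:R * A1 ^+ 3 * A2
  + 12%:R * A1 * A2 * A3 ^+ 2 + 4%:R * A2 ^+ 3 * A3).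
exists (4%:R * A0 ^+ 3 * A2 + 6%:R * A0 ^+ 2 * A1 ^+ 2 + 6%:R * A0 ^+ 2 * A3 ^+ 2
  + 24%:R * A0 * A1 * A2 * A3 + 4%:R * A0 * A2 ^+ 3 + 4%:R * A1 ^+ 3 * A3
  + 6%:R * A1 ^+ 2 * A2 ^+ 2 + 4%:R * A1 * A3 ^+ 3 + 6%:R * A2 ^+ 2 * A3 ^+ 2).
exists (4%:R * A0 ^+ 3 * A3 + 12%:R * A0 ^+ 2 * A1 * A2 + 4%:R * A0 * A1 ^+ 3
  + 12%:R * A0 * A1 * A3 ^+ 2 + 12%:R * A0 * A2 ^+ 2 * A3 + 12%:R * A1 ^+ 2 * A2 * A3
  + 4%:R * A1 * A2 ^+ 3 + 4%:R * A2 * A3 ^+ 3).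
move=> w w4; rewrite /quartic_form; ring: w4.
Qed.

Section Count.
Variables (p k t : nat).
Hypotheses (p_prime : prime p) (p_gt4 : (4 < p)%N) (k_gt0 : (0 < k)%N).
Hypothesis p1E : p.-1 = (4 * t)%N.
Let p_gt1 : (1 < p)%N := prime_gt1 p_prime.
Let R := 'Z_(p ^ k).
Local Notation W := (omegabar_pow p k).
Let t_gt0 : (0 < t)%N. Proof. by clear k_gt0; lia. Qed.

Variables (S : comNzRingType) (iota : {rmorphism R -> S}) (pi : S) (psi : 'F_p -> S).
Hypothesis free : forall c x, (c < p.-1)%N -> pi ^+ c * iota x = 0 -> x = 0.
Hypothesis piE : pi ^+ p.-1 = - p%:R.
Hypothesis psi0 : psi 0 = 1.
Hypothesis psiD : forall u v, psi (u + v) = psi u * psi v.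
Hypothesis gk : forall a, (a < p.-1)%N ->
  \sum_u iota (W a u) * psi u = - (pi ^+ a * iota (gammap p k (a%:R / (p.-1)%:R))).
Let g := gauss iota psi.

Lemma sum_quartic A0 A1 A2 A3 :
  \sum_(z | z != 0) (A0 + A1 * iota (W t z^-1) + A2 * iota (W t z^-1) ^+ 2
     + A3 * iota (W t z^-1) ^+ 3) ^+ 4 = (4 * t)%:R * quartic_form A0 A1 A2 A3.
Proof.
have [C1 [C2 [C3]]] := quartic_expansion A0 A1 A2 A3.
move: (quartic_form A0 A1 A2 A3) => Q C.
rewrite (reindex_inj invr_inj) /= (eq_bigl (fun z => z != 0)); last first.
  by move=> z; rewrite invr_eq0.
have Wn n z : z != 0 -> iota (W t z) ^+ n = iota (W (t * n) z).
  by move=> z0; rewrite !omegabarE // exprM -rmorphXn.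
have S0 n C' : (0 < n < 4)%N -> \sum_(z | z != 0) C' * iota (W t z) ^+ n = 0.
  move=> n4; rewrite -mulr_sumr (eq_bigr _ (Wn n)) -rmorph_sum.
  have := @sum_omegabar p k p_prime k_gt0 (t * n).
  rewrite (bigD1 0) //= omegabar0 add0r p1E [(4 * t)%N]mulnC dvdn_pmul2l // gtnNdvd; [|lia|lia].
  by move=> /(_ isT) ->; rewrite rmorph0 mulr0.
under eq_bigr => z z0.
  rewrite invrK C; last by rewrite Wn // mulnC -p1E omegabar_pred // rmorph1.
  rewrite -[X in C1 * X]expr1; over.
rewrite !big_split /= !S0 // !addr0 sumr_const cardC1 card_Fp // p1E.
by rewrite mulr_natl.
Qed.

Definition fourth_sum (c : nat) (z : 'F_p) : S := \sum_x iota (W c x) * psi (z * x ^+ 4).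

(** Replacing x by w^t x, with w a primitive root, fixes x^4 and multiplies the sum by a nontrivial
    fourth root of unity; its difference from 1 is a unit. *)
Lemma fourth_sum_eq0 c z : ~~ (4 %| c)%N -> fourth_sum c z = 0.
Proof.
move=> nc; have [w wp] := Fp_prim_root p_prime.
have w0 := Fp_prim_root_neq0 p_prime wp.
have un : W c (w ^+ t) - 1 \is a GRing.unit.
  apply: omegabar_sub1_unit; rewrite ?expf_neq0 // -exprM -(prim_order_dvd wp) p1E.
  by rewrite (mulnC 4) dvdn_pmul2l.
have E : fourth_sum c z = iota (W c (w ^+ t)) * fourth_sum c z.
  rewrite {1}/fourth_sum (reindex_inj (mulfI (expf_neq0 t w0))) /= mulr_sumr.
  apply: eq_bigr => x _; rewrite omegabarM // rmorphM exprMn -exprM [(t * 4)%N]mulnC -p1E.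
  by rewrite (prim_expr_order wp) mul1r mulrA.
have : iota (W c (w ^+ t) - 1) * fourth_sum c z = 0.
  by rewrite rmorphB rmorph1 mulrBl mul1r -E subrr.
move=> /(congr1 (fun y => iota (W c (w ^+ t) - 1)^-1 * y)).
by rewrite mulr0 mulrA -rmorphM mulVr // rmorph1 mul1r.
Qed.

Lemma gauss_twist a z : z != 0 -> \sum_(u | u != 0) iota (W a u) * psi (z * u) = iota (W a z^-1) * g a.
Proof.
move=> z0; transitivity (\sum_u iota (W a u) * psi (z * u)).
  by rewrite [RHS](bigD1 0) //= omegabar0 rmorph0 mul0r add0r.
rewrite (reindex_inj (mulfI (invr_neq0 z0))) /= mulr_sumr; apply: eq_bigr => u _.
by rewrite omegabarM // rmorphM mulVKf // mulrA.
Qed.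

Lemma fourth_sumE j z : z != 0 -> fourth_sum (j * 4) z =
  iota (W j z^-1) * (g j + g (j + t) * iota (W t z^-1) + g (j + 2 * t) * iota (W t z^-1) ^+ 2
     + g (j + 3 * t) * iota (W t z^-1) ^+ 3).
Proof.
move=> z0; rewrite /fourth_sum (bigD1 0) //= omegabar0 rmorph0 mul0r add0r.
rewrite (eq_bigr (fun x => iota (W j (x ^+ 4)) * psi (z * x ^+ 4))) => [|x x0]; last first.
  by rewrite omegabarX // x0 orbT.
rewrite (@sum_exp_fibre p k p_prime p_gt4 k_gt0 _ iota
   (fun y => iota (W j y) * psi (z * y)) 4 t) ?p1E //.
under eq_bigr => y y0 do rewrite mulr_sumr.
rewrite exchange_big /=.
have T (i : nat) : \sum_(y | y != 0) iota (W j y) * psi (z * y) * iota (W (i * t) y) =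
   iota (W j z^-1) * (g (j + i * t) * iota (W t z^-1) ^+ i).
  transitivity (iota (W (j + i * t) z^-1) * g (j + i * t)).
    by rewrite -gauss_twist //; apply: eq_bigr => y _; rewrite omegabarD rmorphM; ring.
  rewrite omegabarD rmorphM -rmorphXn -[W t _ ^+ i](_ : W (i * t) z^-1 = _); first by ring.
  by rewrite !omegabarE ?invr_eq0 // mulnC exprM.
under eq_bigr => i _ do rewrite T.
by rewrite !big_ord_recl big_ord0 /= mul0n addn0 mul1n expr0 expr1; ring.
Qed.

Lemma psi_fourier u : u != 0 ->
  (4 * t)%:R * psi u = \sum_(c < 4 * t) g (4 * t - c) * iota (W c u).
Proof.
move=> u0; rewrite /g /gauss.
under [RHS]eq_bigr => c _ do rewrite mulr_suml.
rewrite exchange_big /= [RHS](bigD1 0) //= big1 ?add0r => [|c _]; last first.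
  by rewrite omegabar0 rmorph0 !mul0r.
transitivity (\sum_(v | v != 0) ((u * v^-1 == 1)%:R * (4 * t)%:R) * psi v).
  rewrite (bigD1 u) //= divff // eqxx mul1r big1 ?addr0 // => v /andP [v0 vu].
  rewrite (_ : (u / v == 1) = false) ?mul0r //; apply: contraNF vu => /eqP e.
  by rewrite -[u](divfK v0) e mul1r.
apply: eq_bigr => v v0; have uv : u * v^-1 != 0 by rewrite mulf_neq0 ?invr_eq0.
transitivity (iota (\sum_(c < p.-1) W c (u * v^-1)) * psi v).
  by rewrite sum_omegabar_dual // rmorphM !rmorph_nat p1E.
rewrite rmorph_sum mulr_suml p1E; apply: eq_bigr => c _.
rewrite mulrAC -rmorphM; congr (iota _ * _); rewrite omegabarM //.
have e := omegabarV p_prime k_gt0 c v0.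
have e' : W (4 * t - c) v * W c v = 1 by rewrite -omegabarD subnK 1?ltnW // -p1E omegabar_pred.
have -> : W c v^-1 = W (4 * t - c) v * (W c v * W c v^-1) by rewrite mulrA e' mul1r.
by rewrite e mulr1 mulrC.
Qed.

Lemma sum_ffun_prod (F : 'F_p -> S) :
  \sum_(x : {ffun 'I_4 -> 'F_p}) \prod_i F (x i) = (\sum_y F y) ^+ 4.
Proof. by rewrite -(bigA_distr_bigA (fun _ => F)) prodr_const card_ord. Qed.

Variable lam : 'F_p.
Hypothesis lam_neq0 : lam != 0.

Lemma four_neq0 : (4%:R : 'F_p) != 0.
Proof. by have n2 := two_neq0 p_prime p_gt4; have := mulf_neq0 n2 n2; rewrite -natrM. Qed.

(** Fourier expansion of psi is available at nonzero arguments only, hence when no coordinate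
    vanishes. [W 0] is the indicator of nonzero elements, and the difference of products keeps
    exactly the points with a vanishing coordinate. *)
Lemma psi_dwork_expansion z (x : {ffun 'I_4 -> 'F_p}) : z != 0 ->
  (4 * t)%:R * psi (z * (\sum_i x i ^+ 4 - 4%:R * lam * \prod_i x i)) =
  (4 * t)%:R * (\prod_i psi (z * x i ^+ 4) - \prod_i (iota (W 0 (x i)) * psi (z * x i ^+ 4))) +
  \sum_(c < 4 * t) g (4 * t - c) * iota (W c (- (4%:R * lam * z))) *
     \prod_i (iota (W c (x i)) * psi (z * x i ^+ 4)).
Proof.
move=> z0; have ps : psi (z * \sum_i x i ^+ 4) = \prod_i psi (z * x i ^+ 4).
  by rewrite mulr_sumr (big_morph psi psiD psi0).
have [/forallP x0|] := boolP [forall i, x i != 0].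
  have P0 : \prod_i x i != 0 by apply/prodf_neq0 => i _.
  have -> : \prod_i (iota (W 0 (x i)) * psi (z * x i ^+ 4)) = \prod_i psi (z * x i ^+ 4).
    by apply: eq_bigr => i _; rewrite omegabar_zero x0 rmorph1 mul1r.
  rewrite subrr mulr0 add0r.
  under [RHS]eq_bigr => c _.
    rewrite big_split /= -rmorph_prod -ps.
    have -> : \prod_i W c (x i) = W c (\prod_i x i).
      rewrite (big_morph (W c) (omegabarM p_prime k_gt0 c) (omegabar1 p_prime k_gt0 c)) //.
    rewrite mulrA -[_ * iota _ * iota _]mulrA -rmorphM -omegabarM //.
    over.
  rewrite -mulr_suml -psi_fourier; last first.
    by rewrite mulf_neq0 // oppr_eq0 !mulf_neq0 // four_neq0.
  by rewrite -[RHS]mulrA -psiD; congr (_ * psi _); ring.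
rewrite negb_forall => /existsP [i]; rewrite negbK => /eqP xi.
have -> : \prod_i x i = 0 by rewrite (bigD1 i) //= xi mul0r.
have Z c : \prod_i (iota (W c (x i)) * psi (z * x i ^+ 4)) = 0.
  by rewrite (bigD1 i) //= xi omegabar0 rmorph0 !mul0r.
rewrite mulr0 subr0 ps Z subr0 [X in _ + X]big1 ?addr0 // => c _.
by rewrite Z mulr0.
Qed.

Let X A0 j z := A0 + g (j + t) * iota (W t z^-1) + g (j + 2 * t) * iota (W t z^-1) ^+ 2
     + g (j + 3 * t) * iota (W t z^-1) ^+ 3.

Lemma sum_psi_dwork z : z != 0 ->
  (4 * t)%:R * \sum_(x : {ffun 'I_4 -> 'F_p})
     psi (z * (\sum_i x i ^+ 4 - 4%:R * lam * \prod_i x i)) =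
  (4 * t)%:R * (X 0 0 z ^+ 4 - X (g 0) 0 z ^+ 4) +
  \sum_(j < t) g (4 * t - j * 4) * iota (W (j * 4) (4%:R * lam)) * X (g j) j z ^+ 4.
Proof.
move=> z0; have zV0 : z^-1 != 0 by rewrite invr_eq0.
rewrite mulr_sumr (eq_bigr _ (fun x _ => psi_dwork_expansion x z0)) big_split /=.
rewrite -mulr_sumr sumrB (sum_ffun_prod (fun y => psi (z * y ^+ 4))).
rewrite (sum_ffun_prod (fun y => iota (W 0 y) * psi (z * y ^+ 4))); congr (_ * (_ - _) + _).
(* Here x = 0 contributes an extra 1, which cancels g(0) = -1: the constant coefficient becomes
   0. *)
- congr (_ ^+ 4); rewrite (bigD1 0) //= expr0n mulr0 psi0.
  have := @fourth_sumE 0 z z0; rewrite /fourth_sum mul0n (bigD1 0) //= omegabar0 rmorph0 mul0r add0r.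
  rewrite (eq_bigr (fun y => psi (z * y ^+ 4))) => [->|y y0]; last first.
    by rewrite omegabar_zero y0 rmorph1 mul1r.
  have -> : g 0 = -1 := gauss0 p_prime p_gt4 k_gt0 p1E gk.
  by rewrite omegabar_zero zV0 rmorph1 mul1r /X; ring.
- by congr (_ ^+ 4); rewrite -/(fourth_sum (0 * 4) z) fourth_sumE // omegabar_zero zV0 rmorph1 mul1r.
rewrite exchange_big /=.
under eq_bigr => c _ do rewrite -mulr_sumr (sum_ffun_prod (fun y => iota (W c y) * psi (z * y ^+ 4))) -/(fourth_sum c z).
transitivity (\sum_(c < t * 4) (fun c => g (4 * t - c) * iota (W c (- (4%:R * lam * z))) * fourth_sum c z ^+ 4) c).
  by rewrite mulnC.
rewrite (sum_block_ord (fun c => g (4 * t - c) * iota (W c (- (4%:R * lam * z))) * fourth_sum c z ^+ 4)).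
apply: eq_bigr => j _; rewrite big_ord_recl big1 ?addr0 => [|i _]; last first.
  rewrite fourth_sum_eq0 ?expr0n ?mulr0 // dvdn_addr ?dvdn_mull // lift0.
  by rewrite gtnNdvd //; have := ltn_ord i; lia.
rewrite [(j * 4 + _)%N]addn0 fourth_sumE // exprMn -[LHS]mulrA -[RHS]mulrA; congr (_ * _).
rewrite -/(X (g j) j z) mulrA; congr (_ * _).
rewrite -rmorphXn -rmorphM; congr (iota _).
have -> : W j z^-1 ^+ 4 = W (j * 4) z^-1 by rewrite !omegabarE // exprM.
have -> : - (4%:R * lam * z) = -1 * (4%:R * lam) * z by ring.
rewrite -omegabarM // mulfK // (omegabarM p_prime k_gt0 _ (-1)) (@omegabarN1 p k p_prime p_gt4 k_gt0).
have -> : (-1) ^+ (j * 4) = 1 :> R.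
  by rewrite mulnC exprM (_ : (-1) ^+ 4 = 1) ?expr1n //; ring.
by rewrite mul1r.
Qed.

Let Q j := quartic_form (g j) (g (j + t)) (g (j + 2 * t)) (g (j + 3 * t)).

(** Detect zeros by the sum over z of psi (z F(x)), whose term z = 0 is p^4. The middle term comes
    from points with a vanishing coordinate. The expansion is obtained after multiplication by 4t =
    p-1, a unit that is removed at the end. *)
Lemma affine_count :
  p%:R * #|dwork_affine lam|%:R = p%:R ^+ 4
    + (4 * t)%:R * (quartic_form 0 (g t) (g (2 * t)) (g (3 * t)) - Q 0)
    + \sum_(j < t) g (4 * t - j * 4) * iota (W (j * 4) (4%:R * lam)) * Q j :> S.
Proof.
pose F (x : {ffun 'I_4 -> 'F_p}) := \sum_i x i ^+ 4 - 4%:R * lam * \prod_i x i.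
have E1 : p%:R * #|dwork_affine lam|%:R = \sum_z \sum_x psi (z * F x).
  rewrite exchange_big /= (eq_bigr (fun x => (F x == 0)%:R * p%:R)) => [|x _]; last first.
    exact: (sum_psiM p_prime p_gt4 k_gt0 p1E psi0 gk).
  rewrite -mulr_suml mulrC -natr_sum -sum1_card big_mkcond /=; congr (_%:R * _).
  by apply: eq_bigr => x _; rewrite inE subr_eq0; case: ifP.
have unit4t : (4 * t)%:R \is a @GRing.unit R.
  by rewrite -p1E; apply: natZ_unit; rewrite ?coprime_p1.
suff H : (4 * t)%:R * (p%:R * #|dwork_affine lam|%:R) = (4 * t)%:R * (p%:R ^+ 4
    + (4 * t)%:R * (quartic_form 0 (g t) (g (2 * t)) (g (3 * t)) - Q 0)
    + \sum_(j < t) g (4 * t - j * 4) * iota (W (j * 4) (4%:R * lam)) * Q j).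
  move/(congr1 (fun y => iota ((4 * t)%:R^-1) * y)): H.
  by rewrite -(rmorph_nat iota (4 * t)) !mulrA -rmorphM mulVr // rmorph1 !mul1r.
rewrite E1 (bigD1 0) //= (eq_bigr (fun=> 1)) => [|x _]; last by rewrite mul0r psi0.
rewrite sumr_const card_ffun (card_Fp p_prime) card_ord natrX -[X in _ = _ * X]addrA [RHS]mulrDr [LHS]mulrDr.
congr (_ + _).
rewrite mulr_sumr (eq_bigr _ sum_psi_dwork) big_split /= -mulr_sumr sumrB.
rewrite !sum_quartic [RHS]mulrDr; congr (_ + _).
  by rewrite /Q !add0n; ring.
rewrite exchange_big /= mulr_sumr; apply: eq_bigr => j _.
by rewrite -mulr_sumr sum_quartic -/(Q j) mulrCA.
Qed.

End Count.

(** * The hypergeometric functions *)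

Local Notation fracq := Defs.fracq.

Lemma floor_addz (m : int) (x y : rat) : 0 <= y < 1 -> x = m%:~R + y -> Num.floor x = m.
Proof.
move=> /andP [y0 y1] ->; apply: floor_def.
by rewrite rmorphD /= lerDl y0 ltrD2l.
Qed.

Lemma fracq_addz (m : int) (x y : rat) : 0 <= y < 1 -> x = m%:~R + y -> fracq x = y.
Proof. by move=> y01 e; rewrite /fracq (floor_addz y01 e) e addrC addKr. Qed.

Section Fractions.
Variable n : nat.
Hypothesis n_gt0 : (0 < n)%N.
Local Notation "a /n" := (a%:R / n%:R : rat) (at level 40).

Lemma frac_bounds a : (a < n)%N -> 0 <= a /n < 1.
Proof.
move=> an; rewrite divr_ge0 ?ler0n //= ltr_pdivrMr ?ltr0n // mul1r ltr_nat //.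
Qed.

Lemma frac_id a : (a < n)%N -> fracq (a /n) = a /n.
Proof. by move=> an; apply: (@fracq_addz 0); rewrite ?add0r ?frac_bounds. Qed.

Lemma frac_shift a b : (a < n)%N -> (b < n)%N ->
  fracq (a /n - b /n) = (if (a < b)%N then a + n - b else a - b)%N /n /\
  Num.floor (a /n - b /n) = - (a < b)%N%:Z.
Proof.
move=> an bn; have n0 : n%:R != 0 :> rat by rewrite pnatr_eq0 -lt0n.
have [ab|ba] := ltnP a b.
  have e : a /n - b /n = (-1)%:~R + (a + n - b)%N /n.
    rewrite natrB; last by apply: leq_trans (ltnW bn) (leq_addl _ _).
    by rewrite natrD; field.
  have lt : (a + n - b < n)%N by lia.
  by rewrite (fracq_addz (frac_bounds lt) e) (floor_addz (frac_bounds lt) e).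
have e : a /n - b /n = 0%:~R + (a - b)%N /n by rewrite natrB //; field.
have lt : (a - b < n)%N by lia.
by rewrite (fracq_addz (frac_bounds lt) e) (floor_addz (frac_bounds lt) e).
Qed.

Lemma frac_add a b : (a < n)%N -> (b < n)%N ->
  fracq (a /n + b /n) = (if (n <= a + b)%N then a + b - n else a + b)%N /n /\
  Num.floor (a /n + b /n) = (n <= a + b)%N%:Z.
Proof.
move=> an bn; have n0 : n%:R != 0 :> rat by rewrite pnatr_eq0 -lt0n.
have [ab|ba] := leqP n (a + b).
  have e : a /n + b /n = 1%:~R + (a + b - n)%N /n.
    by rewrite natrB // natrD; field.
  have lt : (a + b - n < n)%N by lia.
  by rewrite (fracq_addz (frac_bounds lt) e) (floor_addz (frac_bounds lt) e).
have e : a /n + b /n = 0%:~R + (a + b)%N /n by rewrite natrD; field.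
by rewrite (fracq_addz (frac_bounds ba) e) (floor_addz (frac_bounds ba) e).
Qed.

End Fractions.

Lemma fracqDz (m : int) x : fracq (m%:~R + x) = fracq x.
Proof. by rewrite /fracq floorDzr ?intr_int // intrKfloor rmorphD; ring. Qed.

(** Numerator over 4t = p-1 of the fractional part of i/4 - j/(p-1); [up_index] is the same for -2/4
    + j/(p-1). *)
Definition down_index (t i j : nat) : nat :=
  if (i * t < j)%N then (i * t + 4 * t - j)%N else (i * t - j)%N.
Definition up_index (t j : nat) : nat :=
  if (4 * t <= 2 * t + j)%N then (2 * t + j - 4 * t)%N else (2 * t + j)%N.

Section Hypergeometric.
Variables (p k t : nat).
Hypotheses (p_prime : prime p) (p_gt4 : (4 < p)%N) (k_gt0 : (0 < k)%N).
Hypothesis p1E : p.-1 = (4 * t)%N.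
Let t_gt0 : (0 < t)%N. Proof. by clear k_gt0; lia. Qed.
Let n_gt0 : (0 < 4 * t)%N. Proof. by rewrite muln_gt0. Qed.
Local Notation gam := (gamma_frac p k).
Local Notation R := 'Z_(p ^ k).

Local Notation r := (down_index t).
Local Notation "a /n" := (a%:R / (4 * t)%N%:R : rat) (at level 40).

Let tn0 : t%:R != 0 :> rat. Proof. by rewrite pnatr_eq0 -lt0n. Qed.
Let quarter i : i%:R / 4 = (i * t) /n.
Proof. by rewrite !natrM; field. Qed.

Let lt_it i : (i < 4)%N -> (i * t < 4 * t)%N.
Proof. by rewrite ltn_pmul2r. Qed.

Let frac_num i : (i < 4)%N -> fracq (i%:R / 4) = (i * t) /n.
Proof. by move=> i4; rewrite quarter frac_id ?lt_it. Qed.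

Let frac_top i j : (i < 4)%N -> (j < 4 * t)%N -> fracq (i%:R / 4 - j /n) = r i j /n.
Proof. by move=> i4 jn; rewrite quarter; case: (frac_shift n_gt0 (lt_it i4) jn). Qed.

Let floor_top i j : (i < 4)%N -> (j < 4 * t)%N ->
  Num.floor (fracq (i%:R / 4) - j /n) = - (i * t < j)%N%:Z.
Proof. by move=> i4 jn; rewrite frac_num //; case: (frac_shift n_gt0 (lt_it i4) jn). Qed.

Let zero_n : 0 = 0 /n. Proof. by rewrite mul0r. Qed.

Let frac_bot0 j : (j < 4 * t)%N -> fracq (- 0 + j /n) = j /n.
Proof. by move=> jn; rewrite oppr0 add0r frac_id. Qed.

Let frac_0 : fracq (- 0) = 0 /n.
Proof. by rewrite oppr0 {1}zero_n frac_id. Qed.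

Let floor_bot0 j : (j < 4 * t)%N -> Num.floor (fracq (- 0) + j /n) = 0.
Proof. by move=> jn; rewrite frac_0 mul0r; apply: (floor_addz (frac_bounds n_gt0 jn)). Qed.

Let opp_half : - (2 / 4) = (-1)%:~R + (2 * t) /n :> rat.
Proof. by rewrite -quarter; field. Qed.

Let frac_half : fracq (- (2 / 4)) = (2 * t) /n.
Proof. by rewrite opp_half fracqDz frac_id ?lt_it. Qed.

Local Notation s := (up_index t).

Let frac_bot j : (j < 4 * t)%N -> fracq (- (2 / 4) + j /n) = s j /n.
Proof.
move=> jn; rewrite opp_half -addrA fracqDz.
by case: (frac_add n_gt0 (@lt_it 2 isT) jn).
Qed.

Let floor_bot j : (j < 4 * t)%N -> Num.floor (fracq (- (2 / 4)) + j /n) = (4 * t <= 2 * t + j)%N%:Z.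
Proof. by move=> jn; rewrite frac_half; case: (frac_add n_gt0 (@lt_it 2 isT) jn). Qed.

Local Notation e i j := (nat_of_bool (i * t < j)%N).

Lemma Gexp3 j : (j < 4 * t)%N ->
  Gexp p [:: 1/4; 2/4; 3/4] [:: 0; 0; 0] j = (e 1 j + e 2 j + e 3 j)%N%:Z.
Proof.
move=> jn; rewrite /Gexp p1E !big_ord_recl big_ord0 /=.
have H (f1 f2 f3 b1 b2 b3 : int) : f1 = - (e 1 j)%:Z -> b1 = 0 -> f2 = - (e 2 j)%:Z -> b2 = 0 ->
    f3 = - (e 3 j)%:Z -> b3 = 0 ->
    - f1 - b1 + (- f2 - b2 + (- f3 - b3 + 0)) = (e 1 j + e 2 j + e 3 j)%N%:Z.
  by move=> -> -> -> -> -> ->; rewrite !subr0 !opprK ?addr0 addrA.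
apply: H.
  - exact: (@floor_top 1).
  - exact: floor_bot0.
  - exact: (@floor_top 2).
  - exact: floor_bot0.
  - exact: (@floor_top 3).
  - exact: floor_bot0.
Qed.

(** The subtraction of natural numbers is exact: the lower parameter wraps around only if 2t <= j,
    and then t < j. *)
Lemma Gexp2 j : (j < 4 * t)%N ->
  Gexp p [:: 3/4; 1/4] [:: 0; 2/4] j = (e 3 j + e 1 j - (4 * t <= 2 * t + j))%N%:Z.
Proof.
move=> jn; rewrite /Gexp p1E !big_ord_recl big_ord0 /=.
have H (f1 f3 b1 b2 : int) : f3 = - (e 3 j)%:Z -> b1 = 0 -> f1 = - (e 1 j)%:Z ->
    b2 = (4 * t <= 2 * t + j)%N%:Z ->
    - f3 - b1 + (- f1 - b2 + 0) = (e 3 j + e 1 j - (4 * t <= 2 * t + j))%N%:Z.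
  move=> -> -> -> ->; clear -t_gt0 jn.
  by case: (leqP (4 * t) (2 * t + j)); case: (ltnP (3 * t) j); case: (ltnP (1 * t) j); lia.
apply: H.
  - exact: (@floor_top 3).
  - exact: floor_bot0.
  - exact: (@floor_top 1).
  - exact: floor_bot.
Qed.

(** Reflection gives Gamma_p(1/4) Gamma_p(3/4) = (-1)^(t+1) and Gamma_p(1/2)^2 = -1. *)
Let gam_den : (gam (1 * t))^-1 * (gam (2 * t))^-1 * (gam (3 * t))^-1 = (-1) ^+ t * gam (2 * t).
Proof.
have gu i : (i < 4)%N -> gam (i * t) \is a GRing.unit.
  by move=> i4; apply: (gamma_frac_unit p_prime p_gt4 k_gt0 p1E); apply: lt_it.
have E1 := @gamma_frac_reflection p k t p_prime p_gt4 k_gt0 p1E (1 * t).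
have E2 := @gamma_frac_reflection p k t p_prime p_gt4 k_gt0 p1E (2 * t).
rewrite -mulnBl in E1; rewrite -mulnBl in E2.
have u1 := gu 1 isT; have u2 := gu 2 isT; have u3 := gu 3 isT.
apply: (mulrI u3); apply: (mulrI u2); apply: (mulrI u1).
transitivity (1 : R).
  transitivity ((gam (1 * t) / gam (1 * t)) * (gam (2 * t) / gam (2 * t)) *
    (gam (3 * t) / gam (3 * t))); first by ring.
  by rewrite !divrr ?mulr1.
transitivity ((-1) ^+ t * (gam (1 * t) * gam ((4 - 1) * t)) * (gam (2 * t) * gam ((4 - 2) * t))).
  rewrite E1 ?E2; try by clear k_gt0; lia.
  rewrite mul1n !exprS mulrA exprM sqrrN !expr1n mulrCA -expr2 sqrr_sign; ring.
by rewrite /subn /=; ring.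
Qed.

Lemma Gfactor3 j : (j < 4 * t)%N ->
  Gfactor p k [:: 1/4; 2/4; 3/4] [:: 0; 0; 0] j =
  (-1) ^+ t * gam (2 * t) * gam j ^+ 3 * gam (r 1 j) * gam (r 2 j) * gam (r 3 j).
Proof.
move=> jn; rewrite /Gfactor p1E !big_ord_recl big_ord0 /=.
have G x a : x = a /n -> gammap p k x = gam a by move=> ->; rewrite /gamma_frac p1E.
have g0 : gam 0 = 1 := gamma_frac0 p_prime p_gt4 k_gt0 p1E.
have H (x1 x2 x3 c1 c2 c3 y1 y2 y3 d1 d2 d3 : rat) :
  x1 = r 1 j /n -> c1 = (1 * t) /n -> y1 = j /n -> d1 = 0 /n ->
  x2 = r 2 j /n -> c2 = (2 * t) /n -> y2 = j /n -> d2 = 0 /n ->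
  x3 = r 3 j /n -> c3 = (3 * t) /n -> y3 = j /n -> d3 = 0 /n ->
  gammap p k x1 / gammap p k c1 * (gammap p k y1 / gammap p k d1) *
   (gammap p k x2 / gammap p k c2 * (gammap p k y2 / gammap p k d2) *
   (gammap p k x3 / gammap p k c3 * (gammap p k y3 / gammap p k d3) * 1)) =
  (-1) ^+ t * gam (2 * t) * gam j ^+ 3 * gam (r 1 j) * gam (r 2 j) * gam (r 3 j).
  do 3!move=> /G -> /G -> /G -> /G ->.
  by rewrite g0 divr1 -gam_den; ring.
apply: H.
  - exact: (@frac_top 1).
  - exact: (@frac_num 1).
  - exact: frac_bot0.
  - exact: frac_0.
  - exact: (@frac_top 2).
  - exact: (@frac_num 2).
  - exact: frac_bot0.
  - exact: frac_0.
  - exact: (@frac_top 3).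
  - exact: (@frac_num 3).
  - exact: frac_bot0.
  - exact: frac_0.
Qed.

Lemma Gfactor2 j : (j < 4 * t)%N ->
  Gfactor p k [:: 3/4; 1/4] [:: 0; 2/4] j =
  (-1) ^+ t * gam (2 * t) * gam j * gam (s j) * gam (r 1 j) * gam (r 3 j).
Proof.
move=> jn; rewrite /Gfactor p1E !big_ord_recl big_ord0 /=.
have G x a : x = a /n -> gammap p k x = gam a by move=> ->; rewrite /gamma_frac p1E.
have g0 : gam 0 = 1 := gamma_frac0 p_prime p_gt4 k_gt0 p1E.
have H (x1 x3 c1 c3 y1 y3 d1 d3 : rat) :
  x3 = r 3 j /n -> c3 = (3 * t) /n -> y3 = j /n -> d3 = 0 /n ->
  x1 = r 1 j /n -> c1 = (1 * t) /n -> y1 = s j /n -> d1 = (2 * t) /n ->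
  gammap p k x3 / gammap p k c3 * (gammap p k y3 / gammap p k d3) *
   (gammap p k x1 / gammap p k c1 * (gammap p k y1 / gammap p k d1) * 1) =
  (-1) ^+ t * gam (2 * t) * gam j * gam (s j) * gam (r 1 j) * gam (r 3 j).
  do 2!move=> /G -> /G -> /G -> /G ->.
  by rewrite g0 divr1 -gam_den; ring.
apply: H.
  - exact: (@frac_top 3).
  - exact: (@frac_num 3).
  - exact: frac_bot0.
  - exact: frac_0.
  - exact: (@frac_top 1).
  - exact: (@frac_num 1).
  - exact: frac_bot.
  - exact: frac_half.
Qed.

End Hypergeometric.

(** * Comparison of the two sides *)

Section Assembly.
Variables (p k t : nat).
Hypotheses (p_prime : prime p) (p_gt4 : (4 < p)%N) (k_gt0 : (0 < k)%N).
Hypothesis p1E : p.-1 = (4 * t)%N.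
Let R := 'Z_(p ^ k).
Local Notation W := (omegabar_pow p k).
Let t_gt0 : (0 < t)%N. Proof. by clear k_gt0; lia. Qed.

Variables (S : comNzRingType) (iota : {rmorphism R -> S}) (pi : S) (psi : 'F_p -> S).
Hypothesis free : forall c x, (c < p.-1)%N -> pi ^+ c * iota x = 0 -> x = 0.
Hypothesis piE : pi ^+ p.-1 = - p%:R.
Hypothesis psi0 : psi 0 = 1.
Hypothesis psiD : forall u v, psi (u + v) = psi u * psi v.
Hypothesis gk : forall a, (a < p.-1)%N ->
  \sum_u iota (W a u) * psi u = - (pi ^+ a * iota (gammap p k (a%:R / (p.-1)%:R))).
Let g := gauss iota psi.
Local Notation gam := (gamma_frac p k).

Lemma gauss_periodM a m : g (a + m * (4 * t)) = g a.
Proof.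
elim: m => [|m IH]; first by rewrite mul0n addn0.
rewrite (mulSnr m) addnA -[RHS]IH.
exact: (gauss_period p_prime k_gt0 p1E iota psi).
Qed.

Lemma gauss_eqmod a b m : (a = b + m * (4 * t))%N -> g a = g b.
Proof. by move=> ->; apply: gauss_periodM. Qed.

Lemma gauss_down i j : (i < 4)%N -> (j < 4 * t)%N -> g (down_index t i j) = g (i * t + 4 * t - j).
Proof.
move=> i4 jn; rewrite /down_index; case: ltnP => // ij; apply/esym/(@gauss_eqmod _ _ 1).
by clear k_gt0; lia.
Qed.

Lemma gauss_up j : g (up_index t j) = g (j + 2 * t).
Proof.
rewrite /up_index; case: leqP => ij; apply/esym.
  by apply: (@gauss_eqmod _ _ 1); clear k_gt0; lia.
by rewrite addnC.
Qed.

Let piX m : pi ^+ (4 * t * m) = iota ((- p%:R) ^+ m).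
Proof. by rewrite exprM -p1E piE rmorphXn rmorphN rmorph_nat. Qed.

Let gE a : (a < 4 * t)%N -> g a = - (pi ^+ a * iota (gam a)).
Proof. exact: gaussE. Qed.

(** By Gross-Koblitz the product of seven Gauss sums has a total exponent of pi equal to 4t (2 + E),
    where E counts the indices that wrap around. This is the exponent of -p in the definition of the
    hypergeometric function, shifted by 2; seven minus signs account for (-1)^(t+1). *)
Lemma gauss_Gfactor3 j : (j < 4 * t)%N ->
  iota (Gfactor p k [:: 1/4; 2/4; 3/4] [:: 0; 0; 0] j *
    (- p%:R) ^+ (2 + ((1 * t < j) + (2 * t < j) + (3 * t < j))%N)) =
  (-1) ^+ t.+1 * g (2 * t) * g j ^+ 3 * g (5 * t - j) * g (6 * t - j) * g (7 * t - j).
Proof.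
move=> jn; have dn i : (i < 4)%N -> (down_index t i j < 4 * t)%N.
  move=> i4; have : (i * t < 4 * t)%N by rewrite ltn_pmul2r.
  by rewrite /down_index; case: (ltnP (i * t) j); clear k_gt0; lia.
have sum : (2 * t + j * 3 + down_index t 1 j + down_index t 2 j + down_index t 3 j =
    4 * t * (2 + ((1 * t < j) + (2 * t < j) + (3 * t < j))))%N.
  rewrite /down_index; clear -t_gt0 jn.
  by case: (ltnP (1 * t) j); case: (ltnP (2 * t) j); case: (ltnP (3 * t) j) => /= *; lia.
have gd i : (i < 4)%N -> g ((4 + i) * t - j) = - (pi ^+ down_index t i j * iota (gam (down_index t i j))).
  by move=> i4; rewrite -gE ?dn // gauss_down // mulnDl addnC.
rewrite (gd 1) // (gd 2) // (gd 3) // gE; last by clear k_gt0; lia.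
rewrite gE // rmorphM -piX -sum !exprD exprM.
rewrite (Gfactor3 p_prime p_gt4 k_gt0 p1E jn) !rmorphM !rmorphXn rmorphN1 !exprSr; ring.
Qed.

Lemma gauss_Gfactor2 j : (j < 4 * t)%N ->
  iota (Gfactor p k [:: 3/4; 1/4] [:: 0; 2/4] j *
    (- p%:R) ^+ (2 + ((3 * t < j) + (1 * t < j) - (4 * t <= 2 * t + j))%N)) =
  (-1) ^+ t.+1 * g (2 * t) * g j * g (j + 2 * t) * g (5 * t - j) * g (7 * t - j).
Proof.
move=> jn; have dn i : (i < 4)%N -> (down_index t i j < 4 * t)%N.
  move=> i4; have : (i * t < 4 * t)%N by rewrite ltn_pmul2r.
  by rewrite /down_index; case: (ltnP (i * t) j); clear k_gt0; lia.
have sum : (2 * t + j + up_index t j + down_index t 1 j + down_index t 3 j =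
    4 * t * (2 + ((3 * t < j) + (1 * t < j) - (4 * t <= 2 * t + j))))%N.
  rewrite /down_index /up_index; clear -t_gt0 jn.
  by case: (ltnP (1 * t) j); case: (leqP (4 * t) (2 * t + j)); case: (ltnP (3 * t) j) => /= *; lia.
have gd i : (i < 4)%N -> g ((4 + i) * t - j) = - (pi ^+ down_index t i j * iota (gam (down_index t i j))).
  by move=> i4; rewrite -gE ?dn // gauss_down // mulnDl addnC.
rewrite (gd 1) // (gd 3) // -gauss_up.
have un : (up_index t j < 4 * t)%N by rewrite /up_index; case: (leqP (4 * t) (2 * t + j)); clear k_gt0; lia.
rewrite !gE //; last by clear k_gt0; lia.
rewrite rmorphM -piX -sum !exprD.
rewrite (Gfactor2 p_prime p_gt4 k_gt0 p1E jn) !rmorphM !rmorphXn rmorphN1 !exprSr; ring.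
Qed.

Lemma gauss_reflection_mod a b m : (a + b = m * (4 * t))%N -> ~~ (4 * t %| a)%N ->
  g a * g b = (-1) ^+ a * p%:R.
Proof.
move=> ab nda; have n0 : (0 < 4 * t)%N by rewrite muln_gt0.
set q := (a %/ (4 * t))%N; set a0 := (a %% (4 * t))%N.
have aE : a = (a0 + q * (4 * t))%N by rewrite addnC -divn_eq.
have a0n : (0 < a0 < 4 * t)%N by rewrite ltn_mod n0 lt0n andbT.
have mq : (q < m)%N.
  rewrite -(ltn_pmul2r n0) -ab; apply: leq_trans (leq_addr _ _); rewrite aE.
  by rewrite -[X in (X < _)%N]add0n ltn_add2r; case/andP: a0n.
have bE : (b = 4 * t - a0 + (m - q.+1) * (4 * t))%N.
  apply: (@addnI a); rewrite ab {1}aE.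
  rewrite -[in LHS](subnKC mq) mulnDl mulSn; clear -a0n; lia.
rewrite (gauss_eqmod aE) (gauss_eqmod bE).
rewrite (gauss_reflection p_prime p_gt4 k_gt0 p1E piE gk) // [in RHS]aE exprD.
suff -> : (-1) ^+ (q * (4 * t)) = 1 :> S by rewrite mulr1.
by rewrite mulnCA exprM (_ : (-1) ^+ 4 = 1) ?expr1n //; ring.
Qed.

(* Up to the factor W j (lam ^+ 4), hyper3_term j and hyper2_term j are the images
   of the j-th summands of the sums in p^3 3G3 and p^2 2G2 (see Gscaled3E and
   Gscaled2E), while the mixed terms sum to the quadratic character of
   1 - lam^4 (see sum_mixed). *)
Definition hyper3_term j : S :=
  (-1) ^+ (j + t.+1) * p%:R * (g (2 * t) * g j ^+ 3 * g (5 * t - j) * g (6 * t - j) * g (7 * t - j)).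
Definition hyper2_term j : S :=
  (-1) ^+ t.+1 * (g (2 * t) * g j * g (j + 2 * t) * g (5 * t - j) * g (7 * t - j)).
Definition mixed_term j : S :=
  (-1) ^+ (j + t) * p%:R * (g (2 * t) * g j * g (6 * t - j)).
(** The coefficient W(4j)(4) g(-4j) of the Fourier expansion. It depends on j modulo t only, so it
    is common to the four terms of a block. *)
Definition quad_factor j : S := iota (W (4 * j) 4%:R) * g (4 * (4 * t - j)).

Let g2t : g (2 * t) * g (2 * t) = p%:R.
Proof. exact: (gauss_2t_sqr p_prime p_gt4 k_gt0 p1E piE gk). Qed.

Lemma omegabar_dual j u : (j <= 4 * t)%N -> u != 0 -> W (4 * (4 * t - j)) u^-1 = W (4 * j) u.
Proof.
move=> jn u0; have e1 := omegabarV p_prime k_gt0 (4 * j) u0.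
have e2 : W (4 * (4 * t - j)) u^-1 * W (4 * j) u^-1 = 1.
  rewrite -omegabarD -mulnDr subnK // -omegabarX ?invr_eq0 ?u0 ?orbT //.
  by rewrite -p1E Fp_exp_pred ?invr_eq0 // omegabar1.
by rewrite -[LHS]mulr1 -e1 mulrCA e2 mulr1.
Qed.

Lemma gauss_quadruplication_dual j : (j < 4 * t)%N ->
  g (4 * t - j) * g (5 * t - j) * g (6 * t - j) * g (7 * t - j) =
  (-1) ^+ t * p%:R * g (2 * t) * quad_factor j.
Proof.
move=> jn; have := gauss_quadruplication p_prime p_gt4 k_gt0 p1E free piE psiD gk (4 * t - j).
rewrite omegabar_dual ?(ltnW jn) ?four_neq0 // -/g.
rewrite (_ : 4 * t - j + t = 5 * t - j)%N; last by clear k_gt0; lia.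
rewrite (_ : 4 * t - j + 2 * t = 6 * t - j)%N; last by clear k_gt0; lia.
rewrite (_ : 4 * t - j + 3 * t = 7 * t - j)%N; last by clear k_gt0; lia.
by move=> ->; rewrite /quad_factor; ring.
Qed.

(** * Indices not divisible by t, where reflection applies to all four Gauss sums of a block *)

Section Generic.
Variable j : nat.
Hypotheses (j_lt : (j < 4 * t)%N) (tj : ~~ (t %| j)%N).

Let ndvd i : ~~ (4 * t %| j + i * t)%N.
Proof.
apply: contra tj => /(dvdn_trans (dvdn_mull 4 (dvdnn t))).
by rewrite dvdn_addl // dvdn_mull.
Qed.

Let sgn_even i : (-1) ^+ (j + (2 * i) * t) = (-1) ^+ j :> S.
Proof. by rewrite exprD -mulnA exprM sqrrN !expr1n mulr1. Qed.

Let refl0 : g j * g (4 * t - j) = (-1) ^+ j * p%:R.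
Proof.
apply: (@gauss_reflection_mod _ _ 1); first by clear k_gt0; lia.
by have := ndvd 0; rewrite mul0n addn0.
Qed.
Let refl1 : g (j + t) * g (7 * t - j) = (-1) ^+ (j + t) * p%:R.
Proof.
apply: (@gauss_reflection_mod _ _ 2); first by clear k_gt0; lia.
by have := ndvd 1; rewrite mul1n.
Qed.
Let refl2 : g (j + 2 * t) * g (6 * t - j) = (-1) ^+ (j + 2 * 1 * t) * p%:R.
Proof.
apply: (@gauss_reflection_mod _ _ 2); first by clear k_gt0; lia.
exact: (ndvd 2).
Qed.
Let refl3 : g (j + 3 * t) * g (5 * t - j) = (-1) ^+ (j + 3 * t) * p%:R.
Proof.
apply: (@gauss_reflection_mod _ _ 2); first by clear k_gt0; lia.
exact: (ndvd 3).
Qed.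

Let quad : p%:R ^+ 2 * quad_factor j =
  (-1) ^+ t * g (2 * t) * (g (4 * t - j) * g (5 * t - j) * g (6 * t - j) * g (7 * t - j)).
Proof.
rewrite gauss_quadruplication_dual // -[in LHS]g2t.
have e : (-1) ^+ t * (-1) ^+ t = 1 :> S by rewrite -expr2 sqrr_sign.
transitivity ((-1) ^+ t * (-1) ^+ t * (p%:R * (g (2 * t) * g (2 * t)) * quad_factor j)).
  by rewrite e mul1r g2t; ring.
ring.
Qed.

(** This identity and the next two are forced to carry p^2, which cannot be cancelled. On the left,
    factors p are traded for products g(b) g(-b): one with b = j here, two with b = j and j + 2t for
    [hyper2_term], three with b = j, j + t and j + 3t for [mixed_term]. On the right,
    quadruplication at -j rewrites p^2 [quad_factor j]. *)
Lemma hyper3_generic : - hyper3_term j = p%:R ^+ 2 * (quad_factor j * g j ^+ 4).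
Proof.
rewrite mulrA quad /hyper3_term addnS exprS exprD.
transitivity ((-1) ^+ t * g (2 * t) * ((-1) ^+ j * p%:R) * g j ^+ 3 *
   g (5 * t - j) * g (6 * t - j) * g (7 * t - j)); first by ring.
by rewrite -refl0; ring.
Qed.

Lemma hyper2_generic : - (p%:R ^+ 2 * hyper2_term j) =
  p%:R ^+ 2 * (quad_factor j * (g j ^+ 2 * g (j + 2 * t) ^+ 2)).
Proof.
rewrite [RHS]mulrA quad /hyper2_term (exprS (-1)).
transitivity ((-1) ^+ t * g (2 * t) * (((-1) ^+ j * p%:R) * ((-1) ^+ j * p%:R)) *
   g j * g (j + 2 * t) * g (5 * t - j) * g (7 * t - j)).
  have : (-1) ^+ j * (-1) ^+ j = 1 :> S by rewrite -expr2 sqrr_sign.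
  by move: ((-1) ^+ j) => s es; ring: es.
by rewrite -{1}refl0 -{1}(sgn_even 1) -refl2; ring.
Qed.

Lemma mixed_generic : p%:R ^+ 2 * mixed_term j =
  p%:R ^+ 2 * (quad_factor j * (g j ^+ 2 * g (j + t) * g (j + 3 * t))).
Proof.
rewrite [RHS]mulrA quad /mixed_term.
transitivity ((-1) ^+ t * g (2 * t) * (g j * g (4 * t - j)) * (g (j + t) * g (7 * t - j)) *
   (g (j + 3 * t) * g (5 * t - j)) * g j * g (6 * t - j)); last by ring.
rewrite refl0 refl1 refl3 (exprD (-1) j t) (exprD (-1) j (3 * t)) (mulnC 3 t) (exprM (-1) t 3).
have e a : (-1) ^+ a * (-1) ^+ a = 1 :> S by rewrite -expr2 sqrr_sign.
by move: ((-1) ^+ j) ((-1) ^+ t) (e j) (e t) => s s' es es'; ring: es es'.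
Qed.

End Generic.

(** Open both Gauss sums, 6t - j standing for 2t - j modulo 4t. Summing over j forces y = -x u by
    orthogonality, and there remains the sum over x of the quadratic character of x times psi ((1-u)
    x), which is g(2t) times the quadratic character of 1 - u. The outer g(2t) completes g(2t)^2 =
    p. *)
Lemma sum_mixed u : u != 0 -> W (2 * t) u = 1 ->
  \sum_(j < 4 * t) iota (W j u) * mixed_term j =
  (-1) ^+ t * p%:R ^+ 2 * (4 * t)%:R * iota (W (2 * t) (1 - u)).
Proof.
move=> u0 Wu.
have E (j : 'I_(4 * t)) : (-1) ^+ j * g j * g (6 * t - j) * iota (W j u) =
    \sum_(x | x != 0) \sum_(y | y != 0)
      iota (W j (- x * u / y)) * (iota (W (2 * t) y) * psi (x + y)).
  have gs a : g a = \sum_(x | x != 0) iota (W a x) * psi x.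
    by rewrite /g /gauss (bigD1 0) //= omegabar0 rmorph0 mul0r add0r.
  transitivity (g j * g (6 * t - j) * ((-1) ^+ j * iota (W j u))); first by ring.
  rewrite !gs big_distrlr mulr_suml; apply: eq_bigr => x x0.
  rewrite mulr_suml; apply: eq_bigr => y y0.
  have -> : W (6 * t - j) y = W (2 * t) y * W j y^-1.
    have e1 := omegabarV p_prime k_gt0 j y0.
    have e2 : W (6 * t - j) y * W j y = W (2 * t) y.
      rewrite -omegabarD subnK; last by have := ltn_ord j; clear k_gt0; lia.
      by rewrite -(omegabar_mod p_prime k_gt0 p1E (2 * t) 1); congr (W _ _); clear k_gt0; lia.
    by rewrite -e2 -mulrA e1 mulr1.
  rewrite psiD -[- x]mulN1r !omegabarM // (omegabarN1 p_prime p_gt4 k_gt0) !rmorphM.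
  by rewrite rmorphXn rmorphN1 /=; ring.
have S0 : \sum_(j < 4 * t) (-1) ^+ j * g j * g (6 * t - j) * iota (W j u) =
    (4 * t)%:R * (iota (W (2 * t) (1 - u)) * g (2 * t)).
  rewrite (eq_bigr _ (fun j _ => E j)) exchange_big /=.
  transitivity (\sum_(x | x != 0) (4 * t)%:R * (iota (W (2 * t) x) * psi ((1 - u) * x))).
    apply: eq_bigr => x x0; rewrite exchange_big /=.
    have xu : - x * u != 0 by rewrite mulf_neq0 // oppr_eq0.
    rewrite (bigD1 (- x * u)) //= [X in _ + X]big1 ?addr0 => [|y /andP [y0 yx]].
      rewrite -mulr_suml -rmorph_sum -p1E divff // (sum_omegabar_dual p_prime k_gt0 (oner_neq0 _)).
      rewrite eqxx mul1r rmorph_nat -[- x]mulN1r !omegabarM // Wu mulr1.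
      rewrite (omegabarN1 p_prime p_gt4 k_gt0) exprM sqrrN !expr1n mul1r.
      by congr (_ * (_ * psi _)); ring.
    have xy : - x * u / y != 0 by rewrite mulf_neq0 ?invr_eq0.
    rewrite -mulr_suml -rmorph_sum -p1E (sum_omegabar_dual p_prime k_gt0 xy).
    rewrite (_ : (_ == 1) = false) ?mul0r ?rmorph0 ?mul0r //.
    by apply: contraNF yx => /eqP e; rewrite -[- x * u](divfK y0) e mul1r.
  rewrite -mulr_sumr; congr (_ * _); have [e|u1] := eqVneq (1 - u) 0.
    rewrite e omegabar0 rmorph0 mul0r.
    under eq_bigr => x _ do rewrite mul0r psi0 mulr1.
    rewrite -rmorph_sum -(rmorph0 iota); congr (iota _).
    have nd : ~~ (p.-1 %| 2 * t)%N by rewrite p1E gtnNdvd; clear k_gt0; lia.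
    by rewrite -[RHS](sum_omegabar p_prime k_gt0 nd) [RHS](bigD1 0) //= omegabar0 add0r.
  rewrite (gauss_twist p_prime k_gt0) //; congr (iota _ * _).
  have e := omegabarV p_prime k_gt0 (2 * t) u1.
  have e2 : W (2 * t) (1 - u) * W (2 * t) (1 - u) = 1.
    by rewrite -omegabarD -mulnDl (_ : (2 + 2) * t = p.-1)%N ?omegabar_pred // p1E.
  by rewrite -[LHS]mul1r -e2 -mulrA e mulr1.
transitivity ((-1) ^+ t * p%:R * g (2 * t) *
    \sum_(j < 4 * t) (-1) ^+ j * g j * g (6 * t - j) * iota (W j u)).
  by rewrite mulr_sumr; apply: eq_bigr => j _; rewrite /mixed_term exprD; ring.
by rewrite S0; ring: g2t.
Qed.

Let F l : S := 12%:R * p%:R ^+ 2 * mixed_term l - hyper3_term l - 3%:R * p%:R ^+ 2 * hyper2_term l.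
Let Q j := quartic_form (g j) (g (j + t)) (g (j + 2 * t)) (g (j + 3 * t)).

(** With a_i = g(i t + j), periodic in i of period 4, the sum over i is a cyclic symmetrization: it
    yields the four mixed monomials with coefficient 12, and counts each a_i^2 a_(i+2)^2 twice, so
    that 3 becomes the 6 of [quartic_form]. *)
Lemma block_generic j : (0 < j < t)%N ->
  \sum_(i < 4) F (i * t + j) = p%:R ^+ 2 * (iota (W (j * 4) 4%:R) * g (4 * t - j * 4) * Q j).
Proof.
move=> /andP [j0 jt]; pose a i := g (i * t + j).
have A i m : g (i * t + j + m * t) = a (i + m)%N by congr (g _); clear k_gt0; nia.
have a4 i : a (4 + i)%N = a i by apply: (@gauss_eqmod _ _ 1); clear k_gt0; nia.
have K i : (i < 4)%N -> quad_factor (i * t + j) = iota (W (j * 4) 4%:R) * g (4 * t - j * 4).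
  move=> i4; congr (iota _ * _).
    rewrite -(omegabar_mod p_prime k_gt0 p1E (j * 4) i); congr (W _ _).
    by clear k_gt0; nia.
  apply: (@gauss_eqmod _ _ (3 - i)).
  by case: i i4 => [|[|[|[|i]]]] //= _; clear k_gt0; lia.
have FE i : (i < 4)%N -> F (i * t + j) = p%:R ^+ 2 * (iota (W (j * 4) 4%:R) * g (4 * t - j * 4)) *
    (12%:R * (a i ^+ 2 * a (i + 1)%N * a (i + 3)%N) + a i ^+ 4 + 3%:R * (a i ^+ 2 * a (i + 2)%N ^+ 2)).
  move=> i4; have l_lt : (i * t + j < 4 * t)%N.
    have : (i.+1 * t <= 4 * t)%N by rewrite leq_mul2r i4 orbT.
    by rewrite mulSn; clear k_gt0; lia.
  have tl : ~~ (t %| i * t + j)%N by rewrite dvdn_addr ?dvdn_mull // gtnNdvd.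
  rewrite -(K i i4) -!A mul1n -/(a i).
  transitivity (12%:R * (p%:R ^+ 2 * mixed_term (i * t + j)) + (- hyper3_term (i * t + j))
    + 3%:R * (- (p%:R ^+ 2 * hyper2_term (i * t + j)))); first by rewrite /F; ring.
  by rewrite mixed_generic // hyper3_generic // hyper2_generic //; rewrite -/(a i); ring.
rewrite !big_ord_recl big_ord0 /= !FE //= -[Q j]/(quartic_form _ _ _ _).
have -> : g j = a 0%N by [].
have -> : g (j + t) = a 1%N by rewrite /a mul1n addnC.
have -> : g (j + 2 * t) = a 2 by rewrite /a addnC.
have -> : g (j + 3 * t) = a 3 by rewrite /a addnC.
rewrite (a4 0%N) (a4 1%N) (a4 2) /quartic_form; ring.
Qed.

(** The product g(0) g(4t) is 1 and not p, and the correction term of [affine_count] makes up for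
    it; -Q 0 comes from g(4t) = -1. After substituting g(0) = -1 and 4t = p-1 this is a polynomial
    identity modulo g(2t)^2 = p, g(t) g(3t) = (-1)^t p and the square of (-1)^t being 1. *)
Lemma block_special :
  \sum_(i < 4) F (i * t) = p%:R ^+ 2 *
    ((4 * t)%:R * (quartic_form 0 (g t) (g (2 * t)) (g (3 * t)) - Q 0) - Q 0).
Proof.
have A0 : g 0 = -1 := gauss0 p_prime p_gt4 k_gt0 p1E gk.
have A4 : g (4 * t) = -1 by rewrite -A0; apply: (@gauss_eqmod _ _ 1); rewrite mul1n.
have A5 : g (5 * t) = g t by apply: (@gauss_eqmod _ _ 1); clear k_gt0; lia.
have A6 : g (6 * t) = g (2 * t) by apply: (@gauss_eqmod _ _ 1); clear k_gt0; lia.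
have A7 : g (7 * t) = g (3 * t) by apply: (@gauss_eqmod _ _ 1); clear k_gt0; lia.
have A13 : g t * g (3 * t) = (-1) ^+ t * p%:R.
  have := gauss_reflection p_prime p_gt4 k_gt0 p1E piE gk (a := t).
  by rewrite (_ : 4 * t - t = 3 * t)%N; [apply; clear k_gt0; lia | clear k_gt0; lia].
have e : (-1) ^+ t * (-1) ^+ t = 1 :> S by rewrite -expr2 sqrr_sign.
have pE : p%:R = 1 + (4 * t)%:R :> S by rewrite -p1E -(natrD _ 1) add1n prednK ?prime_gt0.
have FE i : F (i * t) =
    12%:R * p%:R ^+ 2 * (((-1) ^+ t) ^+ i.+1 * p%:R * (g (2 * t) * g (i * t) * g ((6 - i) * t)))
    + ((-1) ^+ t) ^+ i.+1 * p%:R *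
      (g (2 * t) * g (i * t) ^+ 3 * g ((5 - i) * t) * g ((6 - i) * t) * g ((7 - i) * t))
    + 3%:R * p%:R ^+ 2 *
      ((-1) ^+ t * (g (2 * t) * g (i * t) * g ((i + 2) * t) * g ((5 - i) * t) * g ((7 - i) * t))).
  have e1 : (-1) ^+ (i * t + t) = ((-1) ^+ t) ^+ i.+1 :> S by rewrite -mulSnr mulnC exprM.
  have e2 : (-1) ^+ (i * t + t.+1) = - ((-1) ^+ t) ^+ i.+1 :> S by rewrite addnS (exprS (-1)) mulN1r e1.
  by rewrite /F /mixed_term /hyper3_term /hyper2_term e1 e2 (exprS (-1)) -!mulnBl -!mulnDl; ring.
transitivity (F (0 * t) + (F (1 * t) + (F (2 * t) + (F (3 * t) + 0)))).
  by rewrite !big_ord_recl big_ord0.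
rewrite !FE.
rewrite -[(6 - 0)%N]/6%N -[(5 - 0)%N]/5%N -[(7 - 0)%N]/7%N -[(0 + 2)%N]/2%N.
rewrite -[(6 - 1)%N]/5%N -[(5 - 1)%N]/4%N -[(7 - 1)%N]/6%N -[(1 + 2)%N]/3%N.
rewrite -[(6 - 2)%N]/4%N -[(5 - 2)%N]/3%N -[(7 - 2)%N]/5%N -[(2 + 2)%N]/4%N.
rewrite -[(6 - 3)%N]/3%N -[(5 - 3)%N]/2%N -[(7 - 3)%N]/4%N -[(3 + 2)%N]/5%N.
rewrite mul0n mul1n A0 A4 A5 A6 A7 /Q !add0n A0 /quartic_form.
have -> : (4 * t)%:R = p%:R - 1 :> S by rewrite pE addrC addKr.
move: (g (2 * t)) (g t) (g (3 * t)) ((-1) ^+ t) (p%:R : S) g2t A13 e => A2 A1 A3 s P h2 h13 hs.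
ring: h2 h13 hs.
Qed.


Variable lam : 'F_p.
Hypothesis lam_neq0 : lam != 0.

Lemma dwork_mixed_sum :
  p%:R ^+ 2 * (p%:R * #|dwork_affine lam|%:R) = p%:R ^+ 6 +
  \sum_(l < 4 * t) iota (W l (lam ^+ 4)) * F l.
Proof.
rewrite (affine_count p_prime p_gt4 k_gt0 p1E psi0 psiD gk lam_neq0) -/g.
rewrite (sum_block_ord (fun l => iota (W l (lam ^+ 4)) * F l)) exchange_big /=.
have WE i j : W (i * t + j) (lam ^+ 4) = W (j * 4) lam.
  rewrite omegabarX // -(omegabar_mod p_prime k_gt0 p1E (j * 4) i); congr (W _ _).
  by rewrite mulnDl addnC -mulnA (mulnC t).
under [X in _ = _ + X]eq_bigr => j _.
  under eq_bigr => i _ do rewrite WE.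
  rewrite -mulr_sumr; over.
rewrite (bigD1 (Ordinal t_gt0)) //= [in RHS](bigD1 (Ordinal t_gt0)) //=.
have lam1 : W 0 lam = 1 by rewrite omegabar_zero lam_neq0.
have l41 : W 0 (4%:R * lam) = 1 by rewrite omegabar_zero mulf_neq0 // four_neq0.
have g4t : g (4 * t) = -1.
  rewrite -[RHS](gauss0 p_prime p_gt4 k_gt0 p1E gk); apply: (@gauss_eqmod _ _ 1).
  by rewrite mul1n.
rewrite mul0n subn0 lam1 l41 rmorph1 g4t.
have -> : \sum_(i < 4) F (i * t + 0) = \sum_(i < 4) F (i * t).
  by apply: eq_bigr => i _; rewrite addn0.
rewrite block_special -/(Q 0).
rewrite [X in _ = _ + (_ + X)](eq_bigr (fun j : 'I_t => p%:R ^+ 2 *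
  (g (4 * t - j * 4) * iota (W (j * 4) (4%:R * lam)) * Q j))) => [|j j0].
  rewrite -mulr_sumr; move: (\sum_(j < t | _) _) (quartic_form _ _ _ _) (Q 0) => X Y Z; ring.
rewrite block_generic; last first.
  by rewrite ltn_ord andbT lt0n; apply: contraNneq j0 => e; apply/eqP/val_inj.
by rewrite omegabarM // rmorphM -/(Q j); ring.
Qed.

Let p1_unit : (p.-1)%:R \is a @GRing.unit R.
Proof. by apply: natZ_unit; rewrite ?coprime_p1 // prime_gt1. Qed.

Let sgn_pow E (x : R) : (-1) ^+ E * p%:R ^+ (2 + E) * x = x * (- p%:R) ^+ (2 + E).
Proof. by rewrite [(- p%:R) ^+ _]exprNn (exprD (-1)) sqrrN expr1n mul1r mulrC. Qed.

Lemma Gscaled3E u : iota ((4 * t)%:R * Gscaled p k 3 [:: 1/4; 2/4; 3/4] [:: 0; 0; 0] u) =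
  - \sum_(l < 4 * t) iota (W l u) * hyper3_term l.
Proof.
rewrite /Gscaled p1E mulrA mulrN divrr -?p1E // mulN1r rmorphN rmorph_sum p1E; congr (- _).
apply: eq_bigr => j _; rewrite (Gexp3 p_prime p_gt4 p1E) // -PoszD ?absz_nat.
set E := (_ + _ + _)%N; have h := gauss_Gfactor3 (ltn_ord j); rewrite -/E in h.
(* Of the scaling p^3, two factors are absorbed in (-p)^(2+E); the third one and (-1)^(3j) = (-1)^j
   belong to [hyper3_term]. *)
transitivity (iota (W j u * (-1) ^+ j * p%:R) *
    iota (Gfactor p k [:: 1/4; 2/4; 3/4] [:: 0; 0; 0] j * (- p%:R) ^+ (2 + E))).
  rewrite -rmorphM; congr (iota _); rewrite -sgn_pow (exprM (-1) j 3) (exprD _ 3).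
  rewrite (exprD _ 2 E).
  have e : (-1) ^+ j * (-1) ^+ j = 1 :> R by rewrite -expr2 sqrr_sign.
  by move: ((-1) ^+ j) e => s e; ring: e.
rewrite h !rmorphM rmorphXn rmorphN1 rmorph_nat /hyper3_term exprD; ring.
Qed.

Lemma Gscaled2E u : iota ((4 * t)%:R * Gscaled p k 2 [:: 3/4; 1/4] [:: 0; 2/4] u) =
  - \sum_(l < 4 * t) iota (W l u) * hyper2_term l.
Proof.
rewrite /Gscaled p1E mulrA mulrN divrr -?p1E // mulN1r rmorphN rmorph_sum p1E; congr (- _).
apply: eq_bigr => j _; rewrite (Gexp2 p_prime p_gt4 p1E) // -PoszD ?absz_nat.
set E := (_ - _)%N; have h := gauss_Gfactor2 (ltn_ord j); rewrite -/E in h.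
transitivity (iota (W j u) *
    iota (Gfactor p k [:: 3/4; 1/4] [:: 0; 2/4] j * (- p%:R) ^+ (2 + E))).
  rewrite -rmorphM; congr (iota _); rewrite -sgn_pow (exprM (-1) j 2) sqrr_sign; ring.
by rewrite h /hyper2_term; ring.
Qed.

Lemma dwork_count_padic :
  (p ^ 3 * dwork_count p lam)%N%:R = (p ^ 3 * (p ^ 2 + p + 1))%N%:R
    + (12 * p ^ 4)%N%:R * ((-1) ^+ t * W (2 * t) (1 - lam ^+ 4))
    + Gscaled p k 3 [:: 1/4; 2/4; 3/4] [:: 0; 0; 0] (lam ^+ 4)
    + (3 * p ^ 2)%N%:R * Gscaled p k 2 [:: 3/4; 1/4] [:: 0; 2/4] (lam ^+ 4) :> R.
Proof.
have iota_inj x y : iota x = iota y -> x = y.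
  move=> e; apply/eqP; rewrite -subr_eq0; apply/eqP/(@free 0); first by rewrite p1E muln_gt0.
  by rewrite expr0 mul1r rmorphB e subrr.
have l4 : lam ^+ 4 != 0 by rewrite expf_neq0.
have Wl : W (2 * t) (lam ^+ 4) = 1.
  rewrite omegabarX // (_ : 2 * t * 4 = 2 * (4 * t))%N; last by clear k_gt0; lia.
  by rewrite -omegabarX ?lam_neq0 ?orbT // -p1E Fp_exp_pred // omegabar1.
(* Multiplication by p-1 brings in the affine count: p^2 p (1 + (p-1) n) - p^3 = (p-1) p^3 n for n
   projective points, and p^6 - p^3 = (p-1) p^3 (p^2 + p + 1). *)
apply: (mulrI p1_unit); rewrite p1E; apply: iota_inj.
have G3 := Gscaled3E (lam ^+ 4); have G2 := Gscaled2E (lam ^+ 4).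
have M := sum_mixed l4 Wl; have D := dwork_mixed_sum.
have SF : \sum_(l < 4 * t) iota (W l (lam ^+ 4)) * F l =
    12%:R * p%:R ^+ 2 * (\sum_(l < 4 * t) iota (W l (lam ^+ 4)) * mixed_term l)
    + (- \sum_(l < 4 * t) iota (W l (lam ^+ 4)) * hyper3_term l)
    + 3%:R * p%:R ^+ 2 * (- \sum_(l < 4 * t) iota (W l (lam ^+ 4)) * hyper2_term l).
  rewrite mulrN !mulr_sumr -!sumrB; apply: eq_bigr => l _; rewrite /F; ring.
rewrite SF M -G3 -G2 (card_dwork_affine lam p_prime) p1E in D.
move: (Gscaled p k 3 _ _ _) (Gscaled p k 2 _ _ _) D => Y3 Y2 D {SF M G3 G2}.
have e : (1 + 4 * t)%N%:R = p%:R :> S by rewrite -p1E add1n prednK ?prime_gt0.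
transitivity (p%:R ^+ 2 * (p%:R * (1 + 4 * t * dwork_count p lam)%N%:R) - p%:R ^+ 3 : S).
  rewrite !rmorphM !rmorph_nat -!natrX -!natrM; ring.
rewrite D !rmorphM !rmorphD !rmorphM rmorphXn rmorphN1 !rmorph_nat.
move: (iota Y3) (iota Y2) (iota (W _ _)) ((-1) ^+ t) e => y3 y2 w s e.
have {}e : p%:R = 1 + 4%:R * t%:R :> S by rewrite -e natrD natrM.
ring: e.
Qed.

End Assembly.

(** * The quadratic character *)

(** T has complex values and the Teichmueller powers have p-adic ones, so they are compared through
    an integer: 0 at y = 0, and (-1)^e at y = w^e with w a primitive root, since both quadratic
    characters are -1 at w. As w^(2t) = -1, the same computation gives T(-1) = -1. *)
Lemma quadratic_sign (p t : nat) (T : 'F_p -> algC) (y : 'F_p) :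
  prime p -> p.-1 = (4 * t)%N ->
  T 0 = 0 -> T 1 = 1 -> (forall u v, T (u * v) = T u * T v) ->
  (exists u : 'F_p, u != 0 /\ T u ^+ (2 * t) != 1) ->
  T (-1) = -1 /\
  exists z : int, T y ^+ (2 * t) = z%:~R /\
    forall k, (0 < k)%N -> omegabar_pow p k (2 * t) y = z%:~R.
Proof.
move=> p_prime p1E T0 T1 TM [u [u0 Tu]].
have t_gt0 : (0 < t)%N by have := prime_gt1 p_prime; lia.
have p_gt4 : (4 < p)%N by lia.
have [w wp] := Fp_prim_root p_prime; have w0 := Fp_prim_root_neq0 p_prime wp.
have TX x n : T (x ^+ n) = T x ^+ n.
  by elim: n => [|n IH]; rewrite ?expr0 // !exprS TM IH.
have sgn (x : 'F_p) : x ^+ 2 = 1 -> x != 1 -> x = -1.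
  by move=> /eqP; rewrite -subr_eq0 subr_sqr_1 mulf_eq0 subr_eq0 addr_eq0 => /orP [/eqP -> /eqP|/eqP].
have dlog x : x != 0 -> exists e, x = w ^+ e.
  move=> x0; have /(prim_rootP wp) [e ->] : x ^+ p.-1 = 1 by apply: Fp_exp_pred.
  by exists e.
have w2t : w ^+ (2 * t) = -1.
  apply: sgn.
    by rewrite -exprM (_ : 2 * t * 2 = p.-1)%N ?(prim_expr_order wp) // p1E; lia.
  by rewrite -(prim_order_dvd wp) p1E gtnNdvd; lia.
have Tw : T w ^+ (2 * t) = -1.
  have : (T w ^+ (2 * t)) ^+ 2 == 1.
    by rewrite -exprM -TX (_ : 2 * t * 2 = p.-1)%N ?(prim_expr_order wp) ?T1 // p1E; lia.
  rewrite sqrf_eq1 => /orP [/eqP e|/eqP //].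
  have [a ua] := dlog _ u0; move: Tu; rewrite ua TX exprAC e expr1n.
  by rewrite eqxx.
split; first by rewrite -w2t TX Tw.
have [->|y0] := eqVneq y 0.
  by exists 0; rewrite T0 expr0n muln_eq0 -[t == 0]negbK -lt0n t_gt0.
have [e ->] := dlog _ y0; exists ((-1) ^+ e).
rewrite TX exprAC Tw rmorphXn rmorphN1; split=> // k k0.
rewrite omegabarX ?w0 ?orbT // mulnC -(@omegabarX p k p_prime k0 e) ?w0 ?orbT //.
by rewrite w2t (omegabarN1 p_prime p_gt4 k0) rmorphXn rmorphN1.
Qed.

Unset Implicit Arguments.

Theorem theorem3 (p : nat) (Hp : prime p) (Hp4 : (p %% 4 = 1)%N)
  (T : 'F_p -> algC)
  (T0 : T 0 = 0) (T1 : T 1 = 1) (Tmul : forall x y, T (x * y) = T x * T y)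
  (Tgen : forall m : nat, (0 < m < p.-1)%N ->
            exists x : 'F_p, x != 0 /\ T x ^+ m != 1)
  (lam : 'F_p) (Hlam : lam != 0) :
  let t := (p.-1 %/ 4)%N in
  exists z : int,
    (z%:~R : algC) = T (-1) ^+ t * T (1 - lam ^+ 4) ^+ (2 * t) /\
    forall k : nat, (0 < k)%N ->
      ((p ^ 3 * dwork_count p lam)%N%:R : 'Z_(p ^ k)) =
        ((p ^ 3 * ((p ^ 3 - 1) %/ (p - 1)))%N%:R
        + (12 * p ^ 4)%N%:R * z%:~R
        + Gscaled p k 3 [:: 1/4; 2/4; 3/4] [:: 0; 0; 0] (lam ^+ 4)
        + (3 * p ^ 2)%N%:R * Gscaled p k 2 [:: 3/4; 1/4] [:: 0; 2/4] (lam ^+ 4)).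
Proof.
move=> t.
have p_gt1 := prime_gt1 Hp.
have p1E : p.-1 = (4 * t)%N by rewrite /t; clear T T0 T1 Tmul Tgen lam Hlam; lia.
have p_gt4 : (4 < p)%N by clear T T0 T1 Tmul Tgen lam Hlam; lia.
have m_lt : (0 < 2 * t < p.-1)%N by clear T T0 T1 Tmul Tgen lam Hlam; lia.
have [TN1 [z [zE Wz]]] :=
  @quadratic_sign p t T (1 - lam ^+ 4) Hp p1E T0 T1 Tmul (Tgen _ m_lt).
exists ((-1) ^+ t * z); split.
  by rewrite TN1 zE rmorphM rmorphXn rmorphN1.
move=> k k_gt0.
have [S [iota [pi [psi [free piE psi0 psiD gk]]]]] 
  := @gross_koblitz p Hp p_gt4 k k_gt0.
have -> : ((p ^ 3 - 1) %/ (p - 1) = p ^ 2 + p + 1)%N.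
  have -> : (p ^ 3 - 1 = (p ^ 2 + p + 1) * (p - 1))%N.
    by rewrite -[in RHS](subnK (ltnW p_gt1)) addnK -{1}(subnK (ltnW p_gt1)); lia.
  by rewrite mulnK // subn_gt0.
rewrite (dwork_count_padic Hp p_gt4 k_gt0 p1E free piE psi0 psiD gk Hlam).
by rewrite intrM rmorphXn rmorphN1 Wz.
Qed.
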